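(* Suppose that $\Omega$ is either the flat torus $\mathbb T^d$ or a smooth convex set $\Omega=\{h<0\}$ parameterized as a level set of a smooth convex function $h$. Let $v_t:\Omega\to\mathbb R^d$, $t\in[0,T]$, be a vector field, Lipschitz and bounded in space, uniformly in time; in the case of a convex domain suppose $v\cdot n=0$ on $\partial\Omega$. Then there exists a constant $C>0$ (depending on $v$ and $\Omega$) such that, for every $\varepsilon>0$, setting $H(z):=\sqrt{\varepsilon^2+|z|^2}$ for $z\in\mathbb R^d$, the (sufficiently smooth) solution $\rho_t$ of the Fokker-Planck equation $\partial_t\rho_t-\Delta\rho_t+\nabla\cdot(\rho_tv_t)=0$ with homogeneous Neumann boundary condition satisfies, for $t\in[0,T]$, $$\int_\Omega H(\nabla\rho_t)\,dx\le\int_\Omega H(\nabla\rho_0)\,dx+C\varepsilon t+\frac C\varepsilon\int_0^t\|\rho_s\|_{L^\infty}^2\,ds .$$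
   Context: In the convex case $\Omega$ is bounded, and $n$ is its outward unit normal. $\rho_t$ is a curve of probability densities on $\Omega$ with initial datum $\rho_0$; the homogeneous Neumann condition is $\nabla\rho_t\cdot n=0$ on $\partial\Omega$ (equivalent to the no-flux condition $(\nabla\rho_t-\rho_tv_t)\cdot n=0$ since $v\cdot n=0$); there is no boundary condition on the torus. ''Sufficiently smooth'' means smooth enough that the derivatives of $\rho$ used below the integral signs and in integrations by parts are classical. *)

(* Defs.v *)
From HB Require Import structures.
From mathcomp Require Import all_boot all_order all_algebra.
From mathcomp Require Import all_classical all_reals all_analysis.

Set Implicit Arguments.
Unset Strict Implicit.
Unset Printing Implicit Defensive.
Import Order.TTheory GRing.Theory Num.Theory.
Import numFieldNormedType.Exports.
Local Open Scope classical_set_scope.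
Local Open Scope ring_scope.

(* The library has no Lebesgue measure on R^n: it is built here on n-tuples by
   iterating the product with the one-dimensional measure, then transported to
   row vectors (see lebesgue_rvec_box). *)
Section lebesgue_measure_tuple.
Context {R : realType}.
Local Notation tup n := (n.-tuple (measurableTypeR R)).

Section cons_measure.
Variables (n : nat) (m : {sigma_finite_measure set (tup n) -> \bar R}).

Let f (p : measurableTypeR R * tup n) : tup n.+1 :=
  [the n.+1.-tuple _ of p.1 :: p.2].

Let mf : measurable_fun [set: measurableTypeR R * tup n] f.
Proof. exact: measurable_cons. Qed.

Definition cons_measure : set (tup n.+1) -> \bar R :=
  pushforward (@lebesgue_measure R \x m)%E f.

Let cons_measure0 : cons_measure set0 = 0%E.
Proof. by rewrite /cons_measure /pushforward preimage_set0 measure0. Qed.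

Let cons_measure_ge0 A : (0 <= cons_measure A)%E.
Proof. exact: measure_ge0. Qed.

Let cons_measure_sigma_additive : semi_sigma_additive cons_measure.
Proof.
move=> F mF tF mUF; rewrite /cons_measure /pushforward preimage_bigcup.
apply: measure_semi_sigma_additive.
- by move=> k; rewrite -[X in measurable X]setTI; exact: mf.
- apply/trivIsetP => /= i j _ _ ij; rewrite -preimage_setI.
  by move/trivIsetP : tF => /(_ _ _ _ _ ij) ->//; rewrite preimage_set0.
- by rewrite -preimage_bigcup -[X in measurable X]setTI; exact: mf.
Qed.

HB.instance Definition _ := isMeasure.Build _ _ _ cons_measure
  cons_measure0 cons_measure_ge0 cons_measure_sigma_additive.

Let cons_measure_sigma_finite : sigma_finite setT cons_measure.
Proof.
have /sigma_finiteP[F [TF ndF Foo]] := sigma_finiteT (@lebesgue_measure R).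
have /sigma_finiteP[G [TG ndG Goo]] := sigma_finiteT m.
pose g (t : tup n.+1) : measurableTypeR R * tup n :=
  (tnth t ord0, [tuple of behead t]).
have mg : measurable_fun setT g.
  apply: measurable_fun_pair; first exact: measurable_tnth.
  exact: measurable_behead.
have fK p : g (f p) = p.
  by case: p => x t; rewrite /g /f /=; congr (_, _); exact/val_inj.
exists (fun k => g @^-1` (F k `*` G k)).
  rewrite -preimage_bigcup -(preimage_setT g); congr (_ @^-1` _).
  rewrite -setXTT TF TG predeqE => -[x y]; split.
    move=> [/= [k _ Fkx] [l _ Gly]]; exists (maxn k l) => //; split.
    - by move: x Fkx; exact/subsetPset/ndF/leq_maxl.
    - by move: y Gly; exact/subsetPset/ndG/leq_maxr.
  by move=> [k _ []/= ? ?]; split; exists k.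
move=> k; have [mF Fk] := Foo k; have [mG Gk] := Goo k; split.
  by rewrite -[X in measurable X]setTI; apply: mg => //; exact: measurableX.
rewrite /cons_measure /pushforward (_ : f @^-1` _ = F k `*` G k); last first.
  by apply/funext => p; rewrite -[in RHS](fK p).
by rewrite product_measure1E// lte_mul_pinfty// ge0_fin_numE.
Qed.

HB.instance Definition _ := Measure_isSigmaFinite.Build _ _ _ cons_measure
  cons_measure_sigma_finite.

End cons_measure.

Fixpoint lebesgue_tuple n : {sigma_finite_measure set (tup n) -> \bar R} :=
  if n is n'.+1 then cons_measure (lebesgue_tuple n')
  else dirac [tuple].



Lemma lebesgue_tuple_box n (A : 'I_n -> set (measurableTypeR R)) :
  (forall i, measurable (A i)) ->
  lebesgue_tuple n [set t | forall i, A i (tnth t i)] =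
  (\prod_(i < n) lebesgue_measure (A i))%E.
Proof.
elim: n A => [|n IHn] A mA.
  by rewrite big_ord0 /= diracE mem_set//= => -[].
rewrite big_ord_recl -IHn//= /cons_measure /pushforward -product_measure1E//=.
  congr (product_measure1 _ _ _); apply/seteqP; split => [[x t]|[x t]] /= At.
    by split=> [|i]; [exact: (At ord0)|have := At (lift ord0 i); rewrite tnthS].
  move=> i; case: (unliftP ord0 i) => [j ->|->].
    by rewrite tnthS; exact: At.2.
  exact: At.1.
rewrite (_ : [set _ | _] = \bigcap_(i in [set: 'I_n])
   ((fun t => tnth t i) @^-1` A (lift ord0 i))).
  apply: fin_bigcap_measurable => // i _.
  by rewrite -[X in measurable X]setTI; exact: measurable_tnth.
by apply/seteqP; split => t /= At i; [move=> _; exact: At|exact: At].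
Qed.

Definition tuple_of_row n (v : 'rV[R]_n) : tup n := [tuple v ord0 i | i < n].
Definition row_of_tuple n (t : tup n) : 'rV[R]_n := \row_i tnth t i.

(* 'rV[R]_n with the sigma-algebra generated by the coordinates, i.e. the Borel
   sigma-algebra; convertible to 'rV[R]_n. *)
Definition rvec n := g_sigma_algebra_preimageType (@tuple_of_row n).

Lemma row_of_tupleK n : cancel (@row_of_tuple n) (@tuple_of_row n).
Proof. by move=> t; apply: eq_from_tnth => i; rewrite tnth_mktuple mxE. Qed.

Lemma measurable_row_of_tuple n :
  measurable_fun [set: tup n] (@row_of_tuple n : tup n -> rvec n).
Proof.
move=> _ _ [B mB <-]; rewrite !setTI -comp_preimage.
rewrite (_ : _ @^-1` B = B)//.
by apply/funext => t; rewrite /preimage /= row_of_tupleK.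
Qed.

Section lebesgue_rvec.
Variable n : nat.

Definition lebesgue_rvec : set (rvec n) -> \bar R :=
  pushforward (lebesgue_tuple n) (@row_of_tuple n : tup n -> rvec n).

Let lebesgue_rvec0 : lebesgue_rvec set0 = 0%E.
Proof. by rewrite /lebesgue_rvec /pushforward preimage_set0 measure0. Qed.

Let lebesgue_rvec_ge0 A : (0 <= lebesgue_rvec A)%E.
Proof. by rewrite /lebesgue_rvec /pushforward measure_ge0. Qed.

Let lebesgue_rvec_sigma_additive : semi_sigma_additive lebesgue_rvec.
Proof.
move=> F mF tF mUF; rewrite /lebesgue_rvec /pushforward preimage_bigcup.
have mf := @measurable_row_of_tuple n.
apply: measure_semi_sigma_additive.
- by move=> k; rewrite -[X in measurable X]setTI; exact: mf.
- apply/trivIsetP => /= i j _ _ ij; rewrite -preimage_setI.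
  by move/trivIsetP : tF => /(_ _ _ _ _ ij) ->//; rewrite preimage_set0.
- by rewrite -preimage_bigcup -[X in measurable X]setTI; exact: mf.
Qed.

HB.instance Definition _ := isMeasure.Build _ _ _ lebesgue_rvec
  lebesgue_rvec0 lebesgue_rvec_ge0 lebesgue_rvec_sigma_additive.

Let lebesgue_rvec_sigma_finite : sigma_finite setT lebesgue_rvec.
Proof.
have [F FT Foo] := sigma_finiteT (lebesgue_tuple n).
exists (fun k => @tuple_of_row n @^-1` F k).
  by rewrite -preimage_bigcup -FT preimage_setT.
move=> k; have [mF Fk] := Foo k; split.
  by exists (F k) => //; rewrite setTI.
rewrite /lebesgue_rvec /pushforward (_ : _ @^-1` _ = F k)//.
by apply/funext => t; rewrite /preimage /= row_of_tupleK.
Qed.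

HB.instance Definition _ := Measure_isSigmaFinite.Build _ _ _ lebesgue_rvec
  lebesgue_rvec_sigma_finite.

Lemma lebesgue_rvec_box (A : 'I_n -> set (measurableTypeR R)) :
  (forall i, measurable (A i)) ->
  lebesgue_rvec [set v | forall i, A i (v ord0 i)] =
  (\prod_(i < n) lebesgue_measure (A i))%E.
Proof.
move=> mA; rewrite -lebesgue_tuple_box// /lebesgue_rvec /pushforward.
congr (lebesgue_tuple n _); apply/seteqP; split => t /= At i.
  by have := At i; rewrite mxE.
by rewrite mxE.
Qed.

End lebesgue_rvec.
End lebesgue_measure_tuple.

Arguments lebesgue_rvec {R} n.
Arguments rvec R n : clear implicits.

Section calculus.
Context {R : realType} {d : nat}.
Local Notation V := 'rV[R]_d.
Implicit Types (f : V -> R) (w : V -> V) (x y z : V) (D : set V).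

Definition basis_vec (i : 'I_d) : V := delta_mx ord0 i.

Definition partial (i : 'I_d) f x : R := 'D_(basis_vec i) f x.

Definition partials (s : seq 'I_d) f : V -> R := foldr partial f s.

Definition grad f x : V := \row_i partial i f x.

Definition divergence w x : R := \sum_i partial i (fun y => w y ord0 i) x.

Definition laplacian f x : R := divergence (grad f) x.

Definition dotp (x y : V) : R := \sum_i x ord0 i * y ord0 i.

(* The library norm `|x| on 'rV[R]_d is the sup norm. *)
Definition enorm x : R := Num.sqrt (dotp x x).

Definition smooth f :=
  forall s, continuous (partials s f) /\
    forall i x, derivable (partials s f) x (basis_vec i).

Definition boundary D : set V := closure D `\` interior D.

(* g extends continuously from I x D to I x (closure of D). *)
Definition continuous_up_to (I : set R) D (g : R -> V -> R) :=
  exists G : R * V -> R, {within I `*` closure D, continuous G} /\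
    forall t x, I t -> D x -> g t x = G (t, x).

Definition H (eps : R) (z : V) : R := Num.sqrt (eps ^+ 2 + enorm z ^+ 2).

End calculus.

(* Functions on the flat torus R^d / Z^d are represented by Z^d-periodic
   functions on R^d. *)
Inductive domain (R : realType) (d : nat) :=
| FlatTorus
| Sublevel of ('rV[R]_d -> R).
Arguments FlatTorus {R d}.

Section domain.
Context {R : realType} {d : nat}.
Local Notation V := 'rV[R]_d.
Implicit Type Omega : domain R d.

Definition admissible_domain Omega :=
  match Omega with
  | FlatTorus => True
  | Sublevel h =>
      [/\ smooth h, convex_function [set: V] h &
          bounded_set [set x | h x < 0]]
  end.

Definition points Omega : set V :=
  match Omega with
  | FlatTorus => setT
  | Sublevel h => [set x | h x < 0]
  end.

(* The region of R^d over which integrals over Omega are taken: a fundamental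
   cell in the periodic case. *)
Definition cell Omega : set V :=
  match Omega with
  | FlatTorus => [set x | forall i, 0 <= x ord0 i < 1]
  | Sublevel h => [set x | h x < 0]
  end.

Definition descends {E : Type} Omega (f : V -> E) :=
  match Omega with
  | FlatTorus => forall x i, f (x + basis_vec i) = f x
  | Sublevel _ => True
  end.

(* For nonempty {h < 0} with h convex, grad h does not vanish on {h = 0}. *)
Definition outward_normal (h : V -> R) (x : V) : V :=
  (enorm (grad h x))^-1 *: grad h x.

(* w . n = 0 on the boundary, for a field w defined in Omega only: boundary
   values are limits from inside. *)
Definition zero_normal_component Omega (w : V -> V) :=
  match Omega with
  | FlatTorus => True
  | Sublevel h =>
      forall x, boundary (points Omega) x ->
        dotp (w y) (outward_normal h x)
          @[y --> within (points Omega) (nbhs x)] --> (0 : R)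
  end.

Record admissible_field Omega (T : R) (v : R -> V -> V) : Prop := {
  field_descends : forall t : R, 0 <= t <= T -> descends Omega (v t) ;
  field_bounded : exists M : R, forall t : R, 0 <= t <= T ->
    forall x, points Omega x -> `|v t x| <= M ;
  field_lipschitz : exists L : R, forall t : R, 0 <= t <= T ->
    L.-lipschitz_(points Omega) (v t) ;
  field_tangent : forall t : R, 0 <= t <= T -> zero_normal_component Omega (v t)
}.

(* Classical regularity, with derivatives continuous up to the boundary: rho and
   grad rho up to time 0, space derivatives up to order 3 and the time
   derivatives of rho and grad rho at interior times. *)
Record sufficiently_smooth Omega (T : R) (rho : R -> V -> R) : Prop := {
  smooth_derivable1 : forall (t : R) x i, 0 <= t <= T -> points Omega x ->
    derivable (rho t) x (basis_vec i) ;
  smooth_continuous1 : forall s : seq 'I_d, (size s <= 1)%N ->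
    continuous_up_to `[0, T] (points Omega) (fun t => partials s (rho t)) ;
  smooth_derivable3 : forall (s : seq 'I_d) (t : R) x i, (size s < 3)%N ->
    0 < t < T -> points Omega x ->
    derivable (partials s (rho t)) x (basis_vec i) ;
  smooth_continuous3 : forall s : seq 'I_d, (size s <= 3)%N ->
    continuous_up_to `]0, T[ (points Omega) (fun t => partials s (rho t)) ;
  smooth_derivable_time : forall (s : seq 'I_d) (t : R) x, (size s <= 1)%N ->
    0 < t < T -> points Omega x ->
    derivable (fun tau => partials s (rho tau) x) t 1 ;
  smooth_continuous_time : forall s : seq 'I_d, (size s <= 1)%N ->
    continuous_up_to `]0, T[ (points Omega)
      (fun t x => derive1 (fun tau => partials s (rho tau) x) t)
}.

(* div (rho v) is a pointwise divergence that exists almost everywhere, v being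
   merely Lipschitz in space (Rademacher). *)
Definition FokkerPlanck_equation Omega (T : R)
    (v : R -> V -> V) (rho : R -> V -> R) :=
  {ae @lebesgue_measure R, forall t : R, 0 < t < T ->
    {ae lebesgue_rvec d, forall x, points Omega x ->
      (forall i, derivable (fun y => (rho t y *: v t y) ord0 i)
                           x (basis_vec i)) /\
      derive1 (fun tau => rho tau x) t - laplacian (rho t) x
        + divergence (fun y => rho t y *: v t y) x = 0}}.

Definition probability_density Omega (f : V -> R) :=
  (forall x, points Omega x -> 0 <= f x) /\
  (\int[lebesgue_rvec d]_(x in cell Omega) (f x)%:E = 1)%E.

Record FokkerPlanck_solution Omega (T : R)
    (v : R -> V -> V) (rho : R -> V -> R) : Prop := {
  sol_descends : forall t : R, 0 <= t <= T -> descends Omega (rho t) ;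
  sol_density : forall t : R, 0 <= t <= T -> probability_density Omega (rho t) ;
  sol_smooth : sufficiently_smooth Omega T rho ;
  sol_equation : FokkerPlanck_equation Omega T v rho ;
  sol_neumann : forall t : R, 0 < t < T ->
    zero_normal_component Omega (grad (rho t))
}.

Definition Linf_norm Omega (f : V -> R) : \bar R :=
  Lnorm (lebesgue_rvec d) +oo%E ((EFin \o (f : rvec R d -> R)) \_ (cell Omega)).

End domain.

(* Main.v *)
Require Import Defs.
From mathcomp Require Import all_boot all_order all_algebra.
From mathcomp Require Import all_classical all_reals all_analysis.
From mathcomp Require Import measurable_realfun ess_sup_inf.
From mathcomp Require Import ring lra.

(** The quantity [\int H (grad rho_t)] is differentiated in time. Write [u] for
    the gradient of the density [rho], [J = u / H u] for the gradient of [H] at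
    [u], [A] for the Hessian matrix of [rho] and [F] for the divergence of
    [rho v]. The derivative of [\int H u] is the integral of
    [J . grad (dt rho)], where [dt rho = laplacian rho - F].

    Pointwise inequality. Since [v] is only Lipschitz, [F] cannot be
    differentiated, but difference quotients give
    [|F| <= \sum_i (M |u_i| + L |rho|)] wherever [F] exists
    ([divergence_bound]). For a constant [K], the field
    [W = (dt rho - laplacian rho + K rho) J + (J . grad) u] has a divergence in
    which the third derivatives of [rho] cancel ([divergence_flux]), and
    [J . grad (dt rho)] equals [div W] minus
    [\sum_k H'' (A_k) . A_k + (div J) (K rho - F) + K J . u]. The Hessian [H''] of
    [H] at [u] is nonnegative with trace at most [d / H u], and [div J] is the
    trace of [H'' A]; by the Cauchy-Schwarz inequality for the form [H''] the
    first summand absorbs the second up to terms of order [|u|^2 / H u] and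
    [rho^2 / H u]. The former are paid for by
    [K J . u = K |u|^2 / H u] for a suitable [K], and the latter are at most a
    multiple of [rho^2 / eps] ([entropy_dissipation_bound]). Hence
    [J . grad (dt rho) <= div W + c rho^2 / eps] ([gradH_rt_le_divergence]).

    Integration in space. On the torus [div W] integrates to zero. In the convex
    case, [W] is multiplied by a cutoff [phi] that is a function of [h] and
    vanishes near the boundary. The gradient of [phi] meets the normal component
    of [W], which contains [J . A (grad h)]. With [g = grad h . u] this is
    [J . grad g] minus the Hessian of [h] evaluated at [J] and [u]. The first
    term is removed by adding to [phi W] a multiple of [g J]
    ([cutoff_divergence_algebra]); the second one has the good sign because [h]
    is convex. What remains contains [g], to the first power next to one
    derivative of the cutoff or to the second power next to two of them. By the
    Neumann condition [g] vanishes at the boundary, and a ray argument turns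
    this into [|g| <= C (- h)] ([boundary_decay]), so the remainder is bounded
    uniformly in the width of the layer and tends to zero pointwise. This gives
    [\int (J . grad (dt rho) - c rho^2 / eps) <= 0] at almost every time
    ([entropy_rate_le0]).

    Integration in time. Integrating between two interior times and bounding
    [\int rho^2] by the volume times the square of the norm of [rho] yields the
    claim between these times ([integral_H_growth]); the end times are reached
    by dominated convergence ([cvg_integral_H]). *)

Set Implicit Arguments.
Unset Strict Implicit.
Unset Printing Implicit Defensive.
Import Order.TTheory GRing.Theory Num.Theory.
Import numFieldNormedType.Exports.
Local Open Scope classical_set_scope.
Local Open Scope ring_scope.

(** * Directional derivatives and their exchange *)

Section one_variable.
Context {R : realType}.

Lemma mean_value_at0 (f df : R -> R) (b : R) :
  (forall s : R, `|s| <= `|b| -> is_derive s 1 f (df s)) ->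
  exists2 c, `|c| <= `|b| & f b - f 0 = df c * b.
Proof.
move=> fd.
have fc (s : R) : `|s| <= `|b| -> {for s, continuous f}.
  move=> /fd ?; apply: differentiable_continuous; exact/derivable1_diffP.
have [b0|b0] := leP 0 b.
- have [||c] := @MVT_segment R f df 0 b b0.
  + move=> x; rewrite in_itv/= => /andP[x0 xb]; apply: fd.
    by rewrite !ger0_norm// ltW.
  + apply: continuous_in_subspaceT => x; rewrite inE/= in_itv/= => /andP[x0 xb].
    by apply: fc; rewrite !ger0_norm.
  + rewrite in_itv/= => /andP[c0 cb] E; exists c.
      by rewrite !ger0_norm.
    by rewrite E subr0.
- have [||c] := @MVT_segment R f df b 0 (ltW b0).
  + move=> x; rewrite in_itv/= => /andP[x0 xb]; apply: fd.
    by rewrite (ltr0_norm xb) (ltr0_norm b0) lerN2 ltW.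
  + apply: continuous_in_subspaceT => x; rewrite inE/= in_itv/= => /andP[x0 xb].
    by apply: fc; rewrite (ler0_norm xb) (ltr0_norm b0) lerN2.
  + rewrite in_itv/= => /andP[c0 cb] E; exists c.
      by rewrite (ler0_norm cb) (ltr0_norm b0) lerN2.
    by rewrite -opprB E; lra.
Qed.

(** The second difference quotient of [F] is a value of [F12] near the origin,
    by two applications of the mean value theorem; so one order of
    differentiation yields the other. *)
Lemma mixed_derivative_exchange (F F1 F12 : R -> R -> R) (F2 : R -> R)
    (r : R) : 0 < r ->
  (forall a b : R, `|a| < r -> `|b| < r -> is_derive a 1 (F ^~ b) (F1 a b)) ->
  (forall a b : R, `|a| < r -> `|b| < r -> is_derive b 1 (F1 a) (F12 a b)) ->
  (forall a : R, `|a| < r -> is_derive (0 : R) 1 (F a) (F2 a)) ->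
  (forall e, 0 < e -> exists2 q, 0 < q &
    forall a b, `|a| < q -> `|b| < q -> `|F12 a b - F12 0 0| <= e) ->
  is_derive (0 : R) 1 F2 (F12 0 0).
Proof.
move=> r0 dF1 dF12 dF2 cF12.
suff lim_quot : (fun a => a^-1 *: ((F2 \o shift 0) (a *: (1:R)) - F2 0))
    @ 0^' --> F12 0 0.
  by split; [apply/cvg_ex; exists (F12 0 0)|apply: cvg_lim lim_quot].
apply/cvgrPdist_le => e e0.
have [q q0 Hq] := cF12 e e0.
near=> a.
have a0 : a != 0 by near: a; exact: nbhs_dnbhs_neq.
have aqr : `|a| < Num.min q r.
  near: a; apply: dnbhs0_lt; by rewrite lt_min q0.
move: (aqr); rewrite lt_min => /andP[aq ar].
rewrite /= addr0 [a%:A]mulr1 distrC.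
have key b : 0 < `|b| < Num.min q r ->
    `|a^-1 * (b^-1 * (F a b - F a 0) - b^-1 * (F 0 b - F 0 0)) - F12 0 0| <= e.
  move=> /andP[b0]; rewrite lt_min => /andP[bq br].
  have bn0 : b != 0 by rewrite -normr_gt0.
  have [s|c ca E] := @mean_value_at0 (fun a => F a b - F a 0)
    (fun a => F1 a b - F1 a 0) a.
    move=> sa; have sr : `|s| < r by exact: le_lt_trans ar.
    have := dF1 s b sr br; have := dF1 s 0 sr; rewrite normr0 => /(_ r0) d0 db.
    exact: is_deriveB.
  have cr : `|c| < r by exact: le_lt_trans ar.
  have [s|c' cb E'] := @mean_value_at0 (F1 c) (F12 c) b.
    by move=> sb; apply: dF12 => //; exact: le_lt_trans br.
  rewrite -mulrBr.
  have -> : F a b - F a 0 - (F 0 b - F 0 0) = F12 c c' * b * a.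
    by rewrite E E'.
  have -> : a^-1 * (b^-1 * (F12 c c' * b * a)) = F12 c c' by field; apply/andP.
  by apply: Hq; [exact: le_lt_trans aq|exact: le_lt_trans bq].
have dFa := dF2 a ar.
have dF0 : is_derive (0:R) 1 (F 0) (F2 0) by apply: dF2; rewrite normr0.
have quot (x : R) : `|x| < r -> (fun b => b^-1 * (F x b - F x 0)) @ 0^' --> F2 x.
  move=> xr; have [dFx <-] := dF2 x xr.
  rewrite (_ : (fun b => _) =
    (fun b : R => b^-1 *: ((F x \o shift 0) (b *: (1 : R)) - F x 0))) //.
  by apply/funext => b; rewrite /= addr0 [b%:A]mulr1.
have lim2 : (fun b => `|a^-1 * (b^-1 * (F a b - F a 0) -
    b^-1 * (F 0 b - F 0 0)) - F12 0 0|) @ 0^' -->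
    `|a^-1 * (F2 a - F2 0) - F12 0 0|.
  apply: cvg_norm; apply: cvgB; last exact: cvg_cst.
  apply: cvgMl_tmp; apply: cvgB; apply: quot => //.
  by rewrite normr0.
apply: (cvgr_to_le lim2).
near=> b; apply: key; apply/andP; split.
  by rewrite normr_gt0; near: b; exact: nbhs_dnbhs_neq.
by near: b; apply: dnbhs0_lt; rewrite lt_min q0.
Unshelve. all: by end_near. Qed.

End one_variable.

Section directional.
Context {R : realType}.

Lemma is_derive_lineP (V : normedModType R) (f : V -> R) (x v : V) (s df : R) :
  is_derive (s *: v + x) v f df <->
  is_derive s 1 (fun h : R => f (h *: v + x)) df.
Proof.
set g := fun h : R => f (h *: v + x).
have E : (fun h => h^-1 *: ((f \o shift (s *: v + x)) (h *: v) -
    f (s *: v + x))) =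
    (fun h => h^-1 *: ((g \o shift s) (h *: (1 : R)) - g s)).
  by apply/funext => h; rewrite /g /= [h%:A]mulr1 scalerDl addrA.
split => -[d1 <-]; split.
- by move: d1; rewrite /derivable E.
- by rewrite /derive E.
- by move: d1; rewrite /derivable E.
- by rewrite /derive E.
Qed.

Lemma is_derive_line0 (V : normedModType R) (f : V -> R) (x v : V) (df : R) :
  is_derive x v f df <->
  is_derive (0 : R) 1 (fun h : R => f (h *: v + x)) df.
Proof.
have := is_derive_lineP f x v 0 df.
by rewrite (_ : 0 *: v + x = x)// scale0r add0r.
Qed.

Lemma is_derive_comp_scalar (V : normedModType R) (g : R -> R) (f : V -> R)
    (x v : V) (a b : R) :
  is_derive (f x) 1 g a -> is_derive x v f b ->
  is_derive x v (fun y => g (f y)) (a * b).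
Proof.
move=> dg /is_derive_line0 df; apply/is_derive_line0.
apply: (@is_derive1_comp _ g (fun h : R => f (h *: v + x))) => //.
by rewrite scale0r add0r.
Qed.

Lemma is_derive_add (V : normedModType R) (f g : V -> R) x v (df dg : R) : is_derive x v f df ->
  is_derive x v g dg -> is_derive x v (fun y => f y + g y) (df + dg).
Proof. by move=> Df Dg; exact: is_deriveD. Qed.

Lemma is_derive_sub (V : normedModType R) (f g : V -> R) x v (df dg : R) : is_derive x v f df ->
  is_derive x v g dg -> is_derive x v (fun y => f y - g y) (df - dg).
Proof. by move=> Df Dg; exact: is_deriveB. Qed.

Lemma is_derive_prod (V : normedModType R) (f g : V -> R) x v (df dg : R) : is_derive x v f df ->
  is_derive x v g dg ->
  is_derive x v (fun y => f y * g y) (f x * dg + g x * df).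
Proof. by move=> Df Dg; exact: is_deriveM. Qed.

Lemma is_derive_sums (V : normedModType R) (I : Type) (s : seq I)
    (F : I -> V -> R) (dF : I -> R) x v :
  (forall i, is_derive x v (F i) (dF i)) ->
  is_derive x v (fun y => \sum_(i <- s) F i y) (\sum_(i <- s) dF i).
Proof.
move=> dFx; elim: s => [|i s IHs].
  rewrite big_nil; under eq_fun do rewrite big_nil; exact: is_derive_cst.
rewrite big_cons; under eq_fun do rewrite big_cons; exact: is_deriveD.
Qed.

Context {d : nat}.
Local Notation V := 'rV[R]_d.

(** The increment along [z] is a sum of increments along the coordinates, each
    of them given by a value of a partial derivative close to [x]. *)
Lemma is_derive_direction (f : V -> R) (x z : V) :
  (\forall y \near x, forall i, derivable f y (basis_vec i)) ->
  (forall i, {for x, continuous (partial i f)}) ->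
  is_derive x z f (\sum_i z ord0 i * partial i f x).
Proof.
move=> df cf.
suff lim_quot : (fun h : R => h^-1 *: ((f \o shift x) (h *: z) - f x))
    @ 0^' --> \sum_i z ord0 i * partial i f x.
  by split; [apply/cvg_ex; eexists; exact: lim_quot|apply: cvg_lim lim_quot].
pose trunc k : V := \row_i (if (i < k)%N then z ord0 i else 0).
pose y k (h : R) := h *: trunc k + x.
have trunc0 : trunc 0 = 0 by apply/rowP => i; rewrite !mxE.
have truncd : trunc d = z by apply/rowP => i; rewrite !mxE ltn_ord.
have truncS (k : 'I_d) : trunc k.+1 = z ord0 k *: basis_vec k + trunc k.
  apply/rowP => i; rewrite !mxE /= ltnS leq_eqVlt -(inj_eq val_inj).
  case: eqVneq => [/val_inj ->|_] /=; first by rewrite ltnn mulr1 addr0.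
  by rewrite mulr0 add0r.
have -> : (fun h : R => h^-1 *: ((f \o shift x) (h *: z) - f x)) =
    (fun h => \sum_(k < d) h^-1 * (f (y k.+1 h) - f (y k h))).
  apply/funext => h; rewrite -mulr_sumr; congr (_ * _).
  rewrite -(big_mkord xpredT (fun k => f (y k.+1 h) - f (y k h))).
  by rewrite telescope_sumr// /y truncd trunc0 scaler0 add0r.
apply: cvg_big; first exact: add_continuous.
move=> k _; apply/cvgrPdist_le => e e0.
have z1 : 0 < `|z ord0 k| + 1 by rewrite ltr_wpDl.
have ez : 0 < e / (`|z ord0 k| + 1) by exact: divr_gt0.
have /cvgrPdist_le/(_ _ ez)/nbhs_normP[q/= q0 Hq] := cf k.
have /nbhs_normP[q'/= q'0 Hq'] := df.
pose c := `|trunc k| + `|z ord0 k| * `|basis_vec k : V| + 1.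
have c0 : 0 < c by rewrite ltr_wpDl// addr_ge0// mulr_ge0.
near=> h.
have hn0 : h != 0 by near: h; exact: nbhs_dnbhs_neq.
have hq : `|h| * c < Num.min q q'.
  rewrite -ltr_pdivlMr//; near: h; apply: dnbhs0_lt.
  by rewrite divr_gt0// lt_min q0.
have near_x s : `|s| <= `|h * z ord0 k| ->
    `|x - (s *: basis_vec k + y k h)| < Num.min q q'.
  move=> sh; apply: le_lt_trans hq.
  rewrite /y addrA opprD addrCA subrr addr0 normrN.
  rewrite (le_trans (ler_normD _ _))// !normrZ /c !mulrDr mulr1.
  rewrite addrC -addrA lerD2l ler_wpDr// mulrA ler_wpM2r//.
  by rewrite -normrM.
have [s sh|s sh E] := @mean_value_at0 _ (fun s => f (s *: basis_vec k + y k h))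
    (fun s => partial k f (s *: basis_vec k + y k h)) (h * z ord0 k).
  apply: (is_derive_lineP f (y k h) (basis_vec k) s _).1.
  apply: derivableP; apply: Hq' => /=.
  by have := near_x _ sh; rewrite lt_min => /andP[].
have -> : f (y k.+1 h) - f (y k h) =
    partial k f (s *: basis_vec k + y k h) * (h * z ord0 k).
  by rewrite -E scale0r add0r /y truncS scalerDr scalerA addrA.
rewrite (_ : h^-1 * _ = z ord0 k * partial k f (s *: basis_vec k + y k h));
  last by field.
rewrite -mulrBr normrM.
have /Hq/= : `|x - (s *: basis_vec k + y k h)| < q.
  by have := near_x _ sh; rewrite lt_min => /andP[].
move=> /(ler_wpM2l (normr_ge0 (z ord0 k)))/le_trans; apply.
by rewrite mulrCA ger_pMr// ler_pdivrMr// mul1r lerDl.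
Unshelve. all: by end_near. Qed.

End directional.

Section exchange.
Context {R : realType} {d : nat}.
Local Notation V := 'rV[R]_d.

Lemma is_derive_partial_exchange (f : V -> R) (x : V) (i j : 'I_d) :
  (\forall y \near x, [/\ derivable f y (basis_vec i),
     derivable f y (basis_vec j) & derivable (partial j f) y (basis_vec i)]) ->
  {for x, continuous (partial i (partial j f))} ->
  is_derive x (basis_vec j) (partial i f) (partial i (partial j f) x).
Proof.
move=> /nbhs_normP[q /= q0 Hq] cf.
pose N := `|basis_vec i : V| + `|basis_vec j : V| + 1.
have N0 : 0 < N by rewrite ltr_wpDl// addr_ge0.
pose y (a b : R) : V := b *: basis_vec i + (a *: basis_vec j + x).
have y_near (a b e : R) : 0 < e -> `|a| < e / N -> `|b| < e / N ->
    `|x - y a b| < e.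
  move=> e0 /ltW ae /ltW be; rewrite /y addrA opprD addrCA subrr addr0 normrN.
  rewrite (le_lt_trans (ler_normD _ _))// !normrZ.
  rewrite (@le_lt_trans _ _ (e / N * (`|basis_vec i : V| + `|basis_vec j : V|)))//.
    by rewrite mulrDr lerD// ler_wpM2r.
  by rewrite -mulrA gtr_pMr// mulrC ltr_pdivrMr// mul1r ltrDl.
have /(@mixed_derivative_exchange R (fun a b => f (y a b))
    (fun a b => partial j f (y a b))
    (fun a b => partial i (partial j f) (y a b))
    (fun a => partial i f (a *: basis_vec j + x)) (q / N)) : 0 < q / N.
  exact: divr_gt0.
rewrite (_ : partial i (partial j f) x = partial i (partial j f) (y 0 0)); last first.
  by rewrite /y !scale0r !add0r.
move=> exch; apply: (is_derive_line0 (partial i f) x (basis_vec j) _).2; refine (exch _ _ _ _).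
- move=> a b aq bq.
  have [_ /derivableP D _] := Hq _ (y_near a b _ q0 aq bq).
  have E c : y c b = c *: basis_vec j + (b *: basis_vec i + x).
    by rewrite /y addrCA.
  have := (is_derive_lineP f (b *: basis_vec i + x) (basis_vec j) a
    (partial j f (y a b))).1.
  rewrite -E => /(_ D).
  by under eq_fun do rewrite -E.
- move=> a b aq bq.
  have [_ _ /derivableP D] := Hq _ (y_near a b _ q0 aq bq).
  exact: (is_derive_lineP (partial j f) (a *: basis_vec j + x) (basis_vec i) b _).1 D.
- move=> a aq.
  have /(y_near a 0 _ q0 aq)/Hq[/derivableP D _ _] : `|0 : R| < q / N.
    by rewrite normr0 divr_gt0.
  apply: (is_derive_line0 f (a *: basis_vec j + x) (basis_vec i) _).1.
  by rewrite /y scale0r add0r in D.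
- move=> e e0; have /cvgrPdist_le/(_ _ e0)/nbhs_normP[p/= p0 Hp] := cf.
  exists (p / N); first exact: divr_gt0.
  move=> a b ap bp; rewrite distrC.
  have -> : y 0 0 = x by rewrite /y !scale0r !add0r.
  by apply: Hp; exact: y_near.
Qed.

(** The space derivative of the time derivative of a solution is recovered in
    this way from the time derivative of its gradient. *)
Lemma is_derive_time_exchange (f : R -> V -> R) (t : R) (x : V) (i : 'I_d) :
  (\forall p \near (t, x), [/\ derivable (f p.1) p.2 (basis_vec i),
     derivable (f ^~ p.2) p.1 1 &
     derivable (fun tau => partial i (f tau) p.2) p.1 1]) ->
  {for (t, x), continuous (fun p : R * V =>
     derive1 (fun tau => partial i (f tau) p.2) p.1)} ->
  is_derive x (basis_vec i) (fun y => derive1 (f ^~ y) t)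
    (derive1 (fun tau => partial i (f tau) x) t).
Proof.
move=> /nbhs_ballP[q /= q0 Hq] cf.
pose N := `|basis_vec i : V| + 1.
have N1 : 1 <= N by rewrite lerDr.
have N0 : 0 < N by exact: lt_le_trans N1.
pose y (a : R) : V := a *: basis_vec i + x.
have y_near (a b e : R) : 0 < e -> `|a| < e / N -> `|b| < e / N ->
    ball (t, x) e (b + t, y a).
  move=> e0 ae be; split => /=.
    rewrite /ball/= opprD addrCA subrr addr0 normrN.
    by rewrite (lt_le_trans be)// ler_pdivrMr// ler_peMr// ltW.
  rewrite -ball_normE /= /y opprD addrCA subrr addr0 normrN normrZ.
  rewrite (@le_lt_trans _ _ (e / N * `|basis_vec i : V|))//.
    by rewrite ler_wpM2r// ltW.
  by rewrite -mulrA gtr_pMr// mulrC ltr_pdivrMr// mul1r ltrDl.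
have /(@mixed_derivative_exchange R (fun a b => f (b + t) (y a))
    (fun a b => partial i (f (b + t)) (y a))
    (fun a b => derive1 (fun tau => partial i (f tau) (y a)) (b + t))
    (fun a => derive1 (f ^~ (y a)) t) (q / N)) : 0 < q / N.
  exact: divr_gt0.
rewrite add0r (_ : y 0 = x); last by rewrite /y scale0r add0r.
have shift1 (g : R -> R) (b dg : R) : is_derive (b + t) 1 g dg ->
    is_derive b 1 (fun b => g (b + t)) dg.
  move=> D.
  have := (is_derive_lineP g t 1 b dg).1.
  rewrite [b%:A]mulr1 => /(_ D).
  by under eq_fun do rewrite [_%:A]mulr1.
move=> exch.
apply: (is_derive_line0 (fun y => derive1 (f ^~ y) t) x (basis_vec i) _).2.
refine (exch _ _ _ _).
- move=> a b aq bq.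
  have [/derivableP D _ _] := Hq _ (y_near a b _ q0 aq bq).
  exact: (is_derive_lineP (f (b + t)) x (basis_vec i) a _).1 D.
- move=> a b aq bq.
  have [_ _ /derivableP D] := Hq _ (y_near a b _ q0 aq bq).
  by rewrite derive1E; exact: (shift1 (fun tau => partial i (f tau) (y a)) b _ D).
- move=> a aq.
  have /(y_near a 0 _ q0 aq)/Hq[_ /derivableP D _] : `|0 : R| < q / N.
    by rewrite normr0 divr_gt0.
  rewrite derive1E; rewrite /= in D.
  have := shift1 (f ^~ (y a)) 0 _ D.
  by rewrite add0r.
- move=> e e0; have /cvgrPdist_le/(_ _ e0)/nbhs_ballP[p/= p0 Hp] := cf.
  exists (p / N); first exact: divr_gt0.
  move=> a b ap bp; rewrite distrC.
  exact: (Hp _ (y_near a b _ p0 ap bp)).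
Qed.

End exchange.

(** * Borel functions and integration along coordinate lines *)

Section borel.
Context {R : realType} {d : nat}.
Local Notation V := 'rV[R]_d.

Let box (k : rat * ('rV[rat]_d) * nat) : set (R * V) :=
  [set p : R * V | `|ratr k.1.1 - p.1| < k.2.+1%:R^-1 /\
    forall i, `|ratr (k.1.2 ord0 i) - p.2 ord0 i| < k.2.+1%:R^-1].

Lemma measurable_coord (i : 'I_d) :
  measurable_fun [set: rvec R d] (fun x : rvec R d => (x : V) ord0 i).
Proof.
have -> : (fun x : rvec R d => (x : V) ord0 i) =
    (fun t : d.-tuple (measurableTypeR R) => tnth t i) \o @tuple_of_row R d.
  by apply/funext => x /=; rewrite tnth_mktuple.
apply: (measurableT_comp (measurable_tnth i)).
by move=> _ B mB; rewrite setTI; exists B => //; rewrite setTI.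
Qed.

Let measurable_box k :
  measurable (box k : set (measurableTypeR R * rvec R d)).
Proof.
have -> : box k = (ball (ratr k.1.1 : R) k.2.+1%:R^-1) `*`
    (\bigcap_(i in [set: 'I_d]) (fun x : rvec R d => (x : V) ord0 i) @^-1`
       (ball (ratr (k.1.2 ord0 i) : R) k.2.+1%:R^-1)).
  apply/seteqP; split => -[t x] /= [] A B; split => //.
  by move=> i _; exact: B.
  by move=> i; exact: B.
apply: measurableX; first exact: measurable_ball.
apply: fin_bigcap_measurable => // i _.
rewrite -[X in measurable X]setTI; apply: measurable_coord => //.
exact: measurable_ball.
Qed.

(** An open set is the union of the countably many boxes with rational centres
    and radii [1 / n] that it contains. *)
Lemma open_measurable_prod (O : set (R * V)) : open O ->
  measurable (O : set (measurableTypeR R * rvec R d)).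
Proof.
move=> oO.
pose B n : set (R * V) := if @unpickle (rat * ('rV[rat]_d) * nat)%type n is Some k
  then (if pselect (box k `<=` O) then box k else set0) else set0.
have -> : O = \bigcup_n B n.
  apply/seteqP; split => [[t x] Otx|p [n _]]; last first.
    by rewrite /B; case: unpickle => // k; case: pselect => //= sub; exact: sub.
  have /nbhs_ballP[e /= e0 He] := open_nbhs_nbhs (conj oO Otx).
  pose n := Num.truncn (2 / e).
  have ne : n.+1%:R^-1 + n.+1%:R^-1 <= e.
    have : 2 / e < n.+1%:R by exact: truncnS_gt.
    rewrite ltr_pdivrMr// => /ltW ne.
    by rewrite -mulr2n -[_ *+ 2]mulr_natl ler_pdivrMr// mulrC.
  have near_rat (y : R) : {q : rat | `|ratr q - y| < n.+1%:R^-1}.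
    apply: cid.
    have /rat_in_itvoo[q yq] : y - n.+1%:R^-1 < y + n.+1%:R^-1.
      by rewrite ltrD2l -subr_gt0 opprK addr_gt0.
    by exists q; rewrite ltr_distl; rewrite in_itv/= in yq.
  pose k : rat * ('rV[rat]_d) * nat :=
    ((sval (near_rat t), \row_i sval (near_rat (x ord0 i))), n).
  exists (pickle k); first exact: I.
  have kO : box k `<=` O.
    move=> [s y] [/= sk yk]; apply: He; split => /=.
      rewrite /ball/=; apply: lt_le_trans ne.
      have -> : t - s = - (ratr k.1.1 - t) + (ratr k.1.1 - s) by ring.
      rewrite (le_lt_trans (ler_normD _ _))// normrN ltrD//.
      exact: (svalP (near_rat t)).
    split=> // i j; rewrite (ord1 i) /ball/=; apply: lt_le_trans ne.
    have -> : x ord0 j - y ord0 j = - (ratr (k.1.2 ord0 j) - x ord0 j) +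
      (ratr (k.1.2 ord0 j) - y ord0 j) by ring.
    rewrite (le_lt_trans (ler_normD _ _))// normrN ltrD//.
    by rewrite mxE; exact: (svalP (near_rat (x ord0 j))).
  rewrite /B pickleK; case: pselect => //= _.
  split=> /=; first exact: (svalP (near_rat t)).
  by move=> i; rewrite mxE; exact: (svalP (near_rat (x ord0 i))).
apply: bigcup_measurable => n _; rewrite /B.
case: unpickle => [k|]; last exact: measurable0.
by case: pselect => /= sub; [exact: measurable_box|exact: measurable0].
Qed.

Lemma open_measurable_rvec (O : set V) : open O -> measurable (O : set (rvec R d)).
Proof.
move=> oO.
have oO' : open [set p : R * V | O p.2].
  by apply: open_comp => // p _; exact: cvg_snd.
have := measurable_xsection (0 : R) (open_measurable_prod oO').
rewrite (_ : xsection _ _ = O)//.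
by apply/seteqP; split => x; rewrite /xsection /= inE.
Qed.

Lemma continuous_measurable_prod (O : set (R * V)) (f : R * V -> R) : open O ->
  {in O, continuous f} ->
  measurable_fun (O : set (measurableTypeR R * rvec R d)) f.
Proof.
move=> oO; rewrite -(continuous_open_subspace f oO) => /continuousP cf.
apply: (measurability _ (RGenOpens.measurableE R)).
move=> _ [_ [a [b ->] <-]]; apply: open_measurable_prod.
have /cf/open_subspaceP[W oW WO] : open (`]a, b[%classic : set R).
  exact: interval_open.
by rewrite setIC -WO; exact: openI.
Qed.

Lemma continuous_measurable_rvec (O : set V) (f : V -> R) : open O ->
  {in O, continuous f} -> measurable_fun (O : set (rvec R d)) f.
Proof.
move=> oO; rewrite -(continuous_open_subspace f oO) => /continuousP cf.
apply: (measurability _ (RGenOpens.measurableE R)).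
move=> _ [_ [a [b ->] <-]]; apply: open_measurable_rvec.
have /cf/open_subspaceP[W oW WO] : open (`]a, b[%classic : set R).
  exact: interval_open.
by rewrite setIC -WO; exact: openI.
Qed.

End borel.

Section lines.
Context {R : realType}.
Local Notation tup n := (n.-tuple (measurableTypeR R)).
Local Notation mu := (@lebesgue_measure R).

Definition tset n (i : 'I_n) (s : R) (t : tup n) : tup n :=
  [tuple if j == i then s else tnth t j | j < n].

(** By induction on the dimension: either the first coordinate is the [i]-th one
    and the inner integral vanishes, or the induction applies to the slices
    where the first coordinate is fixed. *)
Lemma integral_lines_eq0 n (i : 'I_n) (F : tup n -> \bar R) :
  (lebesgue_tuple n).-integrable setT F ->
  (forall t, \int[mu]_s F (tset i s t) = 0)%E ->
  (\int[lebesgue_tuple n]_t F t = 0)%E.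
Proof.
elim: n i F => [[]//|n IHn] i F intF F0.
pose m := lebesgue_tuple (R := R) n.
pose f (p : measurableTypeR R * tup n) : tup n.+1 :=
  [the n.+1.-tuple _ of p.1 :: p.2].
have mf : measurable_fun [set: measurableTypeR R * tup n] f.
  exact: measurable_cons.
have mF : measurable_fun setT F by exact: measurable_int intF.
have mFf : measurable_fun setT (F \o f) by exact: measurableT_comp.
have intFf : (mu \x m)%E.-integrable setT (F \o f).
  apply/integrableP; split => //.
  move/integrableP : intF => [_]; apply: le_lt_trans.
  have := @ge0_integral_pushforward _ _ _ _ R f mf (mu \x m)%E setT
    (fun t => `|F t|%E) measurableT.
  by rewrite preimage_setT => <- //; exact: measurableT_comp.
rewrite [LHS](_ : _ = (\int[(mu \x m)%E]_p F (f p))%E); last first.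
  have := @integral_pushforward _ _ _ _ R f mf (mu \x m)%E setT F mF.
  by rewrite preimage_setT => /(_ intFf measurableT).
case: (unliftP ord0 i) => [j ij|i0].
- rewrite -(integral12_prod_meas1 intFf).
  transitivity (\int[mu]_x (cst 0%E x : \bar R))%E; last exact: integral0.
  apply: ae_eq_integral => //; first exact: (measurable_fubini_F intFf).
  have := ae_integrable1 intFf; apply: filterS => x intx _.
  apply: (IHn j) => // t; rewrite -(F0 (f (x, t))).
  apply: eq_integral => s _; congr (F _); apply: eq_from_tnth => k.
  rewrite ij tnth_mktuple; case: (unliftP ord0 k) => [k' ->|->].
    by rewrite !tnthS tnth_mktuple (inj_eq lift_inj).
  by rewrite /f /= !tnth0.
- rewrite -(integral21_prod_meas1 intFf).
  under eq_integral => t _.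
    rewrite /fubini_G /=.
    rewrite (_ : (\int[mu]_x F (f (x, t)) = 0)%E); last first.
      rewrite -(F0 (f (0, t))); apply: eq_integral => s _; congr (F _).
      apply: eq_from_tnth => k; rewrite i0 tnth_mktuple.
      case: (unliftP ord0 k) => [k' ->|->].
        by rewrite /f /= !tnthS.
      by rewrite eqxx.
    over.
  exact: integral0.
Qed.

Context {d : nat}.
Local Notation V := 'rV[R]_d.

Lemma row_of_tset (i : 'I_d) (s : R) (t : tup d) :
  row_of_tuple (tset i s t) = s *: basis_vec i + row_of_tuple (tset i 0 t).
Proof.
apply/rowP => j; rewrite !mxE !tnth_mktuple /=.
by case: eqVneq => [_|_]; rewrite ?mulr1 ?mulr0 ?addr0 ?add0r.
Qed.

Definition halfopen_box (a b : R) : set V :=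
  [set x | forall i, a <= x ord0 i < b].

Lemma halfopen_boxE (a b : R) :
  halfopen_box a b = [set x | forall i, `[a, b[%classic (x ord0 i)].
Proof.
by apply/seteqP; split => x xab i; have := xab i; rewrite /= in_itv.
Qed.

Lemma measurable_halfopen_box (a b : R) :
  measurable (halfopen_box a b : set (rvec R d)).
Proof.
have -> : halfopen_box a b = \bigcap_(i in [set: 'I_d])
    (fun x : rvec R d => (x : V) ord0 i) @^-1` `[a, b[%classic.
  rewrite halfopen_boxE.
  by apply/seteqP; split => x xab i; [move=> _; exact: xab|exact: xab].
apply: fin_bigcap_measurable => // i _.
rewrite -[X in measurable X]setTI; apply: measurable_coord => //.
Qed.

Lemma lebesgue_halfopen_box_lty (a b : R) :
  (lebesgue_rvec d (halfopen_box a b : set (rvec R d)) < +oo)%E.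
Proof.
rewrite halfopen_boxE (lebesgue_rvec_box (fun=> measurable_itv _)).
rewrite lebesgue_measure_itv; case: ifPn => _.
  by rewrite -EFinB prodEFin ltry.
by rewrite prodEFin ltry.
Qed.

(** In the variable [x_i] the integrand is a derivative with equal values at
    both ends, so it integrates to zero along every line; Fubini's theorem
    concludes. *)
Lemma integral_partial_box_eq0 (f : V -> R) (i : 'I_d) (a b M : R) : a < b ->
  (forall x, derivable f x (basis_vec i)) -> continuous (partial i f) ->
  (forall x, `|partial i f x| <= M) ->
  (forall x : V, x ord0 i = 0 -> f (a *: basis_vec i + x) = f (b *: basis_vec i + x)) ->
  (\int[lebesgue_rvec d]_(x in halfopen_box a b : set (rvec R d))
    (partial i f x)%:E = 0)%E.
Proof.
move=> ab df cf Mf fab.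
pose g := partial i f.
have mg : measurable_fun [set: rvec R d] (EFin \o g : rvec R d -> \bar R).
  apply/measurable_EFinP; apply: continuous_measurable_rvec; first exact: openT.
  by move=> x _; exact: cf.
have mB := measurable_halfopen_box a b.
have mrow := @measurable_row_of_tuple R d.
have mgB : measurable_fun [set: rvec R d]
    ((EFin \o g : rvec R d -> \bar R) \_ (halfopen_box a b)).
  by apply/(measurable_restrictT _ mB); exact: measurable_funTS.
have intg : (lebesgue_tuple d).-integrable setT
    (((EFin \o g : rvec R d -> \bar R) \_ (halfopen_box a b)) \o @row_of_tuple R d).
  rewrite (_ : _ \o _ = (EFin \o (g \o @row_of_tuple R d) : tup d -> \bar R) \_
      (@row_of_tuple R d @^-1` halfopen_box a b)); last first.
    by apply/funext => t; rewrite /= !patchE.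
  have mB' : measurable ((@row_of_tuple R d : tup d -> rvec R d)
      @^-1` halfopen_box a b).
    by rewrite -[X in measurable X]setTI; exact: mrow.
  apply/(integrable_mkcond _ mB').
  apply: measurable_bounded_integrable => //.
  - exact: lebesgue_halfopen_box_lty.
  - apply/measurable_EFinP; apply: measurable_funTS.
    exact: measurableT_comp mg mrow.
  - by exists M; split; [exact: num_real|move=> y My t _; apply: le_trans (Mf _) (ltW My)].
rewrite integral_mkcond.
have -> : (\int[lebesgue_rvec d]_x
    ((EFin \o g : rvec R d -> \bar R) \_ (halfopen_box a b)) x =
  \int[lebesgue_tuple d]_t (((EFin \o g : rvec R d -> \bar R) \_
    (halfopen_box a b)) \o @row_of_tuple R d) t)%E.
  have := @integral_pushforward _ _ _ _ R _ mrow (lebesgue_tuple d) setT _ mgB.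
  by rewrite preimage_setT => /(_ intg measurableT).
apply: (integral_lines_eq0 (i := i)) => // t.
pose x0 := row_of_tuple (tset i 0 t).
have x0i : x0 ord0 i = 0 by rewrite mxE tnth_mktuple eqxx.
have [inB|notB] := pselect (forall j, j != i -> a <= tnth t j < b); last first.
  rewrite -[RHS](@integral0 _ _ _ mu setT); apply: eq_integral => s _ /=.
  rewrite patchE memNset// => B; apply: notB => j ji.
  by have := B j; rewrite mxE tnth_mktuple (negbTE ji).
have lineE s : ((EFin \o g : rvec R d -> \bar R) \_ (halfopen_box a b))
    (row_of_tuple (tset i s t)) =
    ((EFin \o (fun s : R => g (s *: basis_vec i + x0))) \_ `[a, b[%classic) s.
  rewrite !patchE /= -row_of_tset; congr (if _ then _ else _).
  apply/idP/idP; rewrite !inE /=.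
    by move=> B; have := B i; rewrite mxE tnth_mktuple eqxx in_itv.
  rewrite in_itv/= => sab j; rewrite mxE tnth_mktuple; case: eqVneq => // ji.
  exact: inB.
under eq_integral do rewrite /= lineE.
rewrite -integral_mkcond.
have cg : continuous (fun s : R => g (s *: basis_vec i + x0)).
  move=> s; apply: continuous_comp; last exact: cf.
  apply: cvgD; last exact: cvg_cst.
  by apply: cvgZr_tmp; exact: cvg_id.
have dfl (s : R) : is_derive s 1 (fun s : R => f (s *: basis_vec i + x0))
    (g (s *: basis_vec i + x0)).
  exact: (is_derive_lineP f x0 (basis_vec i) s _).1 (derivableP (df _)).
have cfl (s : R) : {for s, continuous (fun s : R => f (s *: basis_vec i + x0))}.
  apply: differentiable_continuous; apply/derivable1_diffP; by case: (dfl s).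
rewrite integral_itv_bndo_bndc; last first.
  apply/measurable_EFinP; apply: measurable_funTS.
  exact: continuous_measurable_fun.
rewrite (@continuous_FTC2 _ _ (fun s : R => f (s *: basis_vec i + x0))) //.
- by rewrite fab// subee.
- exact: continuous_subspaceT.
- split.
  + by move=> s _; case: (dfl s).
  + exact/cvg_at_right_filter/cfl.
  + exact/cvg_at_left_filter/cfl.
- by move=> s _; rewrite derive1E; case: (dfl s).
Qed.

End lines.

(** * Bounded continuously differentiable functions *)

Section bounded_C1.
Context {R : realType} {d : nat}.
Local Notation V := 'rV[R]_d.
Variable D : set V.
Hypothesis oD : open D.
Implicit Types f g : V -> R.

Definition bcont f := (forall x, D x -> {for x, continuous f}) /\
  exists M, forall x, D x -> `|f x| <= M.

(** All that is kept of the regularity up to the boundary is the boundedness: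
    it makes integrals over the cell converge and dominates the limits. *)
Definition bC1 f := bcont f /\ forall i,
  (forall x, D x -> derivable f x (basis_vec i)) /\ bcont (partial i f).

Lemma bcont_eq f g : (forall x, D x -> f x = g x) -> bcont f -> bcont g.
Proof.
move=> fg [cf [M fM]]; split; last by exists M => x Dx; rewrite -fg//; exact: fM.
move=> x Dx.
have nD : \forall y \near x, D y by exact: open_nbhs_nbhs.
suff : g @ x --> f x by rewrite fg.
apply: cvg_trans (cf x Dx); apply: (@near_eq_cvg _ _ (nbhs x)).
by apply: filterS nD => y Dy; rewrite fg.
Qed.

Lemma bcont_cst (c : R) : bcont (fun=> c).
Proof. by split=> [x _|]; [exact: cst_continuous|exists `|c|]. Qed.

Lemma bcontD f g : bcont f -> bcont g -> bcont (fun x => f x + g x).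
Proof.
move=> [cf [M fM]] [cg [N gN]]; split=> [x Dx|].
  by apply: continuousD; [exact: cf|exact: cg].
exists (M + N) => x Dx; rewrite (le_trans (ler_normD _ _))//.
by rewrite lerD ?fM ?gN.
Qed.

Lemma bcontM f g : bcont f -> bcont g -> bcont (fun x => f x * g x).
Proof.
move=> [cf [M fM]] [cg [N gN]]; split=> [x Dx|].
  by apply: continuousM; [exact: cf|exact: cg].
by exists (M * N) => x Dx; rewrite normrM ler_pM ?fM ?gN.
Qed.

Lemma bcontN f : bcont f -> bcont (fun x => - f x).
Proof.
move=> [cf [M fM]]; split=> [x Dx|]; first by apply: continuousN; exact: cf.
by exists M => x Dx; rewrite normrN fM.
Qed.

Lemma bcont_sum (I : Type) (s : seq I) (F : I -> V -> R) :
  (forall i, bcont (F i)) -> bcont (fun x => \sum_(i <- s) F i x).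
Proof.
move=> bF; elim: s => [|i s IHs].
  by under eq_fun do rewrite big_nil; exact: bcont_cst.
by under eq_fun do rewrite big_cons; exact: bcontD.
Qed.

Lemma bcont_comp (p : R -> R) f :
  continuous p -> bcont f -> bcont (fun x => p (f x)).
Proof.
move=> cp [cf [M fM]]; split=> [x Dx|].
  by apply: continuous_comp; [exact: cf|exact: cp].
have [N [_ pN]] : bounded_set (p @` `[- M, M]).
  apply: compact_bounded; apply: continuous_compact.
    exact: continuous_subspaceT.
  exact: segment_compact.
exists (N + 1) => x Dx; apply: (pN (N + 1)); first by rewrite ltrDl.
by exists (f x) => //=; rewrite in_itv/= -ler_norml fM.
Qed.

Lemma bC1_bcont f : bC1 f -> bcont f. Proof. by case. Qed.

Lemma bC1_partial f i : bC1 f -> bcont (partial i f).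
Proof. by case=> _ /(_ i)[]. Qed.

Lemma bC1_derive f i x : bC1 f -> D x ->
  is_derive x (basis_vec i) f (partial i f x).
Proof. by move=> [_ /(_ i)[df _]] Dx; apply/derivableP/df. Qed.

Lemma bC1_intro f (df : 'I_d -> V -> R) : bcont f ->
  (forall i, bcont (df i)) ->
  (forall i x, D x -> is_derive x (basis_vec i) f (df i x)) -> bC1 f.
Proof.
move=> bf bd fd; split=> // i; split=> [x Dx|]; first by case: (fd i x Dx).
by apply: bcont_eq (bd i) => x Dx; rewrite /partial; case: (fd i x Dx).
Qed.

Lemma bC1_eq f g : (forall x, D x -> f x = g x) -> bC1 f -> bC1 g.
Proof.
move=> fg bf; apply: (@bC1_intro _ (fun i => partial i f)).
- exact: bcont_eq (bC1_bcont bf).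
- by move=> i; exact: bC1_partial.
- move=> i x Dx; apply: near_eq_is_derive (bC1_derive i bf Dx).
  by apply: filterS (open_nbhs_nbhs (conj oD Dx)) => y Dy; rewrite fg.
Qed.

Lemma bC1_cst (c : R) : bC1 (fun=> c).
Proof.
apply: (@bC1_intro _ (fun _ _ => 0)).
- exact: bcont_cst.
- by move=> i; exact: bcont_cst.
Qed.

Lemma bC1D f g : bC1 f -> bC1 g -> bC1 (fun x => f x + g x).
Proof.
move=> bf bg; apply: (@bC1_intro _ (fun i x => partial i f x + partial i g x)).
- by apply: bcontD; exact: bC1_bcont.
- by move=> i; apply: bcontD; exact: bC1_partial.
- by move=> i x Dx; apply: is_deriveD; exact: bC1_derive.
Qed.

Lemma bC1M f g : bC1 f -> bC1 g -> bC1 (fun x => f x * g x).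
Proof.
move=> bf bg.
apply: (@bC1_intro _ (fun i x => f x * partial i g x + g x * partial i f x)).
- by apply: bcontM; exact: bC1_bcont.
- by move=> i; apply: bcontD; apply: bcontM; by [exact: bC1_bcont|exact: bC1_partial].
- by move=> i x Dx; apply: is_derive_prod; exact: bC1_derive.
Qed.

Lemma bC1N f : bC1 f -> bC1 (fun x => - f x).
Proof.
move=> bf; apply: (@bC1_intro _ (fun i x => - partial i f x)).
- by apply: bcontN; exact: bC1_bcont.
- by move=> i; apply: bcontN; exact: bC1_partial.
- by move=> i x Dx; apply: is_deriveN; exact: bC1_derive.
Qed.

Lemma bC1_sum (I : Type) (s : seq I) (F : I -> V -> R) :
  (forall i, bC1 (F i)) -> bC1 (fun x => \sum_(i <- s) F i x).
Proof.
move=> bF; elim: s => [|i s IHs].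
  by under eq_fun do rewrite big_nil; exact: bC1_cst.
by under eq_fun do rewrite big_cons; exact: bC1D.
Qed.

Lemma bC1_comp (p dp : R -> R) f : bC1 f -> 
  (forall x, D x -> is_derive (f x) 1 p (dp (f x))) ->
  bcont (fun x => p (f x)) -> bcont (fun x => dp (f x)) ->
  bC1 (fun x => p (f x)).
Proof.
move=> bf pd bp bdp.
apply: (@bC1_intro _ (fun i x => dp (f x) * partial i f x)); first by [].
- by move=> i; apply: bcontM => //; exact: bC1_partial.
- by move=> i x Dx; apply: is_derive_comp_scalar; [exact: pd|exact: bC1_derive].
Qed.

Lemma bC1_exchange f i j x : bC1 f -> bC1 (partial j f) -> D x ->
  is_derive x (basis_vec j) (partial i f) (partial i (partial j f) x).
Proof.
move=> bf bjf Dx; apply: is_derive_partial_exchange.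
  apply: filterS (open_nbhs_nbhs (conj oD Dx)) => y Dy.
  by split; [case: bf => _ /(_ i)[]|case: bf => _ /(_ j)[]|
    case: bjf => _ /(_ i)[]] => df _; exact: df.
by case: (bC1_partial i bjf) => + _; exact.
Qed.

Lemma bcont_measurable f : bcont f -> measurable_fun (D : set (rvec R d)) f.
Proof.
move=> [cf _]; apply: continuous_measurable_rvec => // x.
by rewrite inE => Dx; exact: cf.
Qed.

End bounded_C1.

(** * The pointwise dissipation inequality *)

Section algebra.
Context {R : realType} {d : nat}.

(** The Hessian of [z |-> sqrt (eps^2 + |z|^2)] at [u], with [q] the inverse of
    the square root, sends [a] to [q a - q^3 (u . a) u]. *)
Definition hessH (q : R) (u a : 'I_d -> R) (i : 'I_d) : R :=
  a i * q - u i * (\sum_l u l * a l) * q ^+ 3.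

(** The form is [q (|z|^2 - q^2 (u . z)^2)], which the bound on [q] makes at
    least [q |z - q^2 (u . z) u|^2]. *)
Lemma hessH_psd (q : R) (u z : 'I_d -> R) : 0 <= q ->
  q ^+ 2 * (\sum_l u l ^+ 2) <= 1 -> 0 <= \sum_i hessH q u z i * z i.
Proof.
move=> q0 qu; set s := \sum_l u l * z l.
have -> : \sum_i hessH q u z i * z i = q * (\sum_i z i ^+ 2 - q ^+ 2 * s ^+ 2).
  transitivity (\sum_i (q * z i ^+ 2 - q ^+ 3 * s * (u i * z i))).
    by apply: eq_bigr => i _; rewrite /hessH -/s; ring.
  by rewrite sumrB -!mulr_sumr -/s; ring.
apply: mulr_ge0 => //.
suff : 0 <= \sum_i (z i - q ^+ 2 * s * u i) ^+ 2.
  rewrite (_ : \sum_i _ = \sum_i z i ^+ 2 - 2 * q ^+ 2 * s ^+ 2 +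
    (q ^+ 2 * s) ^+ 2 * \sum_i u i ^+ 2); last first.
    transitivity (\sum_i (z i ^+ 2 - 2 * q ^+ 2 * s * (u i * z i) +
        (q ^+ 2 * s) ^+ 2 * u i ^+ 2)).
      by apply: eq_bigr => i _; ring.
    by rewrite big_split sumrB /= -!mulr_sumr -/s; ring.
  have : q ^+ 2 * s ^+ 2 * (q ^+ 2 * (\sum_l u l ^+ 2)) <= q ^+ 2 * s ^+ 2 * 1.
    by apply: ler_wpM2l => //; rewrite mulr_ge0// sqr_ge0.
  nra.
by apply: sumr_ge0 => i _; exact: sqr_ge0.
Qed.

(** Evaluate the nonnegative form at the rows of [A - lam 1] and sum; the trace
    of the Hessian is at most [d q]. *)
Lemma trace_hessH_bound (q lam : R) (u : 'I_d -> R) (A : 'I_d -> 'I_d -> R) :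
  0 <= q -> q ^+ 2 * (\sum_l u l ^+ 2) <= 1 ->
  2 * lam * (\sum_k hessH q u (A k) k) <=
  \sum_k \sum_i hessH q u (A k) i * A k i + d%:R * lam ^+ 2 * q.
Proof.
move=> q0 qu.
rewrite mulr_sumr -subr_ge0.
have -> : d%:R * lam ^+ 2 * q = \sum_(k < d) lam ^+ 2 * q.
  by rewrite sumr_const card_ord -[RHS]mulr_natl mulrA.
rewrite -big_split -sumrB /=; apply: sumr_ge0 => k _.
pose e (i : 'I_d) : R := (i == k)%:R.
have sume (F : 'I_d -> R) : \sum_i F i * e i = F k.
  rewrite (bigD1 k)//= /e eqxx mulr1 big1 ?addr0// => i /negbTE ->.
  by rewrite mulr0.
have := hessH_psd (fun i => A k i - lam * e i) q0 qu.
rewrite (_ : \sum_i _ = \sum_i hessH q u (A k) i * A k i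
   - 2 * lam * hessH q u (A k) k + lam ^+ 2 * (q - u k ^+ 2 * q ^+ 3)); last first.
  have sz : \sum_l u l * (A k l - lam * e l) = \sum_l u l * A k l - lam * u k.
    rewrite -[in RHS](sume u) mulr_sumr -sumrB; apply: eq_bigr => i _; ring.
  rewrite /hessH sz; set s := \sum_l u l * A k l.
  transitivity (\sum_i ((A k i * q - u i * s * q ^+ 3) * A k i)
    + \sum_i (- lam * q * A k i - lam * (A k i * q - u i * s * q ^+ 3) +
      lam ^+ 2 * q * e i - lam ^+ 2 * u k * u i * q ^+ 3) * e i
    + lam * u k * q ^+ 3 * \sum_i u i * A k i).
    rewrite mulr_sumr -!big_split /=; apply: eq_bigr => i _; ring.
  rewrite sume -/s {1}/e eqxx mulr1n; ring.
have := mulr_ge0 (sqr_ge0 (lam * u k)) (exprn_ge0 3 q0).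
lra.
Qed.

Lemma sqr_sum_le (a : 'I_d -> R) :
  (\sum_i a i) ^+ 2 <= d%:R * \sum_i a i ^+ 2.
Proof.
have [d0|d0] := eqVneq d 0%N.
  by subst d; rewrite !big_ord0 mul0r expr0n.
have dp : 0 < d%:R :> R by rewrite ltr0n lt0n.
rewrite -subr_ge0 -(pmulr_rge0 _ dp).
suff -> : d%:R * (d%:R * \sum_i a i ^+ 2 - (\sum_i a i) ^+ 2) =
  \sum_i (d%:R * a i - \sum_i a i) ^+ 2.
  by apply: sumr_ge0 => i _; exact: sqr_ge0.
set s := \sum_i a i.
transitivity (\sum_i (d%:R ^+ 2 * a i ^+ 2 - 2 * d%:R * s * a i + s ^+ 2)); last first.
  by apply: eq_bigr => i _; ring.
rewrite big_split sumrB /= sumr_const card_ord -!mulr_sumr -/s -[s ^+ 2 *+ d]mulr_natl; ring.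
Qed.

(** Here [r] is the density, [u] its gradient, [A] its Hessian matrix and [F]
    the divergence of the drift term. Taking [lam = (F - K r) / 2] in
    [trace_hessH_bound] absorbs the middle term, whose sign is unknown, into the
    quadratic one, for the price [d q (F - K r)^2 / 4]. The part of this price
    that grows like [|u|^2] is exactly [K q |u|^2], which dictates [K]; the rest
    is a multiple of [q r^2], which dictates [c]. *)
Lemma entropy_dissipation_bound (q eps M L r F K c : R) (u : 'I_d -> R)
    (A : 'I_d -> 'I_d -> R) :
  0 <= q -> q ^+ 2 * (\sum_l u l ^+ 2) <= 1 -> q <= eps^-1 ->
  `|F| <= \sum_i (M * `|u i| + L * `|r|) ->
  K = d%:R ^+ 2 * M ^+ 2 -> c = d%:R ^+ 3 * L ^+ 2 + d%:R * K ^+ 2 / 2 ->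
  0 <= \sum_k \sum_i hessH q u (A k) i * A k i
     + (\sum_k hessH q u (A k) k) * (K * r - F)
     + K * (\sum_k u k * q * u k) + c / eps * r ^+ 2.
Proof.
move=> q0 qu qe FB KE cE.
have := trace_hessH_bound ((F - K * r) / 2) A q0 qu.
set dv := \sum_k _; set Q := \sum_k _.
set U := \sum_l u l ^+ 2.
have UE : \sum_k u k * q * u k = q * U.
  by rewrite mulr_sumr; apply: eq_bigr => i _; ring.
rewrite UE.
have F2 : F ^+ 2 <= 2 * d%:R * M ^+ 2 * U + 2 * d%:R ^+ 2 * L ^+ 2 * r ^+ 2.
  rewrite -real_normK ?num_real//.
  apply: (@le_trans _ _ ((\sum_i (M * `|u i| + L * `|r|)) ^+ 2)).
    by rewrite lerXn2r// nnegrE// (le_trans _ FB).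
  apply: (le_trans (sqr_sum_le _)).
  apply: (@le_trans _ _ (d%:R * \sum_(i < d) (2 * M ^+ 2 * u i ^+ 2 + 2 * L ^+ 2 * r ^+ 2))).
    rewrite ler_wpM2l//; apply: ler_sum => i _.
    rewrite -(real_normK (num_real (u i))) -(real_normK (num_real r)).
    have := sqr_ge0 (M * `|u i| - L * `|r|); lra.
  rewrite big_split /= sumr_const card_ord -mulr_sumr -/U -[(_ * _) *+ d]mulr_natl.
  lra.
have d0 : 0 <= d%:R :> R by [].
have FK : (F - K * r) ^+ 2 <= 2 * F ^+ 2 + 2 * K ^+ 2 * r ^+ 2.
  have := sqr_ge0 (F + K * r); lra.
have U0 : 0 <= U by apply: sumr_ge0 => i _; exact: sqr_ge0.
have step : d%:R * ((F - K * r) / 2) ^+ 2 * q <= K * (q * U) + c * r ^+ 2 * q.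
  apply: (@le_trans _ _ (d%:R / 4 * (2 * (2 * d%:R * M ^+ 2 * U
    + 2 * d%:R ^+ 2 * L ^+ 2 * r ^+ 2) + 2 * K ^+ 2 * r ^+ 2) * q)).
    rewrite (_ : d%:R * ((F - K * r) / 2) ^+ 2 * q =
      d%:R / 4 * (F - K * r) ^+ 2 * q); last by field.
    rewrite ler_wpM2r// ler_wpM2l ?divr_ge0//; lra.
  by rewrite KE cE le_eqVlt; apply/orP; left; apply/eqP; rewrite KE; field.
have c0 : 0 <= c.
  have := mulr_ge0 (exprn_ge0 3 d0) (sqr_ge0 L).
  by have := mulr_ge0 d0 (sqr_ge0 K); rewrite cE; lra.
have : c * r ^+ 2 * q <= c / eps * r ^+ 2.
  by rewrite [leRHS]mulrAC; apply: ler_wpM2l => //; rewrite mulr_ge0// sqr_ge0.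
lra.
Qed.

(** With [J] a gradient field, [B k l i] third derivatives, [A] second ones:
    the third derivatives cancel by symmetry. *)
Lemma flux_divergence_algebra (J u w : 'I_d -> R) (Hs A : 'I_d -> 'I_d -> R)
    (B : 'I_d -> 'I_d -> 'I_d -> R) (m K : R) :
  (forall j k, A j k = A k j) -> (forall j k, B k j k = B j k k) ->
  \sum_k (J k * (w k - \sum_l B k l l + K * u k) + m * Hs k k
    + \sum_j (J j * B k j k + A j k * Hs k j)) =
  (\sum_k Hs k k) * m + \sum_k J k * w k + K * (\sum_k J k * u k)
  + \sum_k \sum_i Hs k i * A k i.
Proof.
move=> Asym Bsym.
under eq_bigr do rewrite big_split /=.
rewrite !big_split /=.
have -> : \sum_k \sum_j J j * B k j k = \sum_k J k * \sum_l B k l l.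
  rewrite exchange_big /=; apply: eq_bigr => j _; rewrite mulr_sumr.
  by apply: eq_bigr => k _; rewrite Bsym.
have -> : \sum_k \sum_j A j k * Hs k j = \sum_k \sum_i Hs k i * A k i.
  by apply: eq_bigr => k _; apply: eq_bigr => j _; rewrite mulrC Asym.
have -> : \sum_k J k * (w k - \sum_l B k l l + K * u k) =
    \sum_k J k * w k - \sum_k J k * (\sum_l B k l l) + K * (\sum_k J k * u k).
  rewrite mulr_sumr -sumrB -big_split /=; apply: eq_bigr => k _; ring.
rewrite -mulr_sumr; ring.
Qed.

End algebra.

Section flux.
Context {R : realType} {d : nat}.
Local Notation V := 'rV[R]_d.
Local Opaque partial.
Variables (D : set V) (eps : R) (r rt : V -> R).
Hypotheses (oD : open D) (eps0 : 0 < eps).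
Hypotheses (br : bC1 D r) (bu : forall i, bC1 D (partial i r)).
Hypotheses (bA : forall k i, bC1 D (partial k (partial i r))) (brt : bC1 D rt).

Definition invH (x : V) : R :=
  (Num.sqrt (eps ^+ 2 + \sum_l partial l r x ^+ 2))^-1.

Definition gradH (i : 'I_d) (x : V) : R := partial i r x * invH x.

Definition hessHr (k i : 'I_d) (x : V) : R :=
  hessH (invH x) (fun l => partial l r x)
    (fun l => partial k (partial l r) x) i.

(** The field [m J + (J . grad) (grad r)], where [J] is [gradH] and
    [m = rt - laplacian r + K r]. The summand [K r] makes [K J . grad r], of
    definite sign, appear in the divergence. *)
Definition flux (K : R) (k : 'I_d) (x : V) : R :=
  gradH k x * (rt x - laplacian r x + K * r x)
  + \sum_j gradH j x * partial j (partial k r) x.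

Lemma laplacianE (f : V -> R) x : laplacian f x = \sum_k partial k (partial k f) x.
Proof.
rewrite /laplacian /divergence; apply: eq_bigr => k _; congr (partial k _ x).
by apply/funext => y; rewrite mxE.
Qed.

Let S (x : V) : R := eps ^+ 2 + \sum_l partial l r x ^+ 2.

Let S_ge x : eps ^+ 2 <= S x.
Proof. by rewrite lerDl sumr_ge0// => i _; exact: sqr_ge0. Qed.

Let S_gt0 x : 0 < S x.
Proof. by apply: lt_le_trans (S_ge x); rewrite exprn_gt0. Qed.

Lemma invH_ge0 x : 0 <= invH x. Proof. by rewrite invr_ge0 sqrtr_ge0. Qed.

Lemma invH_le x : invH x <= eps^-1.
Proof.
rewrite lef_pV2 ?posrE ?sqrtr_gt0//; last exact: S_gt0.
by rewrite -[leLHS](gtr0_norm eps0) -sqrtr_sqr ler_wsqrtr//; exact: S_ge.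
Qed.

Lemma invH_sqr x : invH x ^+ 2 * (\sum_l partial l r x ^+ 2) <= 1.
Proof.
rewrite /invH exprVn (sqr_sqrtr (ltW (S_gt0 x))) mulrC ler_pdivrMr; last exact: S_gt0.
rewrite mul1r.
by rewrite lerDr sqr_ge0.
Qed.

Lemma is_derive_sqr (f : V -> R) x v (df : R) : is_derive x v f df ->
  is_derive x v (fun y => f y ^+ 2) (2 * f x * df).
Proof.
move=> dfx; have := is_derive_prod dfx dfx.
rewrite (_ : (fun y => f y * f y) = fun y => f y ^+ 2)//.
rewrite (_ : f x * df + f x * df = 2 * f x * df)//; ring.
Qed.

Lemma is_derive_invH k x : D x -> is_derive x (basis_vec k) invH
  (- (\sum_l partial l r x * partial k (partial l r) x) * invH x ^+ 3).
Proof.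
move=> Dx.
have dS : is_derive x (basis_vec k) S
    (\sum_l 2 * partial l r x * partial k (partial l r) x).
  rewrite -[X in is_derive _ _ _ X]add0r; apply: is_deriveD.
  apply: (is_derive_sums _ (F := fun l y => partial l r y ^+ 2)
    (dF := fun l => 2 * partial l r x * partial k (partial l r) x)) => l.
  by apply: is_derive_sqr; exact: bC1_derive (bu l) Dx.
have sS : Num.sqrt (S x) != 0 by rewrite gt_eqF// sqrtr_gt0.
have dp : is_derive (S x) 1 (fun s => (Num.sqrt s)^-1)
    (- (Num.sqrt (S x)) ^- 2 * (2 * Num.sqrt (S x))^-1).
  by apply: is_deriveV => //; exact: is_derive1_sqrt.
have := is_derive_comp_scalar dp dS.
rewrite (_ : _ * _ = - (\sum_l partial l r x * partial k (partial l r) x) *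
  invH x ^+ 3)//.
rewrite (_ : \sum_l 2 * _ * _ = 2 * \sum_l partial l r x * partial k (partial l r) x);
  last by rewrite mulr_sumr; apply: eq_bigr => i _; ring.
by rewrite /invH -/(S x); field.
Qed.

Lemma bcont_invH : bcont D invH.
Proof.
have bS : bcont D S.
  apply: bcontD; first exact: bcont_cst.
  apply: (bcont_sum _ (F := fun l y => partial l r y ^+ 2)) => l.
  by under eq_fun do rewrite expr2; apply: bcontM; exact: bC1_bcont (bu l).
split=> [x Dx|].
  apply: continuousV; first by rewrite gt_eqF// sqrtr_gt0 S_gt0.
  apply: continuous_comp; last exact: sqrt_continuous.
  by case: bS => + _; exact.
by exists eps^-1 => x Dx; rewrite ger0_norm ?invH_ge0// invH_le.
Qed.

Lemma bC1_invH : bC1 D invH.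
Proof.
apply: (bC1_intro oD (df := fun i x => - (\sum_l partial l r x *
  partial i (partial l r) x) * invH x ^+ 3) bcont_invH) => i; last first.
  by move=> x; exact: is_derive_invH.
apply: bcontM; last first.
  under eq_fun do rewrite exprS expr2.
  by do 2!(apply: bcontM; first exact: bcont_invH); exact: bcont_invH.
apply: bcontN; apply: (bcont_sum _ (F := fun l y =>
  partial l r y * partial i (partial l r) y)) => l.
by apply: bcontM; [exact: bC1_bcont (bu l)|exact: bC1_bcont (bA _ _)].
Qed.

Lemma bC1_gradH i : bC1 D (gradH i).
Proof. by apply: bC1M; [exact: oD|exact: bu|exact: bC1_invH]. Qed.

Lemma is_derive_gradH k i x : D x ->
  is_derive x (basis_vec k) (gradH i) (hessHr k i x).
Proof.
move=> Dx; have := is_derive_prod (bC1_derive k (bu i) Dx) (is_derive_invH k Dx).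
rewrite (_ : _ + _ = hessHr k i x)//; rewrite /hessHr /hessH; ring.
Qed.

Lemma bcont_hessHr k i : bcont D (hessHr k i).
Proof.
apply: (@bcont_eq _ _ _ oD (partial k (gradH i))).
  by move=> x Dx; case: (is_derive_gradH k i Dx).
exact: bC1_partial (bC1_gradH i).
Qed.

Lemma bC1_laplacian : bC1 D (laplacian r).
Proof.
apply: (@bC1_eq _ _ _ oD (fun x => \sum_k partial k (partial k r) x)).
  by move=> x _; rewrite laplacianE.
by apply: (bC1_sum oD _ (F := fun k x => partial k (partial k r) x)) => k; exact: bA.
Qed.

Let bm (K : R) : bC1 D (fun x => rt x - laplacian r x + K * r x).
Proof.
apply: bC1D; [exact: oD| |apply: bC1M; [exact: oD|exact: bC1_cst|exact: br]].
apply: bC1D; [exact: oD|exact: brt|apply: bC1N; [exact: oD|exact: bC1_laplacian]].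
Qed.

Lemma bC1_flux K k : bC1 D (flux K k).
Proof.
apply: bC1D; first exact: oD.
  by apply: bC1M; [exact: oD|exact: bC1_gradH|exact: bm].
apply: (bC1_sum oD _ (F := fun j x => gradH j x * partial j (partial k r) x)).
by move=> j; apply: bC1M; [exact: oD|exact: bC1_gradH|exact: bA].
Qed.

Lemma partial_sym k i x : D x ->
  partial k (partial i r) x = partial i (partial k r) x.
Proof.
by move=> Dx; case: (bC1_exchange oD i br (bu k) Dx).
Qed.

(** The third derivatives of [r] cancel: this is the pointwise form of
    integrating [gradH . grad (laplacian r)] by parts twice. *)
Lemma divergence_flux K x : D x ->
  \sum_k partial k (flux K k) x =
  (\sum_k hessHr k k x) * (rt x - laplacian r x + K * r x)
  + \sum_k gradH k x * partial k rt x
  + K * (\sum_k gradH k x * partial k r x)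
  + \sum_k \sum_i hessHr k i x * partial k (partial i r) x.
Proof.
move=> Dx.
have dlap k : is_derive x (basis_vec k) (laplacian r)
    (\sum_l partial k (partial l (partial l r)) x).
  rewrite (_ : laplacian r = fun y => \sum_l partial l (partial l r) y); last first.
    by apply/funext => y; rewrite laplacianE.
  apply: (is_derive_sums _ (F := fun l y => partial l (partial l r) y)
    (dF := fun l => partial k (partial l (partial l r)) x)) => l.
  exact: bC1_derive (bA l l) Dx.
have dm k : is_derive x (basis_vec k) (fun x => rt x - laplacian r x + K * r x)
    (partial k rt x - \sum_l partial k (partial l (partial l r)) x
     + K * partial k r x).
  have dKr : is_derive x (basis_vec k) (fun y => K * r y) (K * partial k r x).
    have := is_derive_prod (is_derive_cst K x (basis_vec k)) (bC1_derive k br Dx).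
    by rewrite mulr0 addr0.
  exact: is_derive_add (is_derive_sub (bC1_derive k brt Dx) (dlap k)) dKr.
have dflux k : partial k (flux K k) x =
    gradH k x * (partial k rt x - \sum_l partial k (partial l (partial l r)) x
      + K * partial k r x)
    + (rt x - laplacian r x + K * r x) * hessHr k k x
    + \sum_j (gradH j x * partial k (partial j (partial k r)) x
      + partial j (partial k r) x * hessHr k j x).
  suff : is_derive x (basis_vec k) (flux K k) (gradH k x *
    (partial k rt x - \sum_l partial k (partial l (partial l r)) x
      + K * partial k r x)
    + (rt x - laplacian r x + K * r x) * hessHr k k x
    + \sum_j (gradH j x * partial k (partial j (partial k r)) x
      + partial j (partial k r) x * hessHr k j x)) by case.
  apply: is_derive_add.
    exact: is_derive_prod (is_derive_gradH k k Dx) (dm k).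
  apply: (is_derive_sums _ (F := fun j y => gradH j y * partial j (partial k r) y)
    (dF := fun j => gradH j x * partial k (partial j (partial k r)) x
      + partial j (partial k r) x * hessHr k j x)) => j.
  exact: is_derive_prod (is_derive_gradH k j Dx) (bC1_derive k (bA j k) Dx).
under eq_bigr do rewrite dflux.
have := @flux_divergence_algebra R d (fun k => gradH k x)
  (fun k => partial k r x) (fun k => partial k rt x)
  (fun k i => hessHr k i x) (fun j k => partial j (partial k r) x)
  (fun k l i => partial k (partial l (partial i r)) x)
  (rt x - laplacian r x + K * r x) K.
apply=> j k; first exact: partial_sym.
by case: (bC1_exchange oD j (bu k) (bA k k) Dx).
Qed.

(** Up to the divergence of the flux, the integrand of the entropy rate is the
    opposite of the quantity bounded in [entropy_dissipation_bound]. *)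
Lemma gradH_rt_le_divergence (M L K c F : R) x : D x ->
  rt x - laplacian r x + F = 0 ->
  `|F| <= \sum_i (M * `|partial i r x| + L * `|r x|) ->
  K = d%:R ^+ 2 * M ^+ 2 -> c = d%:R ^+ 3 * L ^+ 2 + d%:R * K ^+ 2 / 2 ->
  \sum_k gradH k x * partial k rt x <=
    \sum_k partial k (flux K k) x + c / eps * r x ^+ 2.
Proof.
move=> Dx eqF FB KE cE; rewrite divergence_flux//.
have := entropy_dissipation_bound (fun k i => partial k (partial i r) x)
  (invH_ge0 x) (invH_sqr x) (invH_le x) FB KE cE.
have -> : rt x - laplacian r x + K * r x = K * r x - F by lra.
rewrite /gradH /hessHr.
set Q := \sum_k \sum_i _; set dv := \sum_k hessH _ _ _ _.
lra.
Qed.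

End flux.

(** * Products with a Lipschitz function and convexity *)

Section coordinates.
Context {R : realType} {d : nat}.
Local Notation V := 'rV[R]_d.

Lemma coord_le_norm (x : V) i : `|x ord0 i| <= `|x|.
Proof.
rewrite [leRHS]/Num.norm /= mx_normrE.
exact: (le_bigmax _ (fun ij : 'I_1 * 'I_d => `|x ij.1 ij.2|) (ord0, i)).
Qed.

Lemma norm_basis_vec_le1 (i : 'I_d) : `|basis_vec i : V| <= 1.
Proof.
rewrite [leLHS]/Num.norm /= mx_normrE; apply/bigmax_leP; split=> // -[j k] _ /=.
by rewrite !mxE; case: (_ && _); rewrite ?normr1 ?normr0.
Qed.

(** The bound is read off the difference quotients, because where [r] vanishes
    the product can be derivable without [w] being so. *)
Lemma partial_mul_bound (D : set V) (r w : V -> R) (M L : R) (x : V) i :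
  open D -> D x -> 0 <= L ->
  (forall y, D y -> `|w y| <= M) ->
  (forall y, D y -> `|w y - w x| <= L * `|y - x|) ->
  derivable r x (basis_vec i) ->
  derivable (fun y => r y * w y) x (basis_vec i) ->
  `|partial i (fun y => r y * w y) x| <= M * `|partial i r x| + L * `|r x|.
Proof.
move=> oD Dx L0 wM wL dr drw.
rewrite -lerBlDl.
have lim : (fun h : R => `|h^-1 *: (((fun y => r y * w y) \o shift x)
      (h *: basis_vec i) - r x * w x)| -
    M * `|h^-1 *: ((r \o shift x) (h *: basis_vec i) - r x)|) @ 0^' -->
    `|partial i (fun y => r y * w y) x| - M * `|partial i r x|.
  apply: cvgB; first exact: cvg_norm drw.
  by apply: cvgMl_tmp; exact: cvg_norm dr.
apply: (cvgr_to_le lim).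
have nD : \forall h \near (0 : R)^', D (h *: basis_vec i + x).
  apply: cvg_within.
  have : (fun h : R => h *: basis_vec i + x) @ 0 --> (0 : R) *: basis_vec i + x.
    by apply: cvgD; [apply: cvgZr_tmp; exact: cvg_id|exact: cvg_cst].
  by rewrite scale0r add0r; apply; exact: open_nbhs_nbhs.
near=> h; rewrite /= lerBlDl.
have hn0 : h != 0 by near: h; exact: nbhs_dnbhs_neq.
have Dh : D (h *: basis_vec i + x) by near: h.
rewrite (_ : r _ * w _ - r x * w x = w (h *: basis_vec i + x) *
   (r (h *: basis_vec i + x) - r x) + r x * (w (h *: basis_vec i + x) - w x));
  last by ring.
rewrite scalerDr (le_trans (ler_normD _ _))// lerD//.
  rewrite /GRing.scale /= mulrCA normrM ler_wpM2r// wM//.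
rewrite /GRing.scale /= mulrCA normrM [leRHS]mulrC ler_wpM2l// normrM normfV.
rewrite ler_pdivrMl ?normr_gt0// (le_trans (wL _ Dh))// addrK normrZ.
by rewrite [leRHS]mulrC ler_wpM2l// ler_piMr// norm_basis_vec_le1.
Unshelve. all: by end_near. Qed.

End coordinates.

Section convexity.
Context {R : realType}.

(** If [a < 0], then [dpsi s - dpsi (- s) < 0] for small positive [s], so that
    [psi s + psi (- s)] decreases strictly from its value at [0]. *)
Lemma second_derivative_ge0 (psi dpsi : R -> R) (a : R) :
  (forall s : R, is_derive s 1 psi (dpsi s)) -> is_derive (0 : R) 1 dpsi a ->
  (forall s, 2 * psi 0 <= psi s + psi (- s)) -> 0 <= a.
Proof.
move=> dp ddp mid; rewrite leNgt; apply/negP => a0.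
have : (fun h => h^-1 *: ((dpsi \o shift 0) (h *: (1 : R)) - dpsi 0)) @ 0^' --> a.
  by case: ddp => + <-.
have a2 : 0 < - a / 2 by rewrite divr_gt0// oppr_gt0.
move=> /cvgrPdist_lt/(_ _ a2)/nbhs_ballP[e/= e0 He].
have decr s : 0 < s < e -> dpsi s - dpsi (- s) < 0.
  move=> /andP[s0 se].
  have q (t : R) : t != 0 -> `|t| < e -> t^-1 * (dpsi t - dpsi 0) < 0.
    move=> t0 te.
    have := He t; rewrite /ball/= sub0r normrN => /(_ te t0).
    rewrite addr0 [t%:A]mulr1 /GRing.scale/= ltr_norml => /andP[H _].
    lra.
  have := q s; rewrite gt_eqF// gtr0_norm// => /(_ isT se).
  rewrite pmulr_rlt0 ?invr_gt0// => H1.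
  have := q (- s); rewrite oppr_eq0 gt_eqF// normrN gtr0_norm// => /(_ isT se).
  rewrite invrN mulNr oppr_lt0 pmulr_rgt0 ?invr_gt0// => H2.
  lra.
have e2 : 0 < e / 2 by rewrite divr_gt0.
have dq (s : R) : is_derive s 1 (fun s => psi s + psi (- s)) (dpsi s - dpsi (- s)).
  apply: is_deriveD.
  have := is_derive1_comp (f := psi) (g := -%R) (dp (- s)) (is_deriveNid s 1).
  by rewrite mulrN1.
have [c ce E] := MVT e2 (fun s _ => dq s) (ltac:(
  apply: continuous_subspaceT => s; apply: differentiable_continuous;
  apply/derivable1_diffP; by case: (dq s))).
have /decr : 0 < c < e.
  move: ce; rewrite in_itv/= => /andP[-> ce] /=; lra.
have := mid (e / 2); rewrite oppr0 in E.
move: E; rewrite addr0 => E H1 H2.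
have : (dpsi c - dpsi (- c)) * (e / 2) < 0 by rewrite nmulr_rlt0.
rewrite -E; lra.
Qed.

Context {d : nat}.
Local Notation V := 'rV[R]_d.
Variable h : V -> R.
Hypothesis ch : convex_function [set: V] h.

Lemma convex_combination_le (x y : V) (t : R) : 0 <= t -> t <= 1 ->
  h (t *: x + (1 - t) *: y) <= t * h x + (1 - t) * h y.
Proof.
move=> t0 t1.
by have := ch (Itv01 t0 t1) (mem_setT x) (mem_setT y).
Qed.

Lemma convex_hessian_ge0 (x z : V) : smooth h ->
  0 <= \sum_i z ord0 i * \sum_j z ord0 j * partial j (partial i h) x.
Proof.
move=> sh.
have d1 (s : R) : is_derive s 1 (fun s : R => h (s *: z + x))
    (\sum_i z ord0 i * partial i h (s *: z + x)).
  apply: (is_derive_lineP h x z s _).1; apply: is_derive_direction.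
    apply: (@nearW _ (nbhs (s *: z + x))) => y i; exact: (sh [::]).2.
  by move=> i; exact: (sh [:: i]).1.
have d2 i : is_derive (0 : R) 1 (fun s : R => partial i h (s *: z + x))
    (\sum_j z ord0 j * partial j (partial i h) x).
  apply: (is_derive_line0 (partial i h) x z _).1; apply: is_derive_direction.
    apply: (@nearW _ (nbhs x)) => y j; exact: (sh [:: i]).2.
  by move=> j; exact: (sh [:: j; i]).1.
have dd : is_derive (0 : R) 1
    (fun s : R => \sum_i z ord0 i * partial i h (s *: z + x))
    (\sum_i z ord0 i * \sum_j z ord0 j * partial j (partial i h) x).
  apply: (is_derive_sums _ (F := fun i (s : R) => z ord0 i * partial i h (s *: z + x))
    (dF := fun i => z ord0 i * \sum_j z ord0 j * partial j (partial i h) x)).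
apply: (second_derivative_ge0 d1 dd) => s; rewrite scale0r add0r.
have h2 : 0 <= 2^-1 :> R by rewrite invr_ge0.
have := convex_combination_le (s *: z + x) (- s *: z + x) h2.
rewrite (_ : 1 - 2^-1 = 2^-1); last by lra.
rewrite (_ : 2^-1 *: _ + 2^-1 *: _ = x); last first.
  rewrite -scalerDr scaleNr addrACA subrr add0r scalerDr -scalerDl.
  by rewrite (_ : 2^-1 + 2^-1 = 1) ?scale1r//; lra.
by move=> /(_ (ltac:(lra))); lra.
Qed.

End convexity.

(** * A cutoff function *)

Section cutoff.
Context {R : realType}.

Let pos (s : R) : R := Num.max s 0.

Let is_derive_pos_exp n (s : R) : is_derive s 1 (fun s => pos s ^+ n.+2)
  (n.+2%:R * pos s ^+ n.+1).
Proof.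
have [s0|s0|->] := ltgtP s 0.
- rewrite {2}/pos max_r ?ltW// expr0n mulr0.
  apply: near_eq_is_derive (is_derive_cst (0 : R) s 1).
  near=> t; rewrite /pos max_r ?expr0n//.
  by apply/ltW; near: t; exact: lt_nbhsl.
- rewrite {2}/pos max_l ?ltW//.
  have dX : is_derive s 1 (fun s : R => s ^+ n.+2) (n.+2%:R * s ^+ n.+1).
    have := is_deriveX n.+2 (is_derive_id s (1 : R)).
    by rewrite exprfctE /GRing.scale /= mulr1.
  apply: near_eq_is_derive dX; near=> t; rewrite /pos max_l//.
  by apply/ltW; near: t; exact: lt_nbhsr.
- rewrite {2}/pos maxxx expr0n mulr0.
  suff lim0 : (fun h => h^-1 *: (((fun s => pos s ^+ n.+2) \o shift 0)
      (h *: (1 : R)) - pos 0 ^+ n.+2)) @ 0^' --> (0 : R).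
    by split; [apply/cvg_ex; exists 0|apply: cvg_lim lim0].
  apply/cvgrPdist_le => e e0; near=> h.
  have h0 : h != 0 by near: h; exact: nbhs_dnbhs_neq.
  have h1 : `|h| < Num.min 1 e.
    by near: h; apply: dnbhs0_lt; rewrite lt_min ltr01.
  rewrite sub0r normrN /= addr0 [h%:A]mulr1 {2}/pos maxxx expr0n subr0.
  rewrite /GRing.scale /= normrM normfV ler_pdivrMl ?normr_gt0// normrX.
  have ph : `|pos h| <= `|h|.
    rewrite /pos; case: (leP h 0) => [_|h0']; first by rewrite normr0.
    by rewrite lexx.
  move: h1; rewrite lt_min => /andP[h1 he].
  apply: (@le_trans _ _ (`|h| ^+ n.+2)); first by rewrite lerXn2r// nnegrE.
  rewrite exprS ler_wpM2l// exprS (le_trans _ (ltW he))//.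
  by rewrite ler_piMr// exprn_ile1// ltW.
Unshelve. all: by end_near. Qed.

(** Third differences of [pos ^ 3 / 6] and of its derivatives: [cutoff] is the
    primitive of a quadratic B-spline supported in [1, 4], which has the two
    continuous derivatives that the divergence of the cut off flux involves. *)
Definition cutoff (s : R) : R :=
  (pos (s - 1) ^+ 3 - 3 * pos (s - 2) ^+ 3 + 3 * pos (s - 3) ^+ 3
   - pos (s - 4) ^+ 3) / 6.
Definition cutoff' (s : R) : R :=
  (pos (s - 1) ^+ 2 - 3 * pos (s - 2) ^+ 2 + 3 * pos (s - 3) ^+ 2
   - pos (s - 4) ^+ 2) / 2.
Definition cutoff'' (s : R) : R :=
  pos (s - 1) - 3 * pos (s - 2) + 3 * pos (s - 3) - pos (s - 4).

Let is_derive_pos_shift n (a s : R) : is_derive s 1 (fun s => pos (s - a) ^+ n.+2)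
  (n.+2%:R * pos (s - a) ^+ n.+1).
Proof.
have ds : is_derive s 1 (fun s => s - a) 1.
  have := is_derive_sub (is_derive_id s (1 : R)) (is_derive_cst a s (1 : R)).
  by rewrite subr0.
have := @is_derive1_comp _ (fun s => pos s ^+ n.+2) (fun s => s - a) s _ _
  (is_derive_pos_exp n (s - a)) ds.
by rewrite mulr1.
Qed.

Let third_difference n (k s : R) : is_derive s 1
  (fun s => (pos (s - 1) ^+ n.+2 - 3 * pos (s - 2) ^+ n.+2
    + 3 * pos (s - 3) ^+ n.+2 - pos (s - 4) ^+ n.+2) * k)
  ((pos (s - 1) ^+ n.+1 - 3 * pos (s - 2) ^+ n.+1
    + 3 * pos (s - 3) ^+ n.+1 - pos (s - 4) ^+ n.+1) * (n.+2%:R * k)).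
Proof.
have cM (c df : R) (f : R -> R) : is_derive s 1 f df ->
    is_derive s 1 (fun s => c * f s) (c * df).
  move=> dfs; have := is_derive_prod (is_derive_cst c s (1 : R)) dfs.
  by rewrite mulr0 addr0.
have d a := is_derive_pos_shift n a s.
have D := is_derive_sub (is_derive_add (is_derive_sub (d 1) (cM 3 _ _ (d 2)))
  (cM 3 _ _ (d 3))) (d 4).
have := cM k _ _ D.
set g := fun s => k * _; set f := fun s => _ * k.
have -> : g = f by apply/funext => t; rewrite /g /f mulrC.
by move=> Dg; apply: (is_derive_eq Dg); ring.
Qed.

Lemma is_derive_cutoff (s : R) : is_derive s 1 cutoff (cutoff' s).
Proof.
have := third_difference 1 6^-1 s.
by move=> D; apply: (is_derive_eq D); rewrite /cutoff'; field.
Qed.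

Lemma is_derive_cutoff' (s : R) : is_derive s 1 cutoff' (cutoff'' s).
Proof.
have := third_difference 0 2^-1 s.
by move=> D; apply: (is_derive_eq D); rewrite /cutoff'' !expr1; field.
Qed.

Lemma continuous_cutoff'' : continuous cutoff''.
Proof.
have cpos a : continuous (fun s : R => pos (s - a)).
  move=> s; rewrite (_ : (fun s => _) = fun s => ((s - a) + `|s - a|) * 2^-1).
    apply: cvgMr_tmp; apply: cvgD; last apply: cvg_norm.
      by apply: cvgB; [exact: cvg_id|exact: cvg_cst].
    by apply: cvgB; [exact: cvg_id|exact: cvg_cst].
  by apply/funext => t; rewrite /pos maxr_absE subr0 addr0.
have c3 a : continuous (fun s : R => 3 * pos (s - a)).
  by move=> s; apply: cvgMl_tmp; exact: cpos.
move=> s; apply: cvgB; last exact: cpos.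
apply: cvgD; last exact: c3.
by apply: cvgB; [exact: cpos|exact: c3].
Qed.

Let posE (s : R) : (s <= 0 /\ pos s = 0) \/ (0 < s /\ pos s = s).
Proof. by rewrite /pos; case: (leP s 0) => ?; [left|right]. Qed.

Lemma cutoff_le1 s : s <= 1 -> [/\ cutoff s = 0, cutoff' s = 0 & cutoff'' s = 0].
Proof.
move=> s1; rewrite /cutoff /cutoff' /cutoff''.
have p (a : R) : 1 <= a -> pos (s - a) = 0.
  by move=> a1; rewrite /pos max_r// subr_le0 (le_trans s1).
rewrite !p; [|lra..].
by rewrite !expr0n /=; split; ring.
Qed.

Lemma cutoff_ge4 s : 4 <= s -> [/\ cutoff s = 1, cutoff' s = 0 & cutoff'' s = 0].
Proof.
move=> s4; rewrite /cutoff /cutoff' /cutoff''.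
have p (a : R) : a <= 4 -> pos (s - a) = s - a.
  by move=> a4; rewrite /pos max_l// subr_ge0 (le_trans a4).
rewrite !p; [|lra..].
by split; field.
Qed.

(** The last two bounds are those that are invariant under dilations of the
    argument, hence uniform in the width of the boundary layer. *)
Lemma cutoff_bounds s : [/\ 0 <= cutoff s <= 1, 0 <= cutoff' s,
  `|s * cutoff' s| <= 4 & `|s ^+ 2 * cutoff'' s| <= 16].
Proof.
have [s1|s1] := leP s 1.
  have [-> -> ->] := cutoff_le1 s1; rewrite !mulr0 normr0; split; lra.
have [s4|s4] := leP 4 s.
  have [-> -> ->] := cutoff_ge4 s4; rewrite !mulr0 normr0; split; lra.
suff [c01 [c' c'1] c''] : [/\ 0 <= cutoff s <= 1, 0 <= cutoff' s /\ cutoff' s <= 1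
    & `|cutoff'' s| <= 1].
  split=> //.
    rewrite normrM !ger0_norm//; last by lra.
    apply: (@le_trans _ _ (s * 1)); last by lra.
    by rewrite ler_wpM2l//; lra.
  rewrite normrM (ger0_norm (sqr_ge0 _)) -[leRHS]mulr1.
  by apply: ler_pM => //; first exact: sqr_ge0; nra.
rewrite /cutoff /cutoff' /cutoff''.
(* On each of the intervals ]1, 2], ]2, 3] and ]3, 4[ the claims are polynomial
   inequalities in a variable of [0, 1]; the monomials and squares they rest on
   are supplied to lra. *)
have -> : pos (s - 1) = s - 1 by rewrite /pos max_l//; lra.
have -> : pos (s - 4) = 0 by rewrite /pos max_r//; lra.
have [[s2 ->]|[s2 ->]] := posE (s - 2).
  have -> : pos (s - 3) = 0 by rewrite /pos max_r//; lra.
  have t0 : 0 <= s - 1 by lra.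
  have t1 : s - 1 <= 1 by lra.
  have t3 := exprn_ge0 3 t0; have t3' := exprn_ile1 3 t0 t1.
  have t2 := exprn_ge0 2 t0; have t2' := exprn_ile1 2 t0 t1.
  rewrite !expr0n /= ler_norml.
  split; [apply/andP; split|split|apply/andP; split]; lra.
have [[s3 ->]|[s3 ->]] := posE (s - 3).
  have t1 : s - 2 <= 1 by lra.
  have t2 := mulr_ge0 (ltW s2) (_ : 0 <= 1 - (s - 2)).
  have {}t2 := t2 (ltac:(lra)).
  have t3 := mulr_ge0 (ltW s2) t2; have t5 := sqr_ge0 (s - 2).
  have t6 := sqr_ge0 (2 * (s - 2) - 1).
  have t4 := mulr_ge0 (sqr_ge0 (1 - (s - 2))) (_ : 0 <= 1 + 2 * (s - 2)).
  have {}t4 := t4 (ltac:(lra)).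
  rewrite !expr0n /= ler_norml.
  split; [apply/andP; split|split|apply/andP; split]; lra.
have t0 : 0 <= 4 - s by lra.
have t1 : 4 - s <= 1 by lra.
have t3 := exprn_ge0 3 t0; have t3' := exprn_ile1 3 t0 t1.
have t2 := exprn_ge0 2 t0; have t2' := exprn_ile1 2 t0 t1.
rewrite !expr0n /= ler_norml.
split; [apply/andP; split|split|apply/andP; split]; lra.
Qed.

End cutoff.

(** * Decay at the boundary of a convex domain *)

Section decay.
Context {R : realType} {d : nat}.
Local Notation V := 'rV[R]_d.
Local Opaque partial.

Lemma bC1_segment_lipschitz (D : set V) (g : V -> R) : open D -> bC1 D g ->
  exists2 N, 0 <= N & forall x w, 
    (forall s, 0 <= s <= 1 -> D (s *: w + x)) -> `|g (w + x) - g x| <= N * `|w|.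
Proof.
move=> oD bg.
have [M Mb] : {M : 'I_d -> R | forall i x, D x -> `|partial i g x| <= M i}.
  apply: cid; have [M] := choice (fun i => (bC1_partial i bg).2).
  by exists M.
exists (\sum_i `|M i|) => [|x w seg]; first exact: sumr_ge0.
have dg (s : R) : 0 <= s <= 1 -> is_derive s 1 (fun s : R => g (s *: w + x))
    (\sum_i w ord0 i * partial i g (s *: w + x)).
  move=> /seg Ds; apply: (is_derive_lineP g x w s _).1.
  apply: is_derive_direction => [|i].
    apply: filterS (open_nbhs_nbhs (conj oD Ds)) => y Dy i.
    by case: bg => _ /(_ i)[+ _]; exact.
  by case: (bC1_partial i bg) => + _; exact.
have cg (s : R) : 0 <= s <= 1 -> {for s, continuous (fun s : R => g (s *: w + x))}.
  move=> s01; apply: differentiable_continuous; apply/derivable1_diffP.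
  by case: (dg s s01).
have [||s] := @MVT_segment R (fun s => g (s *: w + x))
    (fun s => \sum_i w ord0 i * partial i g (s *: w + x)) 0 1 ler01.
- by move=> s; rewrite in_itv/= => /andP[s0 s1]; apply: dg; rewrite !ltW.
- apply: continuous_in_subspaceT => s; rewrite inE/= in_itv/=; exact: cg.
rewrite in_itv/= => s01; rewrite scale1r scale0r add0r subr0 mulr1 => ->.
rewrite (le_trans (ler_norm_sum _ _ _))// mulr_suml; apply: ler_sum => i _.
rewrite normrM mulrC ler_pM//; last exact: coord_le_norm.
by rewrite (le_trans (Mb _ _ (seg _ s01)))// ler_norm.
Qed.

(** Along the ray from a fixed interior point [x0] through [x], [g] tends to [0]
    at the exit point, whose distance to [x] is of order [- h x] because the
    convex function [h] increases at a definite rate along the ray. *)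
Lemma boundary_decay (h g : V -> R) : let D := [set x | h x < 0] in
  open D -> convex_function [set: V] h -> bounded_set D -> bC1 D g ->
  (forall y, boundary D y -> g x @[x --> within D (nbhs y)] --> (0 : R)) ->
  exists2 C, 0 <= C & forall x, D x -> `|g x| <= C * (- h x).
Proof.
move=> D oD ch [B [_ DB]] bg gbd.
have [[x0 Dx0]|D0] := pselect (exists x, D x); last first.
  by exists 0 => // x Dx; exfalso; apply: D0; exists x.
have [N N0 lipN] := bC1_segment_lipschitz oD bg.
pose b := `|B| + 1; have b0 : 0 < b by rewrite ltr_wpDl.
have {}DB x : D x -> `|x| <= b.
  by move=> Dx; apply: DB => //; rewrite /b ltr_pwDr// ler_norm.
pose m := - h x0; have m0 : 0 < m by rewrite oppr_gt0.
have C0 : 0 <= N * (2 * b / m) by rewrite mulr_ge0// divr_ge0 ?mulr_ge0 ?ltW.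
exists (N * (2 * b / m) + `|g x0| / m).
  by rewrite addr_ge0// divr_ge0// ltW.
move=> x Dx; have hx : 0 < - h x by rewrite oppr_gt0.
have [xx0|xx0] := eqVneq x x0.
  rewrite xx0 mulrDl -/m divfK ?gt_eqF// lerDr.
  by rewrite mulr_ge0// ltW.
have [w wE] : {w : V | w = x - x0} by exists (x - x0).
have w0 : 0 < `|w| by rewrite normr_gt0 wE subr_eq0.
pose ray (t : R) := t *: w + x.
have ray_conv t u : 0 <= t -> t <= u -> D (ray u) -> D (ray t).
  move=> t0 tu Du; have [u0|u0] := leP u 0.
    have -> : t = 0 by apply/eqP; rewrite eq_le t0 (le_trans tu u0).
    by rewrite /ray scale0r add0r.
  have -> : ray t = (t / u) *: ray u + (1 - t / u) *: x.
    rewrite /ray scalerDr scalerA divfK ?gt_eqF// -addrA -scalerDl.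
    by rewrite addrCA subrr addr0 scale1r.
  have tu0 : 0 <= t / u by rewrite divr_ge0// ltW.
  have tu1 : t / u <= 1 by rewrite ler_pdivrMr// mul1r.
  apply: le_lt_trans (convex_combination_le ch _ _ tu0 tu1) _.
  have : t / u * h (ray u) <= 0 by rewrite mulr_ge0_le0// ltW.
  have : (1 - t / u) * h x <= 0 by rewrite mulr_ge0_le0 ?subr_ge0// ltW.
  have [tu1'|tu1'] := ltP (t / u) 1.
    have : (1 - t / u) * h x < 0 by rewrite pmulr_rlt0 ?subr_gt0.
    lra.
  have -> : t / u = 1 by apply/eqP; rewrite eq_le tu1.
  by rewrite subrr mul0r addr0 mul1r.
pose E := [set t : R | 0 <= t /\ D (ray t)].
have E0 : E 0 by split => //; rewrite /ray scale0r add0r.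
have Eub t : E t -> t <= 2 * b / `|w|.
  move=> [t0 Dt]; rewrite ler_pdivlMr//.
  rewrite -{1}(ger0_norm t0) -normrZ.
  rewrite (_ : t *: w = ray t - x); last by rewrite /ray addrK.
  rewrite (le_trans (ler_normB _ _))//.
  by rewrite mulr_natl mulr2n lerD// DB.
have supE : has_sup E by split; [exists 0|exists (2 * b / `|w|) => t /Eub].
(* The exit point of the ray is [ray ts]. *)
pose ts := sup E.
have ts_lt t : 0 <= t -> t < ts -> D (ray t).
  move=> t0 /(sup_gt supE.1)[u [_ Du] tu].
  exact: ray_conv t0 (ltW tu) Du.
have near_ray (t : R) : D (ray t) -> \forall u \near t, D (ray u).
  move=> Dt.
  have : ray u @[u --> t] --> ray t.
    by apply: cvgD; [apply: cvgZr_tmp; exact: cvg_id|exact: cvg_cst].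
  by apply; exact: open_nbhs_nbhs.
have ts0 : 0 < ts.
  have /near_ray/nbhs_ballP[e/= e0 He] := E0.2.
  have e2 : 0 < e / 2 by rewrite divr_gt0.
  apply: (lt_le_trans e2); apply: ub_le_sup supE.2 _ _; split; first exact: ltW.
  apply: He; rewrite /ball/= sub0r normrN gtr0_norm//; lra.
have nDts : ~ D (ray ts).
  move=> /near_ray/nbhs_ballP[e/= e0 He].
  have e2 : 0 < e / 2 by rewrite divr_gt0.
  have : ts + e / 2 <= ts.
    apply: (ub_le_sup supE.2); split; first by rewrite addr_ge0 ?ltW.
    apply: He; rewrite /ball/= opprD addrA subrr sub0r normrN gtr0_norm//; lra.
  lra.
have c : ray u @[u --> ts^'-] --> ray ts.
  apply: cvg_at_left_filter.
  by apply: cvgD; [apply: cvgZr_tmp; exact: cvg_id|exact: cvg_cst].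
have ray_cvg : ray u @[u --> ts^'-] --> within D (nbhs (ray ts)).
  move=> P /= nP; have := c _ nP; rewrite /nbhs /= => cP.
  near=> u.
  have : (D (ray u) -> P (ray u)) by near: u; exact: cP.
  apply; apply: ts_lt; near: u; last exact: nbhs_left_lt.
  exact: nbhs_left_ge.
have bts : boundary D (ray ts).
  split; last by move=> /interior_subset.
  move=> P nP.
  apply: (@filter_ex _ (ray u @[u --> ts^'-])) => /=.
  near=> u; split; last by near: u; exact: c.
  by apply: ts_lt; near: u; [exact: nbhs_left_ge|exact: nbhs_left_lt].
have step t : 0 <= t -> t < ts ->
    `|g x| - N * (2 * b / m) * (- h x) <= `|g (ray t)|.
  move=> t0 tts; have Dt := ts_lt t t0 tts.
  have seg s : 0 <= s <= 1 -> D (s *: (t *: w) + x).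
    move=> /andP[s0 s1]; rewrite scalerA; apply: (@ray_conv _ t) => //.
      exact: mulr_ge0.
    by rewrite ler_piMl.
  have := lipN x (t *: w) seg; rewrite -/(ray t) normrZ (ger0_norm t0) => lip.
  have tp : 0 < 1 + t by rewrite ltr_wpDr.
  (* [x] is a convex combination of [ray t], where [h < 0], and of [x0]. *)
  have hxt : h x <= t / (1 + t) * - m.
    have p0 : 0 <= (1 + t)^-1 by rewrite invr_ge0 ltW.
    have p1 : (1 + t)^-1 <= 1 by rewrite invf_le1// lerDl.
    have := convex_combination_le ch (ray t) x0 p0 p1.
    have q1 : 1 - (1 + t)^-1 = t / (1 + t) by field; rewrite gt_eqF.
    rewrite q1 (_ : _ + _ *: x0 = x); last first.
      apply/rowP => i; rewrite /ray wE !mxE; field.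
      by rewrite gt_eqF.
    rewrite /m opprK => /le_trans; apply; rewrite gerDr.
    by rewrite mulr_ge0_le0// ltW.
  have tw : t * `|w| <= 2 * b / m * (- h x).
    have w2 : (1 + t) * `|w| <= 2 * b.
      rewrite -{1}(gtr0_norm tp) -normrZ.
      rewrite (_ : (1 + t) *: w = ray t - x0); last first.
        by rewrite scalerDl scale1r addrC /ray -addrA -wE.
      rewrite (le_trans (ler_normB _ _))//.
      by rewrite mulr_natl mulr2n lerD// DB.
    have bm : 0 <= 2 * b / m by rewrite divr_ge0 ?mulr_ge0 ?ltW.
    have hm : t / (1 + t) * m <= - h x by lra.
    apply: le_trans (ler_wpM2l bm hm).
    rewrite (_ : 2 * b / m * (t / (1 + t) * m) = t * (2 * b / (1 + t))); last first.
      by field; rewrite !gt_eqF.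
    by rewrite ler_wpM2l// ler_pdivlMr// mulrC.
  have : N * (t * `|w|) <= N * (2 * b / m * (- h x)) by exact: ler_wpM2l.
  have := ler_normB (g (ray t)) (g (ray t) - g x).
  rewrite opprB addrC subrK; lra.
have lim : `|g (ray t)| @[t --> ts^'-] --> `|0 : R|.
  by apply: cvg_norm; apply: cvg_comp ray_cvg (gbd _ bts).
have : `|g x| - N * (2 * b / m) * (- h x) <= `|0 : R|.
  apply: (cvgr_to_ge lim); near=> t.
  by apply: step; near: t; [exact: nbhs_left_ge|exact: nbhs_left_lt].
have := mulr_ge0 (divr_ge0 (normr_ge0 (g x0)) (ltW m0)) (ltW hx).
rewrite normr0; lra.
Unshelve. all: by end_near. Qed.

End decay.

(** * The divergence theorem on the cell *)

Section cells.
Context {R : realType} {d : nat}.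
Local Notation V := 'rV[R]_d.
Local Notation mu := (lebesgue_rvec d).
Local Opaque partial.
Implicit Type Omega : domain R d.

Lemma smooth_continuous (h : V -> R) : smooth h -> continuous h.
Proof. by move=> sh; exact: (sh [::]).1. Qed.

Lemma open_points Omega : admissible_domain Omega -> open (points Omega).
Proof.
case: Omega => [_|h [sh _ _]] /=; first exact: openT.
have -> : [set x | h x < 0] = h @^-1` [set t | t < 0] by [].
apply: open_comp => [x _|]; [exact: smooth_continuous|exact: open_lt].
Qed.

Lemma cell_sub_points Omega : cell Omega `<=` points Omega.
Proof. by case: Omega => [|h] x. Qed.

Lemma points_box (h : V -> R) : bounded_set [set x | h x < 0] ->
  exists2 b : R, 0 < b & forall x, h x < 0 -> forall i, - b < x ord0 i < b.
Proof.
move=> [B [_ DB]]; exists (`|B| + 2) => [|x hx i]; first by rewrite ltr_wpDl.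
rewrite -ltr_norml (le_lt_trans (coord_le_norm x i))//.
apply: (@le_lt_trans _ _ (`|B| + 1)); last by rewrite ltrD2l; lra.
by apply: DB => //; rewrite ltr_pwDr// ler_norm.
Qed.

Lemma compact_closure_bounded (D : set V) : bounded_set D -> compact (closure D).
Proof.
move=> [B [Br DB]].
apply: bounded_closed_compact; last exact: closed_closure.
exists B; split=> // b Bb x Dx.
have cb : closed [set z : V | `|z| <= b].
  have -> : [set z : V | `|z| <= b] = (fun z : V => `|z|) @^-1` [set t | t <= b] by [].
  by apply: closed_comp => [z _|]; [exact: norm_continuous|exact: closed_le].
have /closure_subset : D `<=` [set z : V | `|z| <= b].
  by move=> z Dz; exact: DB Dz.
by move=> /(_ _ Dx); rewrite -(closure_id _).1.
Qed.

Lemma measurable_cell Omega : admissible_domain Omega ->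
  measurable (cell Omega : set (rvec R d)).
Proof.
case: Omega => [_|h adm]; first exact: measurable_halfopen_box.
exact: open_measurable_rvec (open_points adm).
Qed.

Lemma lebesgue_cell_lty Omega : admissible_domain Omega ->
  (mu (cell Omega : set (rvec R d)) < +oo)%E.
Proof.
case: Omega => [_|h adm]; first exact: lebesgue_halfopen_box_lty.
have [_ _ /points_box[b b0 hb]] := adm.
apply: le_lt_trans (lebesgue_halfopen_box_lty (- b) b).
apply: le_measure; rewrite ?inE; first exact: (@measurable_cell (Sublevel h)).
  exact: measurable_halfopen_box.
by move=> x hx i; have /andP[/ltW -> ->] := hb x hx i.
Qed.

Lemma bcont_measurable_cell Omega (f : V -> R) : admissible_domain Omega ->
  bcont (points Omega) f -> measurable_fun (cell Omega : set (rvec R d)) f.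
Proof.
move=> adm bf; have oD := open_points adm.
apply: (@measurable_funS _ _ (rvec R d) _ (points Omega)).
- exact: open_measurable_rvec.
- exact: cell_sub_points.
- exact: bcont_measurable bf.
Qed.

Lemma bcont_integrable Omega (f : V -> R) : admissible_domain Omega ->
  bcont (points Omega) f ->
  mu.-integrable (cell Omega : set (rvec R d)) (EFin \o f).
Proof.
move=> adm bf; apply: measurable_bounded_integrable.
- exact: measurable_cell.
- exact: lebesgue_cell_lty.
- exact: bcont_measurable_cell.
- case: bf => _ [M fM]; exists M; split; first exact: num_real.
  move=> y My x Dx; apply: le_trans (ltW My); exact/fM/cell_sub_points.
Qed.

(** What makes partial derivatives integrate to zero over the cell: the torus
    has no boundary, and in the convex case [f] vanishes near the boundary. *)
Definition closes_up Omega (f : V -> R) :=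
  match Omega with
  | FlatTorus => descends (FlatTorus : domain R d) f
  | Sublevel h => exists2 eta, 0 < eta & forall x, - eta < h x < 0 -> f x = 0
  end.

(** In the convex case the extension of [f] by zero is continuously
    differentiable in the whole space and vanishes on the faces of a large
    cube. *)
Lemma integral_partial_eq0 Omega (f : V -> R) (k : 'I_d) :
  admissible_domain Omega -> bC1 (points Omega) f -> closes_up Omega f ->
  (\int[mu]_(x in cell Omega : set (rvec R d)) (partial k f x)%:E = 0)%E.
Proof.
case: Omega => [_ bf fper|h adm bf [eta eta0 f0]].
  have [cpf [M pM]] := bC1_partial k bf.
  apply: (@integral_partial_box_eq0 _ _ f k 0 1 M) => //.
  - by move=> x; case: bf => _ /(_ k)[+ _]; exact.
  - by move=> x; exact: cpf.
  - by move=> x; exact: pM.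
  - by move=> x _; rewrite scale0r add0r scale1r addrC fper.
have [sh ch bd] := adm; have [b b0 hb] := points_box bd.
have oD := open_points adm; rewrite /= in oD bf.
set D := [set x : V | h x < 0] in oD bf *.
pose ft (x : V) : R := if h x < 0 then f x else 0.
pose U := [set x : V | - eta < h x].
have oU : open U.
  have -> : U = h @^-1` [set t | - eta < t] by [].
  apply: open_comp => [x _|]; [exact: smooth_continuous|exact: open_gt].
have ft0 x : U x -> ft x = 0.
  by rewrite /U /ft /= => Ux; case: ifPn => // hx; apply: f0; rewrite Ux.
have nU x : U x -> \forall y \near x, U y by move=> ?; exact: open_nbhs_nbhs.
have nD x : D x -> \forall y \near x, D y by move=> ?; exact: open_nbhs_nbhs.
have DU x : ~ D x -> U x.
  move=> /negP; rewrite -leNgt => hx; rewrite /U /=.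
  by apply: lt_le_trans hx; rewrite oppr_lt0.
have dftU x : U x -> is_derive x (basis_vec k) ft 0.
  move=> Ux; apply: near_eq_is_derive (is_derive_cst (0 : R) x (basis_vec k)).
  by apply: filterS (nU x Ux) => y Uy; rewrite ft0.
have dftD x : D x -> is_derive x (basis_vec k) ft (partial k f x).
  move=> Dx; apply: near_eq_is_derive (bC1_derive k bf Dx).
  by apply: filterS (nD x Dx) => y Dy; rewrite /ft ifT.
have pftU x : U x -> partial k ft x = 0.
  by move=> Ux; case: (dftU x Ux) => _.
have pftD x : D x -> partial k ft x = partial k f x.
  by move=> Dx; case: (dftD x Dx) => _.
have [cpf [M pM]] := bC1_partial k bf.
have ftout (x : V) i : ~~ (- b < x ord0 i < b) -> ft x = 0.
  by move=> xi; apply: ft0; apply: DU => /hb/(_ i); rewrite (negbTE xi).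
have := @integral_partial_box_eq0 _ _ ft k (- b) b `|M|.
move=> /(_ (ltac:(lra))) int0.
have {int0} : (\int[mu]_(x in halfopen_box (- b) b : set (rvec R d))
    (partial k ft x)%:E = 0)%E.
  apply: int0.
  - move=> x; have [/dftD[]//|/DU/dftU[]//] := pselect (D x).
  - move=> x; have [Dx|/DU Ux] := pselect (D x).
      have : partial k f @ x --> partial k ft x by rewrite pftD//; exact: cpf.
      apply: cvg_trans; apply: (@near_eq_cvg _ _ (nbhs x)).
      by apply: filterS (nD x Dx) => y Dy; rewrite pftD.
    have : cst (0 : R) @ x --> partial k ft x.
      by rewrite pftU//; exact: cst_continuous.
    apply: cvg_trans; apply: (@near_eq_cvg _ _ (nbhs x)).
    by apply: filterS (nU x Ux) => y Uy; rewrite pftU.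
  - move=> x; have [Dx|/DU Ux] := pselect (D x).
      by rewrite pftD// (le_trans (pM x Dx))// ler_norm.
    by rewrite pftU// normr0.
  - move=> x x0.
    have lo : (- b *: basis_vec k + x) ord0 k = - b.
      by rewrite !mxE x0 !eqxx mulr1 addr0.
    have hi : (b *: basis_vec k + x) ord0 k = b.
      by rewrite !mxE x0 !eqxx mulr1 addr0.
    by rewrite (@ftout _ k) ?lo ?ltxx// (@ftout _ k)// hi ltxx andbF.
move=> <-.
rewrite [LHS]integral_mkcond [RHS]integral_mkcond; apply: eq_integral => x _.
rewrite !patchE; have [hx|hx] := pselect (D x).
  rewrite mem_set// mem_set ?pftD// => i.
  by have /andP[/ltW -> ->] := hb x hx i.
by rewrite memNset// pftU ?if_same//; exact: DU.
Qed.

Lemma integral_divergence_eq0 Omega (Z : 'I_d -> V -> R) :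
  admissible_domain Omega -> (forall k, bC1 (points Omega) (Z k)) ->
  (forall k, closes_up Omega (Z k)) ->
  (\int[mu]_(x in cell Omega : set (rvec R d))
     (\sum_k partial k (Z k) x)%:E = 0)%E.
Proof.
move=> adm bZ cZ.
under eq_integral do rewrite -sumEFin.
rewrite integral_sum.
- by rewrite big1// => k _; exact: integral_partial_eq0.
- exact: measurable_cell.
- by move=> k; apply: bcont_integrable => //; exact: bC1_partial.
Qed.

End cells.

(** * The entropy rate at a fixed time *)

Section limits.
Context {R : realType}.

Lemma bounded_mul_cvg0 (T : Type) (F : set_system T) (f g : T -> R) (M : R) :
  Filter F -> (\forall x \near F, `|f x| <= M) -> g @ F --> (0 : R) ->
  (fun x => f x * g x) @ F --> (0 : R).
Proof.
move=> FF fM g0; apply/cvgrPdist_lt => e e0.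
have M1 : 0 < `|M| + 1 by rewrite ltr_wpDl.
have := g0 => /cvgrPdist_lt/(_ _ (divr_gt0 e0 M1)) gsmall.
near=> x; rewrite sub0r normrN normrM.
apply: (@le_lt_trans _ _ ((`|M| + 1) * `|g x|)).
  rewrite ler_wpM2r// (@le_trans _ _ M)//; first by near: x.
  by rewrite ler_wpDr// ler_norm.
rewrite mulrC -ltr_pdivlMr// -normrN -sub0r.
by near: x.
Unshelve. all: by end_near. Qed.

Lemma ae_le_integral d (T : measurableType d) (m : {measure set T -> \bar R})
    (D : set T) (f g : T -> \bar R) : measurable D ->
  m.-integrable D f -> m.-integrable D g ->
  {ae m, forall x, D x -> (f x <= g x)%E} ->
  (\int[m]_(x in D) f x <= \int[m]_(x in D) g x)%E.
Proof.
move=> mD intf intg [N [mN N0 subN]].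
rewrite (negligible_integral mN mD intf N0) (negligible_integral mN mD intg N0).
have mDN : measurable (D `\` N) by exact: measurableD.
apply: le_integral => //.
- by apply: integrableS intf => // x [].
- by apply: integrableS intg => // x [].
- move=> x; rewrite inE => -[Dx Nx]; apply: contrapT => H.
  by apply: Nx; apply: subN => /(_ Dx).
Qed.

End limits.

Section boundary.
Context {R : realType} {d : nat}.

(** The divergence of [phi W + a g J], where [grad phi = - a hg],
    [grad a = - b hg], [J = q u] and [A] is the Hessian matrix of the density.
    The term of [- a hg . W] that contains [J . A hg] has neither a sign nor a
    decay at the boundary; the derivative of [g] in the corrector [a g J]
    cancels it, leaves the Hessian [hh] of [h] evaluated at [u], and otherwise
    produces terms with a factor [g]. *)
Lemma cutoff_divergence_algebra (phi a b q m g dv : R) (u hg Hs : 'I_d -> R)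
    (dW : 'I_d -> R) (A hh : 'I_d -> 'I_d -> R) :
  g = \sum_k hg k * u k -> dv = \sum_k Hs k ->
  \sum_k (phi * dW k + (u k * q * m + \sum_j u j * q * A j k) * - (a * hg k)
    + (a * g * Hs k + u k * q * (a * (\sum_j (hg j * A k j + u j * hh k j))
       + g * - (b * hg k)))) =
  phi * (\sum_k dW k) - a * g * (m * q - dv)
    + a * q * (\sum_k u k * \sum_j u j * hh k j) - b * q * g ^+ 2.
Proof.
move=> gE dvE.
pose S1 k := \sum_j u j * q * A j k; pose S2 k := \sum_j hg j * A k j.
pose S3 k := \sum_j u j * hh k j.
have cross : \sum_k a * (S1 k * hg k) = \sum_k a * (u k * q * S2 k).
  under eq_bigr do rewrite /S1 mulr_suml mulr_sumr.
  under [RHS]eq_bigr do rewrite /S2 !mulr_sumr.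
  rewrite exchange_big /=; apply: eq_bigr => j _; apply: eq_bigr => k _; ring.
transitivity (\sum_k (phi * dW k - (a * m * q) * (hg k * u k) - a * (S1 k * hg k)
  + a * g * Hs k + (a * (u k * q * S2 k) + a * q * (u k * S3 k))
  - (g * b * q) * (hg k * u k))).
  apply: eq_bigr => k _; rewrite big_split /= -/(S1 k) -/(S2 k) -/(S3 k); ring.
rewrite !big_split /= !sumrN cross -!mulr_sumr -gE -dvE.
rewrite /S3; ring.
Qed.

End boundary.

Section periodic.
Context {R : realType} {d : nat}.
Local Notation V := 'rV[R]_d.

Lemma partial_val (f : V -> R) (k : 'I_d) x (df : R) :
  is_derive x (basis_vec k) f df -> partial k f x = df.
Proof. by case. Qed.

Lemma descends_partial Omega (f : V -> R) (k : 'I_d) :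
  descends Omega f -> descends Omega (partial k f).
Proof.
case: Omega => // fper x i; rewrite /partial /derive.
rewrite (_ : (fun h => _) = (fun h : R => h^-1 *: ((f \o shift x) (h *: basis_vec k) - f x)))//.
by apply/funext => h; rewrite /= addrA !fper.
Qed.

End periodic.

Section fixed_time.
Context {R : realType} {d : nat}.
Local Notation V := 'rV[R]_d.
Local Notation mu := (lebesgue_rvec d).
Local Opaque partial.
Variables (Omega : domain R d) (eps K c : R) (r rt : V -> R).
Hypotheses (adm : admissible_domain Omega) (eps0 : 0 < eps).
Let D := points Omega.
Hypotheses (br : bC1 D r) (bu : forall i, bC1 D (partial i r)).
Hypotheses (bA : forall k i, bC1 D (partial k (partial i r))) (brt : bC1 D rt).
Hypotheses (rper : descends Omega r) (rtper : descends Omega rt).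
Hypothesis neumann : zero_normal_component Omega (grad r).
Hypothesis dissipation : {ae mu, forall x, D x ->
  \sum_k gradH eps r k x * partial k rt x <=
  \sum_k partial k (flux eps r rt K k) x + c / eps * r x ^+ 2}.

Let oD : open D := open_points adm.

Let P x := \sum_k gradH eps r k x * partial k rt x - c / eps * r x ^+ 2.

Lemma bcont_entropy_rate : bcont D P.
Proof.
apply: bcontD; last first.
  apply: bcontN; apply: bcontM; first exact: bcont_cst.
  by under eq_fun do rewrite expr2; apply: bcontM; exact: bC1_bcont br.
apply: (bcont_sum _ (F := fun k x => gradH eps r k x * partial k rt x)) => k.
by apply: bcontM; [exact: bC1_bcont (bC1_gradH oD eps0 bu bA k)|exact: bC1_partial].
Qed.

Lemma descends_flux k : descends Omega (flux eps r rt K k).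
Proof.
have pu i := descends_partial i rper.
have pA j i := descends_partial j (pu i).
move: rper rtper pu pA.
case: (Omega) => [rp rtp pu pA x i|h _ _ _ _]; last exact: I.
have iE : invH eps r (x + basis_vec i) = invH eps r x.
  rewrite /invH; congr (Num.sqrt (_ + _))^-1.
  by apply: eq_bigr => l _; rewrite pu.
have gE l : gradH eps r l (x + basis_vec i) = gradH eps r l x.
  by rewrite /gradH iE pu.
have lE : laplacian r (x + basis_vec i) = laplacian r x.
  by rewrite !laplacianE; apply: eq_bigr => l _; exact: pA.
have sE : \sum_j gradH eps r j (x + basis_vec i) *
      partial j (partial k r) (x + basis_vec i) =
    \sum_j gradH eps r j x * partial j (partial k r) x.
  by apply: eq_bigr => j _; rewrite gE (pA j k x i).
rewrite /flux gE lE (rp x i) (rtp x i).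
exact: (congr1 (fun z => gradH eps r k x * (rt x - laplacian r x + K * r x) + z) sE).
Qed.

Lemma torus_entropy_rate : Omega = FlatTorus ->
  (\int[mu]_(x in cell Omega : set (rvec R d)) (P x)%:E <= 0)%E.
Proof.
move=> OT.
have bF k := bC1_flux oD eps0 br bu bA brt K k.
rewrite -(integral_divergence_eq0 adm bF); last first.
  by move=> k; have := descends_flux k; rewrite OT.
apply: ae_le_integral.
- exact: measurable_cell.
- exact: bcont_integrable bcont_entropy_rate.
- apply: bcont_integrable => //.
  apply: (bcont_sum _ (F := fun k x => partial k (flux eps r rt K k) x)) => k.
  exact: bC1_partial (bF k).
- have [N [mN N0 sub]] := dissipation; exists N; split => // x /= H.
  apply: sub => /= dis; apply: H => /cell_sub_points/dis.
  by rewrite lee_fin /P lerBlDr.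
Qed.

Section cutoff_domain.
Variable h : V -> R.
Hypothesis Oh : Omega = Sublevel h.

Let Dh x : D x = (h x < 0) :> Prop. Proof. by rewrite /D Oh. Qed.

Let sh : smooth h. Proof. by move: adm; rewrite Oh => -[]. Qed.
Let chx : convex_function [set: V] h. Proof. by move: adm; rewrite Oh => -[]. Qed.
Let bdD : bounded_set D. Proof. by move: adm; rewrite /D Oh => -[]. Qed.

Lemma smooth_bcont (f : V -> R) : continuous f -> bcont D f.
Proof.
move=> cf; split=> [x _|]; first exact: cf.
have cD : compact (closure D) by exact: compact_closure_bounded.
have [N [_ fN]] : bounded_set (f @` closure D).
  by apply: compact_bounded; apply: continuous_compact => //; exact: continuous_subspaceT.
exists (N + 1) => x Dx; apply: (fN (N + 1)); first by rewrite ltrDl.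
by exists x => //; exact: subset_closure.
Qed.

Lemma smooth_bC1 (s : seq 'I_d) : bC1 D (partials s h).
Proof.
split; first exact: smooth_bcont (sh s).1.
move=> i; split=> [x _|]; first exact: (sh s).2.
exact: smooth_bcont (sh (i :: s)).1.
Qed.

Let normal_flux x := \sum_k partial k h x * partial k r x.

Lemma bC1_normal_flux : bC1 D normal_flux.
Proof.
apply: (bC1_sum oD _ (F := fun k x => partial k h x * partial k r x)) => k.
by apply: bC1M; [exact: oD|exact: (smooth_bC1 [:: k])|exact: bu].
Qed.

(** The Neumann condition freezes the normal at the boundary point [y]; letting
    it vary costs a bounded factor times the oscillation of [grad h]. *)
Lemma normal_flux_boundary y : boundary D y ->
  normal_flux x @[x --> within D (nbhs y)] --> (0 : R).
Proof.
move=> By.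
have nf0 : dotp (grad r x) (grad h y) @[x --> within D (nbhs y)] --> (0 : R).
  have := neumann; rewrite /zero_normal_component Oh => /(_ y).
  rewrite -Oh => /(_ By); rewrite /outward_normal.
  have dotZ z (t : R) : dotp z (t *: grad h y) = t * dotp z (grad h y).
    by rewrite /dotp mulr_sumr; apply: eq_bigr => k _; rewrite mxE; ring.
  under eq_fun do rewrite dotZ.
  have [n0 _|n0] := eqVneq (enorm (grad h y)) 0.
    have gz : grad h y = 0.
      apply/rowP => k; rewrite [RHS]mxE; apply/eqP; rewrite -sqrf_eq0.
      move/eqP: n0; rewrite /enorm sqrtr_eq0 /dotp => le0.
      rewrite eq_le sqr_ge0 andbT (le_trans _ le0)//.
      rewrite (bigD1 k)//= -expr2 lerDl; apply: sumr_ge0 => i _.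
      by rewrite -expr2; exact: sqr_ge0.
    have d0 z : dotp z (grad h y) = 0.
      by rewrite gz /dotp big1// => k _; rewrite mxE mulr0.
    by under eq_fun do rewrite d0; exact: cvg_cst.
  move=> /(@cvgMl_tmp _ _ _ _ _ (enorm (grad h y))); rewrite mulr0.
  by under eq_fun do rewrite mulrA mulfV// mul1r.
have nf1 : (\sum_k partial k r x * (partial k h x - partial k h y))
    @[x --> within D (nbhs y)] --> (0 : R).
  rewrite [X in _ --> X](_ : _ = \sum_(k < d) (0 : R)); last by rewrite big1.
  apply: cvg_big => [|k _]; first exact: add_continuous.
  have [M pM] := (bC1_bcont (bu k)).2.
  apply: (@bounded_mul_cvg0 _ _ _ _ _ M).
    by rewrite near_withinE; apply: (@nearW _ (nbhs y)) => x Dx; exact: pM.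
  rewrite -[X in _ --> X](subrr (partial k h y)).
  apply: cvgB; last exact: cvg_cst.
  apply: cvg_within_filter; exact: (sh [:: k]).1.
have -> : normal_flux = fun x => dotp (grad r x) (grad h y) +
    \sum_k partial k r x * (partial k h x - partial k h y).
  apply/funext => x; rewrite /dotp -big_split /=; apply: eq_bigr => k _.
  rewrite !mxE; ring.
by rewrite -[X in _ --> X]addr0; exact: cvgD nf0 nf1.
Qed.

Let m x := rt x - laplacian r x + K * r x.
Let q := invH eps r.
Let dv x := \sum_k hessHr eps r k k x.
(** The fluxes [Z n] are cut off in a layer of width of order [1 / n] in the
    values of [h], and [err n] collects the terms of their divergence that live
    in this layer and have no sign. *)
Let sig (n : nat) x := - h x * n.+1%:R.
Let phi n x := cutoff (sig n x).
Let a n x := cutoff' (sig n x) * n.+1%:R.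
Let b n x := cutoff'' (sig n x) * n.+1%:R ^+ 2.
Let Z n k x := phi n x * flux eps r rt K k x
  + a n x * normal_flux x * gradH eps r k x.
Let err n x := a n x * normal_flux x * (m x * q x - dv x)
  + b n x * q x * normal_flux x ^+ 2.

Let bC1_h : bC1 D h := smooth_bC1 [::].

Let bC1_sig n : bC1 D (sig n).
Proof. by apply: bC1M; [exact: oD|exact: bC1N|exact: bC1_cst]. Qed.

Let continuous_cutoff : continuous (@cutoff R).
Proof.
move=> s; apply: differentiable_continuous; apply/derivable1_diffP.
by case: (is_derive_cutoff s).
Qed.

Let continuous_cutoff' : continuous (@cutoff' R).
Proof.
move=> s; apply: differentiable_continuous; apply/derivable1_diffP.
by case: (is_derive_cutoff' s).
Qed.

Let bC1_phi n : bC1 D (phi n).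
Proof.
apply: (bC1_comp oD (dp := @cutoff' R) (bC1_sig n)).
- by move=> x _; exact: is_derive_cutoff.
- exact: bcont_comp continuous_cutoff (bC1_bcont (bC1_sig n)).
- exact: bcont_comp continuous_cutoff' (bC1_bcont (bC1_sig n)).
Qed.

Let bC1_a n : bC1 D (a n).
Proof.
apply: bC1M; [exact: oD| |exact: bC1_cst].
apply: (bC1_comp oD (dp := @cutoff'' R) (bC1_sig n)).
- by move=> x _; exact: is_derive_cutoff'.
- exact: bcont_comp continuous_cutoff' (bC1_bcont (bC1_sig n)).
- exact: bcont_comp (@continuous_cutoff'' R) (bC1_bcont (bC1_sig n)).
Qed.

Let bC1_Z n k : bC1 D (Z n k).
Proof.
apply: bC1D; first exact: oD.
  by apply: bC1M; [exact: oD|exact: bC1_phi|exact: bC1_flux].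
apply: bC1M; [exact: oD| |exact: bC1_gradH].
by apply: bC1M; [exact: oD|exact: bC1_a|exact: bC1_normal_flux].
Qed.

Let is_derive_sig n k x : D x ->
  is_derive x (basis_vec k) (sig n) (- (partial k h x * n.+1%:R)).
Proof.
move=> Dx.
have := is_derive_prod (is_deriveN (bC1_derive k bC1_h Dx))
  (is_derive_cst (n.+1%:R : R) x (basis_vec k)).
by move=> df; apply: (is_derive_eq df); rewrite /cst; ring.
Qed.

Let divergence_Z n x : D x -> \sum_k partial k (Z n k) x =
  phi n x * (\sum_k partial k (flux eps r rt K k) x)
  - a n x * normal_flux x * (m x * q x - dv x)
  + a n x * q x * (\sum_k partial k r x *
      \sum_j partial j r x * partial k (partial j h) x)
  - b n x * q x * normal_flux x ^+ 2.
Proof.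
move=> Dx.
rewrite -(@cutoff_divergence_algebra R d _ _ _ _ _ _ _ (fun k => partial k r x)
  (fun k => partial k h x) (fun k => hessHr eps r k k x)
  (fun k => partial k (flux eps r rt K k) x)
  (fun k j => partial k (partial j r) x)) //.
apply: eq_bigr => k _.
have dphi : is_derive x (basis_vec k) (phi n) (- (a n x * partial k h x)).
  have := is_derive_comp_scalar (is_derive_cutoff (sig n x)) (is_derive_sig n k Dx).
  by move=> df; apply: (is_derive_eq df); rewrite /a; ring.
have da : is_derive x (basis_vec k) (a n) (- (b n x * partial k h x)).
  have := is_derive_prod
    (is_derive_comp_scalar (is_derive_cutoff' (sig n x)) (is_derive_sig n k Dx))
    (is_derive_cst (n.+1%:R : R) x (basis_vec k)).
  by move=> df; apply: (is_derive_eq df); rewrite /b /cst; ring.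
have dg : is_derive x (basis_vec k) normal_flux
    (\sum_j (partial j h x * partial k (partial j r) x
      + partial j r x * partial k (partial j h) x)).
  apply: (is_derive_sums _ (F := fun j y => partial j h y * partial j r y)
    (dF := fun j => partial j h x * partial k (partial j r) x
      + partial j r x * partial k (partial j h) x)) => j.
  exact: is_derive_prod (bC1_derive k (smooth_bC1 [:: j]) Dx) (bC1_derive k (bu j) Dx).
have dZ := is_derive_add
  (is_derive_prod dphi (bC1_derive k (bC1_flux oD eps0 br bu bA brt K k) Dx))
  (is_derive_prod (is_derive_prod da dg) (is_derive_gradH eps0 bu k k Dx)).
exact: partial_val dZ.
Qed.

Let hessian_ge0 x : 0 <= \sum_k partial k r x *
  \sum_j partial j r x * partial k (partial j h) x.
Proof.
apply: (le_trans (convex_hessian_ge0 chx x (grad r x) sh)).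
rewrite le_eqVlt; apply/orP; left; apply/eqP.
transitivity (\sum_i \sum_j partial i r x * (partial j r x * partial j (partial i h) x)).
  by apply: eq_bigr => i _; rewrite mulr_sumr; apply: eq_bigr => j _; rewrite !mxE.
rewrite exchange_big /=; apply: eq_bigr => k _; rewrite mulr_sumr.
by apply: eq_bigr => j _; rewrite mulrCA.
Qed.

Let a_ge0 n x : 0 <= a n x.
Proof. by rewrite mulr_ge0//; have [] := cutoff_bounds (sig n x). Qed.

Let cutoff_rate_le n : {ae mu, forall x, cell Omega x ->
  phi n x * P x - err n x <= \sum_k partial k (Z n k) x}.
Proof.
have [N [mN N0 sub]] := dissipation; exists N; split => // x /= H.
apply: sub => /= dis; apply: H => /cell_sub_points Dx.
rewrite divergence_Z// /err.
have := mulr_ge0 (mulr_ge0 (a_ge0 n x) (invH_ge0 eps r x)) (hessian_ge0 x).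
have p0 : 0 <= phi n x by have [/andP[]] := cutoff_bounds (sig n x).
have : phi n x * P x <= phi n x * (\sum_k partial k (flux eps r rt K k) x).
  by rewrite ler_wpM2l// /P lerBlDr dis.
rewrite -/q; lra.
Qed.

Let bcont_rate n : bcont D (fun x => phi n x * P x - err n x).
Proof.
have bg := bC1_bcont bC1_normal_flux.
have bq : bcont D q by exact: bcont_invH.
apply: bcontD; first by apply: bcontM; [exact: bC1_bcont|exact: bcont_entropy_rate].
apply: bcontN; apply: bcontD.
  apply: bcontM; first by apply: bcontM => //; exact: bC1_bcont.
  apply: bcontD.
    apply: bcontM => //; apply: bcontD.
      apply: bcontD; first exact: bC1_bcont.
      by apply: bcontN; apply: bC1_bcont; exact: bC1_laplacian.
    by apply: bcontM; [exact: bcont_cst|exact: bC1_bcont].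
  apply: bcontN; apply: (bcont_sum _ (F := fun k x => hessHr eps r k k x)) => k.
  exact: bcont_hessHr.
apply: bcontM; last by under eq_fun do rewrite expr2; exact: bcontM.
apply: bcontM => //; apply: bcontM; last exact: bcont_cst.
exact: bcont_comp (@continuous_cutoff'' R) (bC1_bcont (bC1_sig n)).
Qed.

(** In the layer, [a n] is at most of order [1 / (- h)] and [b n] of order
    [1 / h ^ 2]; the decay of [normal_flux] compensates for both. *)
Let rate_bounded : exists B, forall n x, D x ->
  `|phi n x * P x - err n x| <= B.
Proof.
have [M1 PM] := bcont_entropy_rate.2.
have oDh : open [set x | h x < 0] by have := oD; rewrite /D Oh.
have bgh : bC1 [set x | h x < 0] normal_flux.
  by have := bC1_normal_flux; rewrite /D Oh.
have bdh : bounded_set [set x : V | h x < 0] by have := bdD; rewrite /D Oh.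
have nfh y : boundary [set x | h x < 0] y ->
    normal_flux x @[x --> within [set x | h x < 0] (nbhs y)] --> (0 : R).
  by have := @normal_flux_boundary y; rewrite /D Oh.
have [C C0 gC] := boundary_decay oDh chx bdh bgh nfh.
have [M2 mM] : exists M, forall x, D x -> `|m x * q x - dv x| <= M.
  suff : bcont D (fun x => m x * q x - dv x) by case.
  apply: bcontD.
    apply: bcontM; last exact: bcont_invH.
    apply: bcontD; last by apply: bcontM; [exact: bcont_cst|exact: bC1_bcont].
    apply: bcontD; first exact: bC1_bcont.
    by apply: bcontN; apply: bC1_bcont; exact: bC1_laplacian.
  apply: bcontN; apply: (bcont_sum _ (F := fun k x => hessHr eps r k k x)) => k.
  exact: bcont_hessHr.
exists (M1 + (4 * C * M2 + 16 * C ^+ 2 * eps^-1)) => n x Dx.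
have hx : 0 < - h x by have := Dx; rewrite Dh oppr_gt0.
have gx : `|normal_flux x| <= C * (- h x) by apply: gC; have := Dx; rewrite Dh.
have s0 : 0 <= sig n x by rewrite mulr_ge0// ltW.
have [/andP[p0 p1] c'0 c'4 c''16] := cutoff_bounds (sig n x).
have M20 : 0 <= M2 by exact: le_trans (mM x Dx).
rewrite (le_trans (ler_normB _ _))// lerD//.
  rewrite normrM -[leRHS]mul1r ler_pM//; last exact: PM.
  by rewrite ger0_norm.
rewrite (le_trans (ler_normD _ _))// lerD//.
  rewrite normrM ler_pM//; last exact: mM.
  rewrite normrM (ger0_norm (a_ge0 n x)).
  apply: (@le_trans _ _ (a n x * (C * (- h x)))); first by rewrite ler_wpM2l.
  rewrite (_ : a n x * (C * - h x) = (sig n x * cutoff' (sig n x)) * C);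
    last by rewrite /a /sig; ring.
  by rewrite ler_wpM2r// (le_trans (ler_norm _)).
rewrite mulrAC normrM ler_pM//; last first.
  by rewrite ger0_norm ?invH_ge0// invH_le.
rewrite normrM normrX.
apply: (@le_trans _ _ (`|b n x| * (C * (- h x)) ^+ 2)).
  by rewrite ler_wpM2l// lerXn2r// nnegrE// mulr_ge0// ltW.
rewrite (_ : `|b n x| * (C * - h x) ^+ 2 =
   `|sig n x ^+ 2 * cutoff'' (sig n x)| * C ^+ 2); first by rewrite ler_wpM2r// sqr_ge0.
rewrite /b normrM [in RHS]normrM (ger0_norm (sqr_ge0 (sig n x))).
by rewrite (ger0_norm (sqr_ge0 _)) /sig; ring.
Qed.

Let rate_cvg x : D x ->
  (fun n => phi n x * P x - err n x) @ \oo --> P x.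
Proof.
move=> Dx; have hx : 0 < - h x by have := Dx; rewrite Dh oppr_gt0.
apply: cvg_near_cst; near=> n.
have s4 : 4 <= sig n x.
  rewrite /sig -ler_pdivrMl// mulrC; apply: ltW.
  apply: (@lt_le_trans _ _ (Num.truncn (4 / - h x)).+1%:R).
    exact: truncnS_gt.
  rewrite ler_nat ltnS; near: n; exact: nbhs_infty_ge.
have [c1 c'0 c''0] := cutoff_ge4 s4.
by rewrite /err /phi /a /b c1 c'0 c''0; ring.
Unshelve. all: by end_near. Qed.

(** At a given point the cutoff is [1] and [err n] is [0] as soon as [n] is
    large, so dominated convergence applies. *)
Lemma sublevel_entropy_rate :
  (\int[mu]_(x in cell Omega : set (rvec R d)) (P x)%:E <= 0)%E.
Proof.
have [B rB] := rate_bounded.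
have mC := measurable_cell adm.
have [|||||_ _ lim] := @dominated_convergence _ _ _ mu _ mC
  (fun n x => (phi n x * P x - err n x)%:E) (EFin \o P) (fun=> B%:E).
- by move=> n; apply/measurable_EFinP; exact: bcont_measurable_cell.
- by apply/measurable_EFinP; apply: bcont_measurable_cell => //; exact: bcont_entropy_rate.
- apply: aeW => x /cell_sub_points Dx; apply: cvg_EFin.
    by apply: nearW => n.
  exact: rate_cvg.
- exact: (bcont_integrable adm (bcont_cst _ B)).
- by apply: aeW => x n /cell_sub_points Dx; rewrite /= lee_fin rB.
apply: (cvge_to_le lim); apply: nearW => n /=.
rewrite -(@integral_divergence_eq0 _ _ Omega (Z n) adm (bC1_Z n)).
  apply: ae_le_integral => //.
  - exact: bcont_integrable.
  - apply: bcont_integrable => //.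
    apply: (bcont_sum _ (F := fun k x => partial k (Z n k) x)) => k.
    exact: bC1_partial.
  - exact: cutoff_rate_le.
move=> k; rewrite /closes_up Oh; exists n.+1%:R^-1 => [|x /andP[hx hx0]].
  by rewrite invr_gt0.
have s1 : sig n x <= 1.
  by rewrite /sig -ler_pdivlMr// mul1r lerNl ltW.
have [c0 c'0 _] := cutoff_le1 s1.
by rewrite /Z /phi /a c0 c'0; ring.
Qed.

End cutoff_domain.

Lemma entropy_rate_le0 :
  (\int[mu]_(x in cell Omega : set (rvec R d)) (P x)%:E <= 0)%E.
Proof.
case E : Omega => [|h]; rewrite -E; first exact: torus_entropy_rate.
exact: (sublevel_entropy_rate E).
Qed.

End fixed_time.

(** * Functions continuous up to the boundary *)

Section periodicity.
Context {R : realType} {d : nat}.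
Local Notation V := 'rV[R]_d.

Lemma descends_lattice (f : V -> R) (n : 'I_d -> int) (x : V) :
  descends (FlatTorus : domain R d) f ->
  f (x + \sum_i (n i)%:~R *: basis_vec i) = f x.
Proof.
move=> fper.
have shift_nat (m : nat) i y : f (y + m%:R *: basis_vec i) = f y.
  elim: m y => [|m IHm] y; first by rewrite scale0r addr0.
  by rewrite -natr1 scalerDl scale1r addrA fper IHm.
have shift_int (m : int) i y : f (y + m%:~R *: basis_vec i) = f y.
  case: m => m; first exact: shift_nat.
  by rewrite NegzE mulrNz scaleNr -(shift_nat m.+1 i (y - _)) subrK.
elim: (index_enum _) x => [|i s IHs] x; first by rewrite big_nil addr0.
by rewrite big_cons addrA IHs shift_int.
Qed.

Lemma lattice_representative (x : V) : exists n : 'I_d -> int,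
  cell (FlatTorus : domain R d) (x + \sum_i (n i)%:~R *: basis_vec i).
Proof.
exists (fun i => - Num.floor (x ord0 i)) => j.
rewrite mxE summxE (bigD1 j)//= big1 => [|i ij].
  rewrite !mxE !eqxx mulr1 addr0 mulrNz.
  rewrite subr_ge0 ge_floor /= ltrBlDl.
  have := lt_succ_floor (x ord0 j).
  by rewrite intrD.
by rewrite !mxE eq_sym (negbTE ij) andbF mulr0.
Qed.

End periodicity.

Section up_to_boundary.
Context {R : realType} {d : nat}.
Local Notation V := 'rV[R]_d.
Implicit Types (Omega : domain R d) (I : set R) (g : R -> V -> R).

Lemma continuous_up_to_within I (D : set V) g t x :
  continuous_up_to I D g -> I t -> D x ->
  g p.1 p.2 @[p --> within (I `*` D) (nbhs (t, x))] --> g t x.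
Proof.
move=> [G [/subspace_continuousP cG gG]] It Dx.
have := cG (t, x) (conj It (subset_closure Dx)); rewrite gG// => cGx.
move=> P /cGx; rewrite /nbhs /= /within /=; apply: filterS => -[tau y] /= GP [Itau Dy].
by rewrite gG//; apply: GP; split => //; exact: subset_closure.
Qed.

Lemma continuous_up_to_space I (D : set V) g t x : open D ->
  continuous_up_to I D g -> I t -> D x -> {for x, continuous (g t)}.
Proof.
move=> oD cg It Dx P gP.
have := continuous_up_to_within cg It Dx gP.
rewrite /nbhs /= /within /= => -[[A B] /= [nA nB] ABP].
have nD : \forall y \near x, D y by exact: open_nbhs_nbhs.
apply: filterS (filterI nB nD) => y [By Dy].
apply: (ABP (t, y)) => //; split => //=; exact: nbhs_singleton.
Qed.

Lemma continuous_up_to_time I (D : set V) g t x : 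
  continuous_up_to I D g -> I t -> D x ->
  g tau x @[tau --> within I (nbhs t)] --> g t x.
Proof.
move=> cg It Dx P gP.
have := continuous_up_to_within cg It Dx gP.
rewrite /nbhs /= /within /= => -[[A B] /= [nA nB] ABP].
apply: filterS nA => tau Atau Itau.
apply: (ABP (tau, x)) => //; split => //=; exact: nbhs_singleton.
Qed.

Lemma continuous_up_to_joint I (D : set V) g t x : open D -> open I ->
  continuous_up_to I D g -> I t -> D x ->
  {for (t, x), continuous (fun p : R * V => g p.1 p.2)}.
Proof.
move=> oD oI cg It Dx P gP.
have := continuous_up_to_within cg It Dx gP.
rewrite /nbhs /= /within /= => -[[A B] /= [nA nB] ABP].
exists (A `&` I, B `&` D) => /=.
  by split; apply: filterI => //; exact: open_nbhs_nbhs.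
by move=> [tau y] /= [[Atau Itau] [By Dy]]; exact: (ABP (tau, y)).
Qed.

(** The values are all taken on a compact set: the closed unit cube for the
    torus, the closure of the domain in the convex case. *)
Lemma continuous_up_to_bounded Omega I g (a b : R) :
  admissible_domain Omega -> `[a, b]%classic `<=` I ->
  continuous_up_to I (points Omega) g ->
  (forall t, a <= t <= b -> descends Omega (g t)) ->
  exists M, forall t x, a <= t <= b -> points Omega x -> `|g t x| <= M.
Proof.
move=> adm abI [G [cG gG]] gper.
suff [K [cK KD Kg]] : exists K : set V, [/\ compact K, K `<=` closure (points Omega) &
    forall x, points Omega x -> exists y, [/\ K y, points Omega y &
      forall t, a <= t <= b -> g t x = g t y]].
  have cabK : compact (`[a, b]%classic `*` K : set (R * V)).
    by apply: compact_setX => //; exact: segment_compact.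
  have cGK : {within `[a, b]%classic `*` K, continuous G}.
    by apply: continuous_subspaceW cG => -[t x] /= [/abI It /KD Kx].
  have [N [_ GN]] : bounded_set (G @` (`[a, b]%classic `*` K)).
    by apply: compact_bounded; exact: continuous_compact.
  exists (N + 1) => t x tab /Kg[y [Ky Dy ->//]].
  have tI : `[a, b]%classic t by rewrite /= in_itv.
  rewrite gG//; last exact: abI.
  by apply: (GN (N + 1)); [rewrite ltrDl|exists (t, y)].
case: Omega adm cG gG gper => [_ _ _ gper|h [_ _ bd] _ _ _].
  exists [set x : V | forall i, `[0, 1]%classic (x ord0 i)]; split.
  - exact: (@rV_compact _ _ (fun=> `[(0 : R), 1]%classic) (fun=> @segment_compact _ 0 1)).
  - by move=> x _; exact: subset_closure.
  - move=> x _; have [n xn] := lattice_representative x.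
    exists (x + \sum_i (n i)%:~R *: basis_vec i); split => //.
      by move=> i; have /andP[x0 x1] := xn i; rewrite /= in_itv/= x0 ltW.
    by move=> t tab; rewrite descends_lattice//; exact: gper.
exists (closure [set x | h x < 0]); split => //.
  exact: compact_closure_bounded.
by move=> x Dx; exists x; split => //; exact: subset_closure.
Qed.

Lemma continuous_up_to_bcont Omega I g t : admissible_domain Omega -> I t ->
  continuous_up_to I (points Omega) g -> descends Omega (g t) ->
  bcont (points Omega) (g t).
Proof.
move=> adm It cg gper; split=> [x Dx|].
  exact: continuous_up_to_space (open_points adm) cg It Dx.
have [|s /andP[ts st]|M gM] := @continuous_up_to_bounded Omega I g t t adm _ cg.
- by move=> s; rewrite /= in_itv/= -eq_le => /eqP <-.
- by rewrite (_ : s = t)//; apply/eqP; rewrite eq_le st.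
by exists M => x Dx; apply: gM => //; rewrite lexx.
Qed.

End up_to_boundary.

(** * The entropy rate of a solution *)

Section solution.
Context {R : realType} {d : nat}.
Local Notation V := 'rV[R]_d.
Local Notation mu := (lebesgue_rvec d).
Local Opaque partial.
Variables (Omega : domain R d) (T : R) (v : R -> V -> V) (rho : R -> V -> R).
Hypotheses (adm : admissible_domain Omega) (sol : FokkerPlanck_solution Omega T v rho).
Let D := points Omega.
Let oD : open D := open_points adm.
Let reg := sol_smooth sol.

Definition drho (t : R) (x : V) : R := derive1 (rho ^~ x) t.
Definition dgrad (i : 'I_d) (t : R) (x : V) : R :=
  derive1 (fun tau => partial i (rho tau) x) t.

Lemma in_ooP (t : R) : (`]0, T[%classic t) = (0 < t < T) :> Prop.
Proof. by rewrite /= in_itv. Qed.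

Lemma in_ccP (t : R) : (`[0, T]%classic t) = (0 <= t <= T) :> Prop.
Proof. by rewrite /= in_itv. Qed.

Lemma oo_cc (t : R) : 0 < t < T -> 0 <= t <= T.
Proof. by move=> /andP[t0 tT]; rewrite !ltW. Qed.

Lemma descends_partials s (t : R) : 0 <= t <= T -> descends Omega (partials s (rho t)).
Proof.
move=> tT; elim: s => [|i s IHs] /=; first exact: sol_descends sol t tT.
exact: descends_partial.
Qed.

Lemma near_oo (t : R) : 0 < t < T -> \forall tau \near t, 0 < tau < T.
Proof.
move=> t0T.
have oI : open_nbhs t `]0, T[%classic.
  by split; [exact: interval_open|rewrite in_ooP].
by apply: filterS (open_nbhs_nbhs oI) => tau; rewrite in_ooP.
Qed.

Lemma descends_time_derivative (g : R -> V -> R) (t : R) :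
  (forall tau, 0 <= tau <= T -> descends Omega (g tau)) -> 0 < t < T ->
  descends Omega (fun x => derive1 (g ^~ x) t).
Proof.
move=> gper t0T; case: (Omega) gper => // gper x i.
rewrite !derive1E; apply: near_eq_derive.
by apply: filterS (near_oo t0T) => tau /oo_cc/gper; exact.
Qed.

Lemma bC1_space s (t : R) : (size s < 3)%N -> 0 < t < T ->
  bC1 D (partials s (rho t)).
Proof.
move=> s3 t0T; have It : `]0, T[%classic t by rewrite in_ooP.
have bs s' : (size s' <= 3)%N -> bcont D (partials s' (rho t)).
  move=> s'3; apply: (continuous_up_to_bcont adm It (smooth_continuous3 reg s'3)).
  exact: descends_partials (oo_cc t0T).
split; first exact: bs (ltnW s3).
move=> i; split=> [x Dx|]; first exact: (smooth_derivable3 reg s3 t0T Dx).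
exact: (bs (i :: s) s3).
Qed.

Lemma bcont_drho (t : R) : 0 < t < T -> bcont D (drho t).
Proof.
move=> t0T; have It : `]0, T[%classic t by rewrite in_ooP.
apply: (continuous_up_to_bcont adm It (smooth_continuous_time reg (s := [::]) isT)).
by apply: descends_time_derivative => // tau; exact: (@descends_partials [::]).
Qed.

Lemma bcont_dgrad i (t : R) : 0 < t < T -> bcont D (dgrad i t).
Proof.
move=> t0T; have It : `]0, T[%classic t by rewrite in_ooP.
apply: (continuous_up_to_bcont adm It (smooth_continuous_time reg (s := [:: i]) isT)).
by apply: descends_time_derivative => // tau; exact: (@descends_partials [:: i]).
Qed.

Lemma is_derive_drho i (t : R) (x : V) : 0 < t < T -> D x ->
  is_derive x (basis_vec i) (drho t) (dgrad i t x).
Proof.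
move=> t0T Dx; have It : `]0, T[%classic t by rewrite in_ooP.
apply: (is_derive_time_exchange (f := rho)).
  exists (`]0, T[%classic, D) => /=.
    split; last exact: open_nbhs_nbhs.
    by apply: open_nbhs_nbhs; split => //; exact: interval_open.
  move=> [tau y] /= [+ Dy]; rewrite in_itv/= => tau0T; split.
  - exact: (smooth_derivable3 reg (s := [::]) (i := i) isT tau0T Dy).
  - exact: (smooth_derivable_time reg (s := [::]) isT tau0T Dy).
  - exact: (smooth_derivable_time reg (s := [:: i]) isT tau0T Dy).
apply: (continuous_up_to_joint oD _ (smooth_continuous_time reg (s := [:: i]) isT)) => //.
Qed.

Lemma partial_drho i (t : R) (x : V) : 0 < t < T -> D x ->
  partial i (drho t) x = dgrad i t x.
Proof. by move=> t0T Dx; apply: partial_val; exact: is_derive_drho. Qed.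

Lemma bC1_drho (t : R) : 0 < t < T -> bC1 D (drho t).
Proof.
move=> t0T; apply: (bC1_intro oD (df := fun i => dgrad i t)).
- exact: bcont_drho.
- by move=> i; exact: bcont_dgrad.
- by move=> i x Dx; exact: is_derive_drho.
Qed.

Lemma divergence_bound (M L : R) (t : R) (x : V) : 0 <= L -> 0 < t < T -> D x ->
  (forall y, D y -> `|v t y| <= M) -> L.-lipschitz_D (v t) ->
  (forall i, derivable (fun y => (rho t y *: v t y) ord0 i) x (basis_vec i)) ->
  `|divergence (fun y => rho t y *: v t y) x| <=
    \sum_i (M * `|partial i (rho t) x| + L * `|rho t x|).
Proof.
move=> L0 t0T Dx vM vL dv; rewrite (le_trans (ler_norm_sum _ _ _))//.
apply: ler_sum => i _.
have E : (fun y => (rho t y *: v t y) ord0 i) = (fun y => rho t y * v t y ord0 i).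
  by apply/funext => y; rewrite mxE.
rewrite E; apply: (partial_mul_bound oD Dx L0).
- by move=> y Dy; rewrite (le_trans (coord_le_norm _ i))// vM.
- move=> y Dy; have := vL (y, x) (conj Dy Dx) => /=; apply: le_trans.
  by have := coord_le_norm (v t y - v t x) i; rewrite !mxE.
- exact: (smooth_derivable3 reg (s := [::]) (i := i) isT t0T Dx).
- by rewrite -E; exact: dv.
Qed.

Lemma integral_entropy_rate_le0 (M L K c eps : R) (t : R) : 0 <= L -> 0 < eps ->
  (forall y, D y -> `|v t y| <= M) -> L.-lipschitz_D (v t) ->
  K = d%:R ^+ 2 * M ^+ 2 -> c = d%:R ^+ 3 * L ^+ 2 + d%:R * K ^+ 2 / 2 ->
  0 < t < T ->
  {ae mu, forall x, D x ->
    (forall i, derivable (fun y => (rho t y *: v t y) ord0 i) x (basis_vec i)) /\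
    drho t x - laplacian (rho t) x + divergence (fun y => rho t y *: v t y) x = 0} ->
  (\int[mu]_(x in cell Omega : set (rvec R d))
     (\sum_k gradH eps (rho t) k x * dgrad k t x - c / eps * rho t x ^+ 2)%:E <= 0)%E.
Proof.
move=> L0 eps0 vM vL KE cE t0T eqn.
have b0 := bC1_space (s := [::]) isT t0T.
have b1 i := bC1_space (s := [:: i]) isT t0T.
have b2 k i := bC1_space (s := [:: k; i]) isT t0T.
have bt := bC1_drho t0T.
have := @entropy_rate_le0 R d Omega eps K c (rho t) (drho t) adm eps0 b0 b1 b2 bt
  (sol_descends sol (oo_cc t0T)).
have dper : descends Omega (drho t).
  by apply: descends_time_derivative => // tau; exact: (@descends_partials [::]).
move=> /(_ dper (sol_neumann sol t0T)) rate.
have {}rate : (\int[mu]_(x in cell Omega : set (rvec R d))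
   (\sum_k gradH eps (rho t) k x * partial k (drho t) x
     - c / eps * rho t x ^+ 2)%:E <= 0)%E.
  apply: rate; have [N [mN N0 sub]] := eqn; exists N; split => // x /= H.
  apply: sub => /= eq; apply: H => Dx; have [dv eqx] := eq Dx.
  apply: (gradH_rt_le_divergence oD eps0 b0 b1 b2 bt Dx eqx _ KE cE).
  exact: divergence_bound.
apply: le_trans rate; rewrite le_eqVlt; apply/orP; left; apply/eqP.
apply: eq_integral => x; rewrite inE => /cell_sub_points Dx.
have E : \sum_k gradH eps (rho t) k x * dgrad k t x =
    \sum_k gradH eps (rho t) k x * partial k (drho t) x.
  by apply: eq_bigr => k _; rewrite partial_drho.
exact: (congr1 (fun z => (z - c / eps * rho t x ^+ 2)%:E) E).
Qed.

End solution.

(** * Growth between interior times *)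

Section rectangle.
Context d1 d2 (T1 : measurableType d1) (T2 : measurableType d2) (R : realType).
Variables (m1 : {sigma_finite_measure set T1 -> \bar R})
  (m2 : {sigma_finite_measure set T2 -> \bar R}).
Variables (A1 : set T1) (A2 : set T2) (f : T1 * T2 -> R) (B : R).
Hypotheses (mA1 : measurable A1) (mA2 : measurable A2).
Hypotheses (A1oo : (m1 A1 < +oo)%E) (A2oo : (m2 A2 < +oo)%E).
Hypotheses (mf : measurable_fun (A1 `*` A2) f).
Hypothesis fB : forall p, (A1 `*` A2) p -> `|f p| <= B.

Let g := (EFin \o f) \_ (A1 `*` A2).

Let intg : (m1 \x m2)%E.-integrable setT g.
Proof.
have mA : measurable (A1 `*` A2) by exact: measurableX.
apply/(integrable_mkcond _ mA); apply: measurable_bounded_integrable => //.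
  by rewrite /= product_measure1E// lte_mul_pinfty// ge0_fin_numE.
exists B; split; first exact: num_real.
by move=> y By p Ap; apply: le_trans (fB Ap) (ltW By).
Qed.

Let g1 x : (\int[m2]_y g (x, y))%E =
  ((fun x => \int[m2]_(y in A2) (f (x, y))%:E)%E \_ A1) x.
Proof.
rewrite [RHS]patchE; case: ifPn => Ax.
  rewrite [RHS]integral_mkcond; apply: eq_integral => y _.
  rewrite /g !patchE; congr (if _ then _ else _).
  by rewrite in_setX Ax.
rewrite integral0_eq// => y _; rewrite /g patchE ifF//.
by rewrite in_setX (negbTE Ax).
Qed.

Let g2 y : (\int[m1]_x g (x, y))%E =
  ((fun y => \int[m1]_(x in A1) (f (x, y))%:E)%E \_ A2) y.
Proof.
rewrite [RHS]patchE; case: ifPn => Ay.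
  rewrite [RHS]integral_mkcond; apply: eq_integral => x _.
  rewrite /g !patchE; congr (if _ then _ else _).
  by rewrite in_setX Ay andbT.
rewrite integral0_eq// => x _; rewrite /g patchE ifF//.
by rewrite in_setX (negbTE Ay) andbF.
Qed.

Lemma integrable_rectangle :
  m1.-integrable A1 (fun x => \int[m2]_(y in A2) (f (x, y))%:E)%E.
Proof.
apply/(integrable_mkcond _ mA1).
have := integrable_fubini_F intg; rewrite /fubini_F.
by under eq_fun do rewrite g1.
Qed.

Lemma Fubini_rectangle :
  (\int[m1]_(x in A1) \int[m2]_(y in A2) (f (x, y))%:E =
   \int[m2]_(y in A2) \int[m1]_(x in A1) (f (x, y))%:E)%E.
Proof.
have := Fubini intg.
under eq_integral do rewrite g1.
under [X in _ = X -> _]eq_integral do rewrite g2.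
by rewrite -!integral_mkcond.
Qed.

End rectangle.

Section time.
Context {R : realType} {d : nat}.
Local Notation V := 'rV[R]_d.
Local Notation mu := (lebesgue_rvec d).
Local Notation lam := (@lebesgue_measure R).
Local Opaque partial.
Variables (Omega : domain R d) (T : R) (v : R -> V -> V) (rho : R -> V -> R).
Hypotheses (adm : admissible_domain Omega) (sol : FokkerPlanck_solution Omega T v rho).
Variable eps : R.
Hypothesis eps0 : 0 < eps.
Let D := points Omega.
Let oD : open D := open_points adm.
Let reg := sol_smooth sol.

Lemma H_gradE (f : V -> R) x :
  H eps (grad f x) = Num.sqrt (eps ^+ 2 + \sum_l partial l f x ^+ 2).
Proof.
rewrite /H /enorm sqr_sqrtr; last first.
  by apply: sumr_ge0 => i _; rewrite -expr2 sqr_ge0.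
by congr (Num.sqrt (_ + _)); apply: eq_bigr => i _; rewrite mxE expr2.
Qed.

Let N (t : R) (x : V) := \sum_k gradH eps (rho t) k x * dgrad rho k t x.

Let S_gt0 (f : V -> R) x : 0 < eps ^+ 2 + \sum_l partial l f x ^+ 2.
Proof.
apply: (@lt_le_trans _ _ (eps ^+ 2)); first by rewrite exprn_gt0.
by rewrite lerDl sumr_ge0// => i _; exact: sqr_ge0.
Qed.

Lemma is_derive_H_grad (t : R) x : 0 < t < T -> D x ->
  is_derive t 1 (fun tau => H eps (grad (rho tau) x)) (N t x).
Proof.
move=> t0T Dx.
have du k : is_derive t 1 (fun tau => partial k (rho tau) x) (dgrad rho k t x).
  rewrite /dgrad derive1E; apply: derivableP.
  exact: (smooth_derivable_time reg (s := [:: k]) isT t0T Dx).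
have dS : is_derive t 1 (fun tau => eps ^+ 2 + \sum_l partial l (rho tau) x ^+ 2)
    (0 + \sum_l 2 * partial l (rho t) x * dgrad rho l t x).
  apply: (is_derive_add (is_derive_cst (eps ^+ 2) t (1 : R))).
  apply: (is_derive_sums _ (F := fun l tau => partial l (rho tau) x ^+ 2)
    (dF := fun l => 2 * partial l (rho t) x * dgrad rho l t x)) => l.
  have Dl := is_derive_prod (du l) (du l).
  by apply: (is_derive_eq Dl); ring.
have := @is_derive_comp_scalar R R Num.sqrt
  (fun tau => eps ^+ 2 + \sum_l partial l (rho tau) x ^+ 2) t 1 _ _
  (is_derive1_sqrt (S_gt0 (rho t) x)) dS.
have -> : (fun tau => Num.sqrt (eps ^+ 2 + \sum_l partial l (rho tau) x ^+ 2)) =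
    (fun tau => H eps (grad (rho tau) x)).
  by apply/funext => tau; rewrite H_gradE.
move=> DH; apply: (is_derive_eq DH).
rewrite add0r mulr_sumr; apply: eq_bigr => k _; rewrite /gradH /invH; field.
by rewrite gt_eqF// sqrtr_gt0.
Qed.

Let joint (s : seq 'I_d) (t : R) x : (size s <= 1)%N -> 0 < t < T -> D x ->
  {for (t, x), continuous (fun p : R * V => partials s (rho p.1) p.2)}.
Proof.
move=> s1 t0T Dx.
have It : `]0, T[%classic t by rewrite in_ooP.
have s3 : (size s <= 3)%N by rewrite (leq_trans s1).
apply: (continuous_up_to_joint oD _ (smooth_continuous3 reg s3)) => //.
Qed.

Let joint_dgrad k (t : R) x : 0 < t < T -> D x ->
  {for (t, x), continuous (fun p : R * V => dgrad rho k p.1 p.2)}.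
Proof.
move=> t0T Dx; have It : `]0, T[%classic t by rewrite in_ooP.
apply: (continuous_up_to_joint oD _ (smooth_continuous_time reg (s := [:: k]) isT)) => //.
Qed.

Lemma continuous_entropy_rate (t : R) x : 0 < t < T -> D x ->
  {for (t, x), continuous (fun p : R * V => N p.1 p.2)}.
Proof.
move=> t0T Dx.
have cu k := joint (s := [:: k]) isT t0T Dx.
have cq : {for (t, x), continuous (fun p : R * V => invH eps (rho p.1) p.2)}.
  apply: continuousV; first by rewrite gt_eqF// sqrtr_gt0 S_gt0.
  apply: continuous_comp; last exact: sqrt_continuous.
  apply: continuousD; first exact: cst_continuous.
  apply: cvg_big => [|l _]; first exact: add_continuous.
  by under eq_fun do rewrite expr2; exact: cvgM (cu l) (cu l).
apply: cvg_big => [|k _]; first exact: add_continuous.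
by apply: cvgM; [exact: cvgM (cu k) cq|exact: joint_dgrad].
Qed.

Lemma bcont_H_grad (t : R) : 0 <= t <= T ->
  bcont D (fun x => H eps (grad (rho t) x)).
Proof.
move=> tT; have It : `[0, T]%classic t by rewrite in_ccP.
apply: (@bcont_eq _ _ _ oD
    (fun x => Num.sqrt (eps ^+ 2 + \sum_l partial l (rho t) x ^+ 2))).
  by move=> x _; rewrite H_gradE.
apply: (bcont_comp (@sqrt_continuous R)).
apply: bcontD; first exact: bcont_cst.
apply: (bcont_sum _ (F := fun l x => partial l (rho t) x ^+ 2)) => l.
have bl : bcont D (partial l (rho t)).
  apply: (continuous_up_to_bcont adm It (smooth_continuous1 reg (s := [:: l]) isT)).
  exact: (descends_partials sol [:: l]).
by under eq_fun do rewrite expr2; exact: bcontM.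
Qed.

Lemma bounded_H_grad : exists B, forall t x, 0 <= t <= T -> D x ->
  `|H eps (grad (rho t) x)| <= B.
Proof.
have [M uM] : {M : 'I_d -> R | forall k t x, 0 <= t <= T -> D x ->
    `|partial k (rho t) x| <= M k}.
  apply: cid; have /choice[M HM] : forall k : 'I_d, exists B, forall t x,
      0 <= t <= T -> D x -> `|partial k (rho t) x| <= B.
    move=> k; apply: (continuous_up_to_bounded adm _
      (smooth_continuous1 reg (s := [:: k]) isT)) => //.
    exact: (descends_partials sol [:: k]).
  by exists M.
exists (Num.sqrt (eps ^+ 2 + \sum_k M k ^+ 2)) => t x tT Dx.
rewrite H_gradE ger0_norm ?sqrtr_ge0// ler_wsqrtr// lerD2l.
apply: ler_sum => k _; rewrite -(real_normK (num_real (partial k (rho t) x))).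
by rewrite lerXn2r ?nnegrE ?uM// (le_trans _ (uM k t x tT Dx)).
Qed.

Let G (t : R) := (\int[mu]_(x in cell Omega : set (rvec R d)) (H eps (grad (rho t) x))%:E)%E.

(** This continuity reaches the times [0] and [T], at which the equation is not
    assumed. *)
Lemma cvg_integral_H (t : R) (tn : nat -> R) : 0 <= t <= T ->
  (forall n, 0 <= tn n <= T) -> tn @ \oo --> t ->
  (fun n => G (tn n)) @ \oo --> G t.
Proof.
move=> tT tnT tnt; have [B HB] := bounded_H_grad.
have mC := measurable_cell adm.
have [|||||_ _ lim] := @dominated_convergence _ _ _ mu _ mC
  (fun n x => (H eps (grad (rho (tn n)) x))%:E)
  (fun x => (H eps (grad (rho t) x))%:E) (fun=> B%:E); last exact: lim.
- by move=> n; apply/measurable_EFinP; apply: bcont_measurable_cell => //; exact: bcont_H_grad.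
- by apply/measurable_EFinP; apply: bcont_measurable_cell => //; exact: bcont_H_grad.
- apply: aeW => x /cell_sub_points Dx; apply: cvg_EFin; first by apply: nearW.
  have It : `[0, T]%classic t by rewrite in_ccP.
  have tnI : tn n @[n --> \oo] --> within `[0, T]%classic (nbhs t).
    move=> P /= wP; have := tnt _ wP; rewrite /nbhs /= => cP.
    near=> n; have : (`[0, T]%classic (tn n) -> P (tn n)) by near: n; exact: cP.
    by apply; rewrite in_ccP.
  have cu l : partial l (rho (tn n)) x @[n --> \oo] --> partial l (rho t) x.
    have cl := continuous_up_to_time (smooth_continuous1 reg (s := [:: l]) isT) It Dx.
    exact: cvg_comp tnI cl.
  rewrite H_gradE; under eq_fun do rewrite H_gradE.
  apply: (@continuous_cvg _ _ _ _ _ _ Num.sqrt); first exact: sqrt_continuous.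
  apply: cvgD; first exact: cvg_cst.
  apply: cvg_big => [|l _]; first exact: add_continuous.
  by under eq_fun do rewrite expr2; rewrite expr2; exact: cvgM (cu l) (cu l).
- exact: (bcont_integrable adm (bcont_cst _ B)).
- by apply: aeW => x n /cell_sub_points Dx; rewrite lee_fin HB.
Unshelve. all: by end_near. Qed.

Variables (c : R).
Hypothesis c0 : 0 <= c.
Hypothesis rate : {ae lam, forall t, 0 < t < T ->
  (\int[mu]_(x in cell Omega : set (rvec R d))
     (N t x - c / eps * rho t x ^+ 2)%:E <= 0)%E}.

Let kappa (t : R) := (\int[mu]_(x in cell Omega : set (rvec R d))
  (c / eps * rho t x ^+ 2)%:E)%E.

Let oO : open (`]0, T[%classic `*` D : set (R * V)).
Proof.
have -> : `]0, T[%classic `*` D = (fst @^-1` `]0, T[%classic) `&` (snd @^-1` D) by [].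
apply: openI.
  by apply: open_comp => [p _|]; [exact: cvg_fst|exact: interval_open].
by apply: open_comp => [p _|]; [exact: cvg_snd|exact: oD].
Qed.

Let rect_sub (s t : R) : 0 < s -> t < T ->
  `[s, t]%classic `*` cell Omega `<=` `]0, T[%classic `*` D.
Proof.
move=> s0 tT [tau x] [/=]; rewrite !in_itv/= => /andP[stau taut] /cell_sub_points Dx.
by split => //; rewrite (lt_le_trans s0)//= (le_lt_trans taut).
Qed.

Let measurable_rect (f : R * V -> R) (s t : R) : 0 < s -> t < T ->
  (forall t x, 0 < t < T -> D x -> {for (t, x), continuous f}) ->
  measurable_fun (`[s, t]%classic `*` cell Omega : set (measurableTypeR R * rvec R d)) f.
Proof.
move=> s0 tT cf.
apply: (@measurable_funS _ _ (measurableTypeR R * rvec R d)%type _ (`]0, T[%classic `*` D)).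
- exact: open_measurable_prod.
- exact: rect_sub.
- apply: continuous_measurable_prod => // -[tau x]; rewrite inE => -[/=].
  by rewrite in_itv/=; exact: cf.
Qed.

Let sub_oo (s t tau : R) : 0 < s -> t < T -> s <= tau <= t -> 0 < tau < T.
Proof.
by move=> s0 tT /andP[stau taut]; rewrite (lt_le_trans s0)//= (le_lt_trans taut).
Qed.

Let bounded_N (s t : R) : 0 < s -> t < T ->
  exists B, forall tau x, s <= tau <= t -> D x -> `|N tau x| <= B.
Proof.
move=> s0 tT.
have [M uM] : {M : 'I_d -> R | forall k tau x, s <= tau <= t -> D x ->
    `|dgrad rho k tau x| <= M k}.
  apply: cid; have /choice[M HM] : forall k : 'I_d, exists B, forall tau x,
      s <= tau <= t -> D x -> `|dgrad rho k tau x| <= B.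
    move=> k; apply: (continuous_up_to_bounded adm _
      (smooth_continuous_time reg (s := [:: k]) isT)) => //.
      by move=> tau; rewrite in_ooP /= in_itv/=; exact: sub_oo.
    move=> tau /(sub_oo s0 tT) tau0T.
    apply: (descends_time_derivative _ tau0T) => tau' tau'T.
    exact: (descends_partials sol [:: k]).
  by exists M.
exists (\sum_k 1 * M k) => tau x st Dx.
rewrite (le_trans (ler_norm_sum _ _ _))//; apply: ler_sum => k _.
rewrite normrM ler_pM//; last exact: uM.
rewrite -(@expr_le1 _ 2)// real_normK ?num_real//.
apply: le_trans (invH_sqr (rho tau) eps0 x).
rewrite /gradH exprMn mulrC ler_wpM2l ?sqr_ge0//.
by rewrite (bigD1 k)//= lerDl sumr_ge0// => i _; exact: sqr_ge0.
Qed.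

Let bounded_rho : exists B, forall t x, 0 <= t <= T -> D x -> `|rho t x| <= B.
Proof.
apply: (continuous_up_to_bounded adm _ (smooth_continuous1 reg (s := [::]) isT)) => //.
exact: (descends_partials sol [::]).
Qed.

Let bounded_rho2 : exists B, forall t x, 0 <= t <= T -> D x ->
  `|c / eps * rho t x ^+ 2| <= B.
Proof.
have [B rB] := bounded_rho; exists (c / eps * B ^+ 2) => t x tT Dx.
have ce0 : 0 <= c / eps by rewrite divr_ge0// ltW.
rewrite normrM (ger0_norm ce0) ler_wpM2l//.
by rewrite normrX lerXn2r ?nnegrE ?rB// (le_trans _ (rB t x tT Dx)).
Qed.

Let integral_N (s t : R) x : 0 < s -> s < t -> t < T -> D x ->
  (\int[lam]_(tau in `[s, t]) (N tau x)%:E =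
  (H eps (grad (rho t) x))%:E - (H eps (grad (rho s) x))%:E)%E.
Proof.
move=> s0 st tT Dx.
have dH tau : s <= tau <= t -> is_derive tau 1 (fun tau => H eps (grad (rho tau) x)) (N tau x).
  by move=> /(sub_oo s0 tT) tau0T; exact: is_derive_H_grad.
have cH tau : s <= tau <= t -> {for tau, continuous (fun tau => H eps (grad (rho tau) x))}.
  move=> /dH dHt; apply: differentiable_continuous; apply/derivable1_diffP; by case: dHt.
rewrite (@continuous_FTC2 _ _ (fun tau => H eps (grad (rho tau) x))) //.
- apply: continuous_in_subspaceT => tau; rewrite inE /= in_itv/= => /(sub_oo s0 tT) tau0T.
  have cp : (tau', x) @[tau' --> tau] --> (tau, x).
    move=> P [[A B] /= [nA nB] ABP]; apply: filterS nA => tau' Atau'.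
    by apply: ABP; split => //=; exact: nbhs_singleton.
  exact: cvg_comp cp (continuous_entropy_rate tau0T Dx).
- split.
  + move=> tau; rewrite in_itv/= => /andP[stau taut].
    have taust : s <= tau <= t by rewrite !ltW.
    by case: (dH tau taust).
  + by apply/cvg_at_right_filter/cH; rewrite lexx ltW.
  + by apply/cvg_at_left_filter/cH; rewrite lexx ltW.
- move=> tau; rewrite in_itv/= => /andP[stau taut]; rewrite derive1E.
  have taust : s <= tau <= t by rewrite !ltW.
  by case: (dH tau taust).
Qed.

Let measurable_interval (s t : R) :
  measurable (`[s, t]%classic : set (measurableTypeR R)).
Proof. exact: measurable_itv. Qed.

Let interval_lty (s t : R) : (lam `[s, t]%classic < +oo)%E.
Proof.
by rewrite lebesgue_measure_itv/=; case: ifP => _; rewrite ?ltry// -EFinB ltry.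
Qed.

Lemma integrable_integral_sqr (s t : R) : 0 < s -> t < T ->
  lam.-integrable (`[s, t]%classic : set (measurableTypeR R)) kappa.
Proof.
move=> s0 tT; have [Br rB] := bounded_rho2.
have mr : measurable_fun (`[s, t]%classic `*` cell Omega : set (measurableTypeR R * rvec R d))
    (fun p : R * V => c / eps * rho p.1 p.2 ^+ 2).
  apply: measurable_rect => // tau x tau0T Dx.
  apply: cvgM; first exact: cvg_cst.
  under eq_fun do rewrite expr2; rewrite expr2.
  have crho := joint (s := [::]) isT tau0T Dx.
  exact: (cvgM crho crho).
have rB' (p : measurableTypeR R * rvec R d) :
    (`[s, t]%classic `*` cell Omega) p -> `|c / eps * rho p.1 p.2 ^+ 2| <= Br.
  case: p => tau x [/=]; rewrite in_itv/= => /(sub_oo s0 tT)/oo_cc tauT.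
  by move=> /cell_sub_points; exact: rB.
exact: (@integrable_rectangle _ _ _ _ R lam mu _ _ _ Br (measurable_interval s t)
  (measurable_cell adm) (interval_lty s t) (lebesgue_cell_lty adm) mr rB').
Qed.

(** The fundamental theorem of calculus in time at each point, then the exchange
    of the two integrals, reduce the growth to the rates at almost every time. *)
Lemma integral_H_growth (s t : R) : 0 < s -> s < t -> t < T ->
  (G t <= G s + \int[lam]_(tau in `[s, t]) kappa tau)%E.
Proof.
move=> s0 st tT.
have t0T : 0 <= t <= T by rewrite !ltW// (lt_trans s0).
have s0T : 0 <= s <= T by rewrite !ltW// (lt_trans st).
have mC := measurable_cell adm; have Coo := lebesgue_cell_lty adm.
have mI := measurable_interval s t; have Ioo := interval_lty s t.
have iHt := bcont_integrable adm (bcont_H_grad t0T).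
have iHs := bcont_integrable adm (bcont_H_grad s0T).
have [BN NB] := bounded_N s0 tT.
have mN := measurable_rect s0 tT continuous_entropy_rate.
have NB' (p : measurableTypeR R * rvec R d) :
    (`[s, t]%classic `*` cell Omega) p -> `|N p.1 p.2| <= BN.
  by case: p => tau x [/=]; rewrite in_itv/= => tst /cell_sub_points; exact: NB.
have swap := @Fubini_rectangle _ _ _ _ R lam mu _ _ _ BN mI mC Ioo Coo mN NB'.
have iN := @integrable_rectangle _ _ _ _ R lam mu _ _ _ BN mI mC Ioo Coo mN NB'.
have ir := integrable_integral_sqr s0 tT.
have fs : G s \is a fin_num by exact: integrable_fin_num iHs.
rewrite -leeBlDl// /G -(integralB_EFin mC iHt iHs).
have -> : (\int[mu]_(x in cell Omega : set (rvec R d))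
    ((H eps (grad (rho t) x))%:E - (H eps (grad (rho s) x))%:E) =
  \int[mu]_(x in cell Omega : set (rvec R d)) \int[lam]_(tau in `[s, t]) (N tau x)%:E)%E.
  apply: eq_integral => x; rewrite inE => /cell_sub_points Dx.
  by rewrite integral_N.
rewrite -swap; apply: ae_le_integral => //.
have [Z [mZ Z0 sub]] := rate; exists Z; split => // tau /= Htau.
apply: sub => /= Hr; apply: Htau; rewrite in_itv/= => /(sub_oo s0 tT) tau0T.
have := Hr tau0T.
have bN : bcont D (N tau).
  apply: (bcont_sum _ (F := fun k x => gradH eps (rho tau) k x * dgrad rho k tau x)) => k.
  apply: bcontM; last exact: (bcont_dgrad adm sol k tau0T).
  apply: bC1_bcont; apply: (bC1_gradH oD eps0).
    by move=> i; exact: (bC1_space adm sol (s := [:: i])).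
  by move=> i j; exact: (bC1_space adm sol (s := [:: i; j])).
have br : bcont D (fun x => c / eps * rho tau x ^+ 2).
  apply: bcontM; first exact: bcont_cst.
  have b0 := bC1_bcont (bC1_space adm sol (s := [::]) isT tau0T).
  by under eq_fun do rewrite expr2; exact: bcontM.
have iNt := bcont_integrable adm bN; have irt := bcont_integrable adm br.
rewrite (integralB_EFin mC iNt irt).
by rewrite sube_le0.
Qed.

End time.

(** * The estimate *)

Section integrals.
Import HBNNSimple.

(** Comparing the suprema over simple functions that define the integrals covers
    functions of unknown measurability, such as the squared norm of [rho s] as a
    function of [s]. *)
Lemma ge0_le_integral_subset d (T : measurableType d) (R : realType)
    (m : {measure set T -> \bar R}) (A B : set T) (f g : T -> \bar R) :
  A `<=` B -> (forall x, A x -> (0 <= f x)%E) -> (forall x, B x -> (0 <= g x)%E) ->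
  (forall x, A x -> (f x <= g x)%E) ->
  (\int[m]_(x in A) f x <= \int[m]_(x in B) g x)%E.
Proof.
move=> AB f0 g0 fg; rewrite (integral_mkcond A) (integral_mkcond B).
have fA0 x : (0 <= (f \_ A) x)%E by apply: erestrict_ge0.
have gB0 x : (0 <= (g \_ B) x)%E by apply: erestrict_ge0.
rewrite !ge0_integralTE//; apply: ereal_sup_le => _ [k /= kf <-].
exists k => // x.
apply: le_trans (kf x) _; rewrite !patchE; case: ifPn => [|_].
  by rewrite inE => Ax; rewrite mem_set; [exact: fg|exact: AB].
by case: ifPn => // xB; apply: g0; rewrite inE in xB.
Qed.

Lemma cvge_le_add (R : realType) (u w : (\bar R)^nat) (a b x : \bar R) :
  x \is a fin_num -> u @ \oo --> a -> w @ \oo --> b ->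
  (forall n, (w n <= u n + x)%E) -> (b <= a + x)%E.
Proof.
move=> xfin ua wb wux.
have uxa : (fun n => u n + x)%E @ \oo --> (a + x)%E.
  exact: (cvgeD (fin_num_adde_defl _ xfin) ua (cvg_cst _)).
exact: (lee_cvg_to wb uxa (nearW _ wux)).
Qed.

End integrals.

Section Linf.
Context {R : realType} {d : nat}.
Local Notation V := 'rV[R]_d.
Local Notation mu := (lebesgue_rvec d).
Variable Omega : domain R d.
Hypothesis adm : admissible_domain Omega.

Lemma Linf_norm_ge0 (f : V -> R) : (0 <= Linf_norm Omega f)%E.
Proof. exact: Lnorm_ge0. Qed.

Lemma integral_sqr_le_Linf (f : V -> R) (k : R) : 0 <= k ->
  bcont (points Omega) f ->
  (\int[mu]_(x in cell Omega : set (rvec R d)) (k * f x ^+ 2)%:E <=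
   (k * fine (mu (cell Omega : set (rvec R d))))%:E * Linf_norm Omega f ^+ 2)%E.
Proof.
move=> k0 bf; have mC := measurable_cell adm; have Coo := lebesgue_cell_lty adm.
have mCfin : mu (cell Omega : set (rvec R d)) \is a fin_num by rewrite ge0_fin_numE.
have [mu0|mu0] := eqVneq (mu (setT : set (rvec R d))) 0%E.
  have C0 : mu (cell Omega : set (rvec R d)) = 0%E.
    by apply: (subset_measure0 _ measurableT _ mu0).
  rewrite C0 /= mulr0 mul0e.
  rewrite (_ : (\int[mu]_(x in _) _) = 0)%E//.
  rewrite (negligible_integral mC mC _ C0); last first.
    apply: (bcont_integrable adm); apply: bcontM; first exact: bcont_cst.
    by under eq_fun do rewrite expr2; exact: bcontM.
  by rewrite setDv integral_set0.
have muT : (0 < mu (setT : set (rvec R d)))%E by rewrite lt0e mu0/=.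
have [_ [M fM]] := bf.
set l := Linf_norm Omega f.
have lE : l = ess_sup mu (abse \o ((EFin \o (f : rvec R d -> R)) \_ (cell Omega))).
  by rewrite /l /Linf_norm unlock muT.
have l_ge0 : (0 <= l)%E by exact: Linf_norm_ge0.
have l_le : (l <= `|M|%:E)%E.
  rewrite lE; apply/ess_supP; apply: aeW => x /=.
  rewrite patchE; case: ifPn => [|_]; last by rewrite abse0 lee_fin.
  rewrite inE => /cell_sub_points/fM fxM; rewrite lee_fin.
  by rewrite (le_trans fxM)// ler_norm.
have lfin : l \is a fin_num by rewrite ge0_fin_numE// (le_lt_trans l_le)// ltry.
rewrite -(fineK lfin); set l' := fine l.
have ae_le : {ae mu, forall x, cell Omega x ->
    ((k * f x ^+ 2)%:E <= (k * l' ^+ 2)%:E)%E}.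
  have [N [mN N0 sub]] := ess_sup_ge mu
    (abse \o ((EFin \o (f : rvec R d -> R)) \_ (cell Omega))).
  exists N; split => // x /= H; apply: sub => /= fl; apply: H => Cx.
  move: fl; rewrite -lE -(fineK lfin) patchE mem_set//= lee_fin => fl.
  by rewrite lee_fin ler_wpM2l// -(real_normK (num_real (f x))) lerXn2r// nnegrE// (le_trans _ fl).
apply: (@le_trans _ _ (\int[mu]_(x in cell Omega : set (rvec R d)) (k * l' ^+ 2)%:E)%E).
  apply: ae_le_integral => //.
    apply: (bcont_integrable adm); apply: bcontM; first exact: bcont_cst.
    by under eq_fun do rewrite expr2; exact: bcontM.
  exact: (bcont_integrable adm (bcont_cst _ _)).
rewrite integral_cst// -[X in (_ * X <= _)%E](fineK mCfin) -EFinM.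
by rewrite -EFin_expe -EFinM lee_fin mulrAC.
Qed.

End Linf.

Theorem lemmaA4 (R : realType) (d : nat) (Omega : domain R d) (T : R)
    (v : R -> 'rV[R]_d -> 'rV[R]_d) :
  admissible_domain Omega -> 0 <= T -> admissible_field Omega T v ->
  exists C : R, 0 < C /\
    forall eps : R, 0 < eps ->
    forall rho : R -> 'rV[R]_d -> R, FokkerPlanck_solution Omega T v rho ->
    forall t : R, 0 <= t <= T ->
    (\int[lebesgue_rvec d]_(x in cell Omega) (H eps (grad (rho t) x))%:E
     <= \int[lebesgue_rvec d]_(x in cell Omega) (H eps (grad (rho 0%R) x))%:E
        + (C * eps * t)%:E
        + (C / eps)%:E *
          \int[@lebesgue_measure R]_(s in `[0%R, t])
            (Linf_norm Omega (rho s) ^+ 2))%E.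
Proof.
move=> adm T0 field.
have [M vM] := field_bounded field; have [L0 vL0] := field_lipschitz field.
pose L := `|L0|.
have vL (t : R) : 0 <= t <= T -> L.-lipschitz_(points Omega) (v t).
  move=> tT; have := vL0 t tT; move=> vt xy Dxy; apply: le_trans (vt xy Dxy) _.
  by rewrite ler_wpM2r// ler_norm.
pose K := d%:R ^+ 2 * M ^+ 2.
pose c := d%:R ^+ 3 * L ^+ 2 + d%:R * K ^+ 2 / 2.
have c0 : 0 <= c.
  have d0 : 0 <= d%:R :> R by [].
  have := mulr_ge0 (exprn_ge0 3 d0) (sqr_ge0 L).
  by have := mulr_ge0 d0 (sqr_ge0 K); rewrite /c; lra.
pose vol := fine (lebesgue_rvec d (cell Omega : set (rvec R d))).
have vol0 : 0 <= vol by apply: fine_ge0.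
(* The summand 1 makes [C] positive when [c * vol] is [0]. *)
pose C := c * vol + 1.
have C0 : 0 < C by rewrite ltr_wpDl// mulr_ge0.
exists C; split=> // eps eps0 rho sol t /andP[t0 tT].
pose G t := (\int[lebesgue_rvec d]_(x in cell Omega) (H eps (grad (rho t) x))%:E)%E.
pose I := (\int[@lebesgue_measure R]_(s in `[0%R, t]) (Linf_norm Omega (rho s) ^+ 2))%E.
suff : (G t <= G 0%R + (C * eps * t)%:E + (C / eps)%:E * I)%E by [].
have I0 : (0 <= I)%E by apply: integral_ge0 => s _; rewrite expe_ge0// Linf_norm_ge0.
have Ce0 : 0 < C / eps by rewrite divr_gt0.
have CI0 : (0 <= (C / eps)%:E * I)%E by rewrite mule_ge0// lee_fin ltW.
have Cet0 : (0 <= (C * eps * t)%:E)%E by rewrite lee_fin !mulr_ge0// ltW.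
have [tz|tn0] := eqVneq t 0.
  rewrite {1}tz -addeA; apply: leeDl; exact: adde_ge0.
have tp : 0 < t by rewrite lt_neqAle eq_sym tn0.
suff main : (G t <= G 0%R + (C / eps)%:E * I)%E.
  apply: le_trans main _; rewrite addeAC; exact: leeDl.
have rate : {ae @lebesgue_measure R, forall tau, 0 < tau < T ->
  (\int[lebesgue_rvec d]_(x in cell Omega : set (rvec R d))
     (\sum_k gradH eps (rho tau) k x * dgrad rho k tau x
       - c / eps * rho tau x ^+ 2)%:E <= 0)%E}.
  have [Z [mZ Z0 sub]] := sol_equation sol; exists Z; split => // tau /= Htau.
  apply: sub => /= eqn; apply: Htau => tau0T.
  apply: (integral_entropy_rate_le0 adm sol (M := M) (L := L) (K := K)) => //.
  - exact: normr_ge0.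
  - by move=> y Dy; apply: vM => //; exact: oo_cc.
  - by apply: vL; exact: oo_cc.
  - exact: eqn.
have growth (s u : R) : 0 < s -> s < u -> u < T -> u <= t ->
    (G u <= G s + (C / eps)%:E * I)%E.
  move=> s0 su uT ut.
  apply: le_trans (integral_H_growth adm sol eps0 c0 rate s0 su uT) _.
  apply: leeD => //.
  pose kappa tau := (\int[lebesgue_rvec d]_(x in cell Omega : set (rvec R d))
    (c / eps * rho tau x ^+ 2)%:E)%E.
  have kappa0 tau : (0 <= kappa tau)%E.
    apply: integral_ge0 => x _; rewrite lee_fin mulr_ge0 ?sqr_ge0//.
    by rewrite divr_ge0// ltW.
  have mk : measurable_fun (`[s, u]%classic : set (measurableTypeR R)) kappa.
    exact: measurable_int (integrable_integral_sqr adm sol eps0 c0 s0 uT).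
  have -> : (\int[@lebesgue_measure R]_(tau in `[s, u]) kappa tau =
      (C / eps)%:E * \int[@lebesgue_measure R]_(tau in `[s, u])
        (((C / eps)^-1)%:E * kappa tau))%E.
    rewrite ge0_integralZl//; last by rewrite lee_fin invr_ge0 ltW.
    by rewrite muleA -EFinM divff ?gt_eqF// mul1e.
  apply: lee_wpmul2l; first by rewrite lee_fin ltW.
  apply: ge0_le_integral_subset.
  - move=> tau /=; rewrite !in_itv/= => /andP[h1 h2].
    by rewrite (le_trans (ltW s0))//= (le_trans h2).
  - by move=> tau _; rewrite mule_ge0// lee_fin invr_ge0 ltW.
  - by move=> tau _; rewrite expe_ge0// Linf_norm_ge0.
  move=> tau /=; rewrite in_itv/= => /andP[h1 h2].
  have tau0T : 0 < tau < T by rewrite (lt_le_trans s0)//= (le_lt_trans h2).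
  have ce0 : 0 <= c / eps by rewrite divr_ge0// ltW.
  have := integral_sqr_le_Linf adm ce0 (bC1_bcont (bC1_space adm sol (s := [::]) isT tau0T)).
  rewrite -/(kappa tau) => kl.
  apply: (le_trans (lee_wpmul2l _ kl)); first by rewrite lee_fin invr_ge0 ltW.
  rewrite muleA -EFinM -[leRHS]mul1e lee_wpmul2r ?expe_ge0 ?Linf_norm_ge0//.
  rewrite lee_fin ler_pdivrMl// mulr1 mulrAC ler_pM2r ?invr_gt0//.
  by rewrite -/vol /C lerDl.
have T0T : 0 <= (0 : R) <= T by rewrite lexx.
have ttT : 0 <= t <= T by rewrite ltW.
have mC := measurable_cell adm.
have iH0 := bcont_integrable adm (bcont_H_grad adm sol eps T0T).
have fG0 : G 0%R \is a fin_num by exact: integrable_fin_num iH0.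
have [Xoo|Xfin] := eqVneq ((C / eps)%:E * I)%E +oo%E.
  by rewrite Xoo addey ?leey//; case: (G 0%R) fG0.
have {}Xfin : ((C / eps)%:E * I)%E \is a fin_num.
  by rewrite ge0_fin_numE// lt_neqAle Xfin leey.
(* The growth estimate holds between interior times only; it is applied between
   [t / (n + 3)] and [t - t / (n + 3)]. *)
pose sn n := t * (n.+3%:R)^-1; pose un n := t - sn n.
have inv0 : (n.+3%:R : R)^-1 @[n --> \oo] --> (0 : R).
  have := @cvg_harmonic R; rewrite -(cvg_shiftn 2).
  by under [X in X @ _ --> _]eq_fun do rewrite /= addn2.
have sn0 : sn @ \oo --> (0 : R).
  by rewrite -[X in _ --> X](mulr0 t); exact: cvgMl_tmp.
have unt : un @ \oo --> t.
  by rewrite -[X in _ --> X](subr0 t); apply: cvgB => //; exact: cvg_cst.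
have sn_pos n : 0 < sn n by rewrite mulr_gt0// invr_gt0.
have sn_lt n : sn n < un n.
  have k3 : (n.+3%:R : R)^-1 <= 3^-1 by rewrite lef_pV2 ?posrE// ler_nat.
  have := ler_wpM2l (ltW tp) k3; rewrite -/(sn n) /un.
  by move: (sn n) => a ha; lra.
have un_lt n : un n < t by rewrite /un ltrBlDr ltrDl.
have snT n : 0 <= sn n <= T.
  by rewrite ltW//= (le_trans (ltW (sn_lt n)))// (le_trans (ltW (un_lt n))).
have unT n : 0 <= un n <= T.
  by rewrite (le_trans (ltW (sn_pos n)) (ltW (sn_lt n)))/= (le_trans (ltW (un_lt n))).
have Gs : (fun n => G (sn n)) @ \oo --> G 0%R by exact: (cvg_integral_H adm sol).
have Gu : (fun n => G (un n)) @ \oo --> G t by exact: (cvg_integral_H adm sol).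
apply: (cvge_le_add Xfin Gs Gu) => n.
apply: growth; [exact: sn_pos|exact: sn_lt| |exact: ltW (un_lt n)].
exact: lt_le_trans (un_lt n) tT.
Qed.
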